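(* Let $r\ge3$ be an integer, let $q=e^{2\pi i/r}$, and let $u_q\mathfrak{sl}_2$ be the small quantum group. The Kerler--Lyubashenko functor $J_4:4\mathrm{HB}\to u_q\mathfrak{sl}_2\text{-mod}$ satisfies $$J_4\big((S^2\times S^2)\smallsetminus\mathring D^4\big)=(-1)^{r'-1},$$ $$J_4\big((S^2\,\widetilde\times\,S^2)\smallsetminus\mathring D^4\big)=\begin{cases}1&\text{if }r\not\equiv0\bmod4,\\-1&\text{if }r\equiv4\bmod8,\\0&\text{if }r\equiv0\bmod8,\end{cases}$$ where $r'=\frac{r}{\gcd(r,2)}$.
   Context: **Small quantum group.** Let $r'=r/\gcd(r,2)$, $r''=r/\gcd(r,4)$, $\{k\}=q^k-q^{-k}$, $[k]=\{k\}/\{1\}$, $[k]!=[k][k-1]\cdots[1]$. $u_q\mathfrak{sl}_2$ is the $\mathbb{C}$-algebra generated by $K^{\pm1},E,F$ with relations $KEK^{-1}=q^2E$, $KFK^{-1}=q^{-2}F$, $[E,F]=\frac{K-K^{-1}}{q-q^{-1}}$, $K^{r'}=1$, $E^{r'}=F^{r'}=0$. Its Hopf structure is $\Delta(K)=K\otimes K$, $\Delta(E)=E\otimes K+1\otimes E$, $\Delta(F)=F\otimes1+K^{-1}\otimes F$, $\varepsilon(K)=1$, $\varepsilon(E)=\varepsilon(F)=0$, $S(K)=K^{-1}$, $S(E)=-EK^{-1}$, $S(F)=-KF$. The R-matrix is $$R=\frac1{r'}\sum_{a,b,c=0}^{r'-1}\frac{\{1\}^a}{[a]!}q^{\frac{a(a-1)}2-2bc}K^bE^a\otimes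 K^cF^a,$$ the pivotal element is $g=K$, and, writing $R=\sum_iR'_i\otimes R''_i$, the ribbon element is $v_+=uK^{-1}$ with $u=\sum_iS(R''_i)R'_i$ (the twist of the ribbon category $u_q\mathfrak{sl}_2\text{-mod}$ is the action of $v_-=v_+^{-1}$). The chosen left integral is $\lambda(E^aF^bK^c)=\lambda(F^bE^aK^c)=\frac{\sqrt{r''}[r'-1]!}{\{1\}^{r'-1}}\delta_{a,r'-1}\delta_{b,r'-1}\delta_{c,r'-1}$ for $0\le a,b,c\le r'-1$, and the chosen two-sided cointegral is $\Lambda=\frac{\{1\}^{r'-1}}{\sqrt{r''}[r'-1]!}\sum_{a=0}^{r'-1}E^{r'-1}F^{r'-1}K^a$. The adjoint representation $\mathrm{ad}$ (the algebra with action $h\triangleright x=h_{(1)}xS(h_{(2)})$) is the end $\int_VV\otimes V^*$ with $j_V(x)=\sum_i(x\cdot v_i)\otimes f_i$ for dual bases $\{v_i\},\{f_i\}$ of $V,V^*$. **Handlebodies.** $4\mathrm{HB}$ is Bobtcheva--Piergallini's category of connected $4$-dimensional $2$-handlebodies up to $2$-deformation. Endomorphisms of its tensor unit $0$ are connected $4$-dimensional $2$-handlebodies obtained from $D^4$ by attaching $1$- and $2$-handles, up to isotopies of attaching maps, slides of $i$-handles over $i$-handles ($i\le2$), and creation/removal of canceling $0/1$ and $1/2$ pairs. They are presented by Kirby links: dotted $0$-framed unknots stand for $1$-handles, undotted framed components for $2$-handles. $S^2\times S^2$ is the trivial and $S^2\,\widetilde\times\,S^2$ the twisted $S^2$-bundle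 over $S^2$; each has a handle decomposition with one $0$-handle, two $2$-handles, one $4$-handle. Removing the $4$-handle gives the $2$-handlebodies $(S^2\times S^2)\smallsetminus\mathring D^4$, presented by an undotted Hopf link with both framings $0$, and $(S^2\,\widetilde\times\,S^2)\smallsetminus\mathring D^4$, presented, up to a $2$-handle slide, by an undotted $2$-component unlink with framings $+1$ and $-1$. **The functor $J_4$ on endomorphisms of $0$.** (Scalars are identified with endomorphisms of the trivial module.) Let a Kirby link have dotted components $U_1,\dots,U_d$ and undotted components $K_1,\dots,K_k$. Cut all strands crossing the Seifert disc of $U_i$, open up this disc, and bring both of its sides down to the bottom line as the $i$th block of bottom endpoints, whose left half is joined to its right half by nested pairing; cut each $K_s$ at one point brought to the top line, so it becomes the $s$th top arc. Color the arcs by modules $X_1,\dots,X_k$ so that the top endpoints give $X_1\otimes X_1^*\otimes\cdots\otimes X_k\otimes X_k^*$; the $i$th bottom block gives $Y_i\otimes Y_i^*$, with $Y_i$ a tensor product of the $X_s$ and their duals. The Reshetikhin--Turaev evaluation of the resulting tangle composed with $j_{Y_1}\otimes\cdots\otimes j_{Y_d}$ is dinatural in the $X_s$, hence equals $(j_{X_1}\otimes\cdots\otimes j_{X_k})\circ\Phi$ for a unique intertwiner $\Phi:\mathrm{ad}^{\otimes d}\to\mathrm{ad}^{\otimes k}$, and $J_4$ of the handlebody is $\lambda^{\otimes k}\circ\Phi\circ\Lambda^{\otimes d}$. *)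

(* Defs.v *)
From HB Require Import structures.
From mathcomp Require Import all_boot all_order all_algebra.
From mathcomp Require Import mxtens complex ring.
From mathcomp Require Import boolp reals trigo.

Set Implicit Arguments.
Unset Strict Implicit.
Unset Printing Implicit Defensive.

Import Order.TTheory GRing.Theory Num.Theory.
Local Open Scope ring_scope.
Local Open Scope quotient_scope.

(* The associative unital C-algebra with generators G and relations rel. *)
Inductive aterm (C G : Type) : Type :=
| Cst of C
| Gen of G
| Add of aterm C G & aterm C G
| Mul of aterm C G & aterm C G.
Arguments Gen {C G}.
Arguments Cst {C G}.

HB.instance Definition _ C G := gen_eqMixin (aterm C G).
HB.instance Definition _ C G := gen_choiceMixin (aterm C G).

Fixpoint Pow (C : pzRingType) G (t : aterm C G) n : aterm C G :=
  if n is n'.+1 then Mul t (Pow t n') else Cst 1.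

Section Presented.
Variables (C : comPzRingType) (G : Type) (rel : aterm C G -> aterm C G -> Prop).
Local Notation term := (aterm C G).

Inductive acong : term -> term -> Prop :=
| ac_rel t u : rel t u -> acong t u
| ac_refl t : acong t t
| ac_sym t u : acong t u -> acong u t
| ac_trans t u v : acong t u -> acong u v -> acong t v
| ac_add t t' u u' : acong t t' -> acong u u' -> acong (Add t u) (Add t' u')
| ac_mul t t' u u' : acong t t' -> acong u u' -> acong (Mul t u) (Mul t' u')
| ac_addA t u v : acong (Add t (Add u v)) (Add (Add t u) v)
| ac_addC t u : acong (Add t u) (Add u t)
| ac_mulA t u v : acong (Mul t (Mul u v)) (Mul (Mul t u) v)
| ac_mulDl t u v : acong (Mul (Add t u) v) (Add (Mul t v) (Mul u v))
| ac_mulDr t u v : acong (Mul t (Add u v)) (Add (Mul t u) (Mul t v))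
| ac_add0 t : acong (Add (Cst 0) t) t
| ac_mul0 t : acong (Mul (Cst 0) t) (Cst 0)
| ac_mul1 t : acong (Mul (Cst 1) t) t
| ac_cstD c d : acong (Cst (c + d)) (Add (Cst c) (Cst d))
| ac_cstM c d : acong (Cst (c * d)) (Mul (Cst c) (Cst d))
| ac_cstC c t : acong (Mul (Cst c) t) (Mul t (Cst c)).

Definition acongb (t u : term) := `[< acong t u >].

Fact acongb_refl : reflexive acongb.
Proof. by move=> t; apply/asboolP; exact: ac_refl. Qed.
Fact acongb_sym : symmetric acongb.
Proof. by move=> t u; apply/asboolP/asboolP; exact: ac_sym. Qed.
Fact acongb_trans : transitive acongb.
Proof.
by move=> u t v /asboolP tu /asboolP uv; apply/asboolP; exact: ac_trans tu uv.
Qed.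
Canonical acong_equiv := EquivRel acongb acongb_refl acongb_sym acongb_trans.

Definition palg := {eq_quot acong_equiv}.
HB.instance Definition _ := Choice.on palg.
HB.instance Definition _ := EqQuotient.on palg.

Definition pcls (t : term) : palg := \pi_palg t.

Lemma pclsP t u : acong t u <-> pcls t = pcls u.
Proof.
by split=> [tu|/eqmodP/asboolP //]; apply/eqmodP/asboolP.
Qed.

Lemma pclsK x : pcls (repr x) = x. Proof. exact: reprK. Qed.

Lemma acong_repr t : acong (repr (pcls t)) t.
Proof. by apply/pclsP; rewrite pclsK. Qed.

Lemma palgP (P : palg -> Prop) : (forall t, P (pcls t)) -> forall x, P x.
Proof. by move=> h x; rewrite -[x]pclsK. Qed.

Definition padd (x y : palg) := pcls (Add (repr x) (repr y)).
Definition pmul (x y : palg) := pcls (Mul (repr x) (repr y)).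
Definition pscale (c : C) (x : palg) := pcls (Mul (Cst c) (repr x)).
Definition pgen (g : G) : palg := pcls (Gen g).

Lemma paddE t u : padd (pcls t) (pcls u) = pcls (Add t u).
Proof. by apply/pclsP/ac_add; exact: acong_repr. Qed.
Lemma pmulE t u : pmul (pcls t) (pcls u) = pcls (Mul t u).
Proof. by apply/pclsP/ac_mul; exact: acong_repr. Qed.
Lemma pscaleE c t : pscale c (pcls t) = pcls (Mul (Cst c) t).
Proof. by apply/pclsP/ac_mul; [exact: ac_refl|exact: acong_repr]. Qed.

Fact paddA : associative padd.
Proof.
elim/palgP=> t; elim/palgP=> u; elim/palgP=> v.
by rewrite !paddE; apply/pclsP/ac_addA.
Qed.
Fact paddC : commutative padd.
Proof.
by elim/palgP=> t; elim/palgP=> u; rewrite !paddE; apply/pclsP/ac_addC.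
Qed.
Fact padd0 : left_id (pcls (Cst 0)) padd.
Proof. by elim/palgP=> t; rewrite paddE; apply/pclsP/ac_add0. Qed.
Fact paddN : left_inverse (pcls (Cst 0)) (pscale (-1)) padd.
Proof.
elim/palgP=> t; rewrite pscaleE paddE; apply/pclsP.
apply: (ac_trans (u := Mul (Cst (-1 + 1)) t)); last first.
  by rewrite addNr; exact: ac_mul0.
apply: ac_sym; apply: (ac_trans (ac_mul (ac_cstD _ _) (ac_refl _))).
apply: (ac_trans (ac_mulDl _ _ _)).
by apply: ac_add; [exact: ac_refl|exact: ac_mul1].
Qed.
HB.instance Definition _ := GRing.isZmodule.Build palg paddA paddC padd0 paddN.

Fact pmulA : associative pmul.
Proof.
elim/palgP=> t; elim/palgP=> u; elim/palgP=> v.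
by rewrite !pmulE; apply/pclsP/ac_mulA.
Qed.
Fact pmul1 : left_id (pcls (Cst 1)) pmul.
Proof. by elim/palgP=> t; rewrite pmulE; apply/pclsP/ac_mul1. Qed.
Fact pmulr1 : right_id (pcls (Cst 1)) pmul.
Proof.
elim/palgP=> t; rewrite pmulE; apply/pclsP.
by apply: (ac_trans (ac_sym (ac_cstC _ _))); exact: ac_mul1.
Qed.
Fact pmulDl : left_distributive pmul padd.
Proof.
elim/palgP=> t; elim/palgP=> u; elim/palgP=> v.
by rewrite !(paddE, pmulE); apply/pclsP/ac_mulDl.
Qed.
Fact pmulDr : right_distributive pmul padd.
Proof.
elim/palgP=> t; elim/palgP=> u; elim/palgP=> v.
by rewrite !(paddE, pmulE); apply/pclsP/ac_mulDr.
Qed.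
HB.instance Definition _ :=
  GRing.Zmodule_isPzRing.Build palg pmulA pmul1 pmulr1 pmulDl pmulDr.

Fact pscaleA a b x : pscale a (pscale b x) = pscale (a * b) x.
Proof.
elim/palgP: x => t; rewrite !pscaleE; apply/pclsP.
apply: (ac_trans (ac_mulA _ _ _)); apply: ac_mul (ac_refl _).
exact/ac_sym/ac_cstM.
Qed.
Fact pscale1 : left_id 1 pscale.
Proof. by elim/palgP=> t; rewrite pscaleE; apply/pclsP/ac_mul1. Qed.
Fact pscaleDr : right_distributive pscale +%R.
Proof.
move=> c; elim/palgP=> t; elim/palgP=> u; rewrite /GRing.add /=.
by rewrite !(pscaleE, paddE); apply/pclsP/ac_mulDr.
Qed.
Fact pscaleDl x : {morph pscale^~ x : a b / a + b}.
Proof.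
move=> a b; elim/palgP: x => t; rewrite {2}/GRing.add /= !pscaleE paddE.
apply/pclsP; apply: (ac_trans (ac_mul (ac_cstD _ _) (ac_refl _))).
exact: ac_mulDl.
Qed.
HB.instance Definition _ :=
  GRing.Zmodule_isLmodule.Build C palg pscaleA pscale1 pscaleDr pscaleDl.

Fact pscaleAl (c : C) (x y : palg) : c *: (x * y) = (c *: x) * y.
Proof.
rewrite /GRing.mul /GRing.scale /=; elim/palgP: x => t; elim/palgP: y => u.
by rewrite !(pmulE, pscaleE); apply/pclsP/ac_mulA.
Qed.
Fact pscaleAr (c : C) (x y : palg) : c *: (x * y) = x * (c *: y).
Proof.
rewrite /GRing.mul /GRing.scale /=; elim/palgP: x => t; elim/palgP: y => u.
rewrite !(pmulE, pscaleE); apply/pclsP.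
apply: (ac_trans (ac_mulA _ _ _)); apply/ac_sym/(ac_trans (ac_mulA _ _ _)).
exact/ac_mul/ac_refl/ac_sym/ac_cstC.
Qed.
Lemma pclsD t u : pcls (Add t u) = pcls t + pcls u.
Proof. by rewrite /GRing.add /= paddE. Qed.
Lemma pclsM t u : pcls (Mul t u) = pcls t * pcls u.
Proof. by rewrite /GRing.mul /= pmulE. Qed.
Lemma pclsC c : pcls (Cst c) = c *: (1 : palg).
Proof.
rewrite /GRing.scale /GRing.one /= pscaleE; apply/pclsP.
by rewrite -{1}[c]mulr1; exact: ac_cstM.
Qed.
Lemma pclsX t n : pcls (Pow t n) = pcls t ^+ n.
Proof. by elim: n => [|n ih] /=; rewrite ?pclsC ?scale1r// exprS -ih pclsM. Qed.

Section Lift.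
Variables (B : lmodType C) (one : B) (mul : B -> B -> B) (f : G -> B).

Fixpoint aeval (t : term) : B :=
  match t with
  | Cst c => c *: one
  | Gen g => f g
  | Add t u => aeval t + aeval u
  | Mul t u => mul (aeval t) (aeval u)
  end.

(* The morphism to the algebra (B, one, mul) that extends f, for an f that
   satisfies the relations. *)
Definition plift (x : palg) : B := aeval (repr x).

Hypotheses (mul_linl : forall y, linear (mul^~ y)).
Hypotheses (mul_linr : forall x, linear (mul x)).
Hypotheses (mulmA : associative mul).
Hypotheses (mul1m : left_id one mul) (mulm1 : right_id one mul).
Hypothesis f_rel : forall t u, rel t u -> aeval t = aeval u.

Let mulZl c x y : mul (c *: x) y = c *: mul x y.
Proof.
have m0 : mul 0 y = 0.
  by have := mul_linl y (-1) 0 0; rewrite scaler0 addr0 scaleN1r addNr.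
by have := mul_linl y c x 0; rewrite m0 !addr0.
Qed.
Let mulZr c x y : mul x (c *: y) = c *: mul x y.
Proof.
have m0 : mul x 0 = 0.
  by have := mul_linr x (-1) 0 0; rewrite scaler0 addr0 scaleN1r addNr.
by have := mul_linr x c y 0; rewrite m0 !addr0.
Qed.

Lemma aeval_cong t u : acong t u -> aeval t = aeval u.
Proof.
elim=> //=.
- by move=> ? ? ? _ -> _ ->.
- by move=> ? ? ? ? _ -> _ ->.
- by move=> ? ? ? ? _ -> _ ->.
- by move=> *; rewrite addrA.
- by move=> *; rewrite addrC.
- by move=> x y z; have := mul_linl (aeval z) 1 (aeval x) (aeval y);
    rewrite !scale1r.
- by move=> x y z; have := mul_linr (aeval x) 1 (aeval y) (aeval z);
    rewrite !scale1r.
- by move=> *; rewrite scale0r add0r.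
- by move=> *; rewrite mulZl !scale0r.
- by move=> *; rewrite scale1r mul1m.
- by move=> *; rewrite scalerDl.
- by move=> *; rewrite mulZl mul1m scalerA.
- by move=> *; rewrite mulZl mul1m mulZr mulm1.
Qed.

Lemma plift_cls t : plift (pcls t) = aeval t.
Proof. exact/aeval_cong/acong_repr. Qed.

Lemma plift_linear : linear plift.
Proof.
move=> c; elim/palgP=> t; elim/palgP=> u.
have -> : c *: pcls t = pcls (Mul (Cst c) t).
  by rewrite pclsM pclsC -pscaleAl mul1r.
by rewrite -pclsD !plift_cls /= mulZl mul1m.
Qed.

Lemma plift1 : plift 1 = one.
Proof.
have -> : (1 : palg) = pcls (Cst 1) by rewrite pclsC scale1r.
by rewrite plift_cls /= scale1r.
Qed.

Lemma pliftM x y : plift (x * y) = mul (plift x) (plift y).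
Proof. by elim/palgP: x => t; elim/palgP: y => u; rewrite -pclsM !plift_cls. Qed.

Lemma plift_gen g : plift (pgen g) = f g.
Proof. exact: plift_cls. Qed.
End Lift.
End Presented.
Arguments pgen {C G} rel.

Section Tensor.
Variables (C : comPzRingType) (V W : lmodType C).

Inductive tterm : Type :=
| TZero
| TPure of V & W
| TAdd of tterm & tterm
| TScale of C & tterm.

HB.instance Definition _ := gen_eqMixin tterm.
HB.instance Definition _ := gen_choiceMixin tterm.

Inductive tcong : tterm -> tterm -> Prop :=
| tc_refl t : tcong t t
| tc_sym t u : tcong t u -> tcong u t
| tc_trans t u v : tcong t u -> tcong u v -> tcong t v
| tc_add t t' u u' : tcong t t' -> tcong u u' -> tcong (TAdd t u) (TAdd t' u')
| tc_scale c t t' : tcong t t' -> tcong (TScale c t) (TScale c t')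
| tc_addA t u v : tcong (TAdd t (TAdd u v)) (TAdd (TAdd t u) v)
| tc_addC t u : tcong (TAdd t u) (TAdd u t)
| tc_add0 t : tcong (TAdd TZero t) t
| tc_addN t : tcong (TAdd (TScale (-1) t) t) TZero
| tc_scaleA a b t : tcong (TScale a (TScale b t)) (TScale (a * b) t)
| tc_scale1 t : tcong (TScale 1 t) t
| tc_scaleDr a t u : tcong (TScale a (TAdd t u)) (TAdd (TScale a t) (TScale a u))
| tc_scaleDl a b t : tcong (TScale (a + b) t) (TAdd (TScale a t) (TScale b t))
| tc_pureDl v v' w : tcong (TPure (v + v') w) (TAdd (TPure v w) (TPure v' w))
| tc_pureDr v w w' : tcong (TPure v (w + w')) (TAdd (TPure v w) (TPure v w'))
| tc_pureZl c v w : tcong (TPure (c *: v) w) (TScale c (TPure v w))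
| tc_pureZr c v w : tcong (TPure v (c *: w)) (TScale c (TPure v w)).

Definition tcongb (t u : tterm) := `[< tcong t u >].

Fact tcongb_refl : reflexive tcongb.
Proof. by move=> t; apply/asboolP; exact: tc_refl. Qed.
Fact tcongb_sym : symmetric tcongb.
Proof. by move=> t u; apply/asboolP/asboolP; exact: tc_sym. Qed.
Fact tcongb_trans : transitive tcongb.
Proof.
by move=> u t v /asboolP tu /asboolP uv; apply/asboolP; exact: tc_trans tu uv.
Qed.
Canonical tcong_equiv := EquivRel tcongb tcongb_refl tcongb_sym tcongb_trans.

Definition tensor := {eq_quot tcong_equiv}.
HB.instance Definition _ := Choice.on tensor.
HB.instance Definition _ := EqQuotient.on tensor.

Definition tcls (t : tterm) : tensor := \pi_tensor t.
Definition tpure (v : V) (w : W) : tensor := tcls (TPure v w).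

Lemma tclsP t u : tcong t u <-> tcls t = tcls u.
Proof.
by split=> [tu|/eqmodP/asboolP //]; apply/eqmodP/asboolP.
Qed.
Lemma tclsK x : tcls (repr x) = x. Proof. exact: reprK. Qed.
Lemma tcong_repr t : tcong (repr (tcls t)) t.
Proof. by apply/tclsP; rewrite tclsK. Qed.
Lemma tensorP (P : tensor -> Prop) : (forall t, P (tcls t)) -> forall x, P x.
Proof. by move=> h x; rewrite -[x]tclsK. Qed.

Definition tadd (x y : tensor) := tcls (TAdd (repr x) (repr y)).
Definition tscale (c : C) (x : tensor) := tcls (TScale c (repr x)).

Lemma taddE t u : tadd (tcls t) (tcls u) = tcls (TAdd t u).
Proof. by apply/tclsP/tc_add; exact: tcong_repr. Qed.
Lemma tscaleE c t : tscale c (tcls t) = tcls (TScale c t).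
Proof. by apply/tclsP/tc_scale; exact: tcong_repr. Qed.

Fact taddA : associative tadd.
Proof.
elim/tensorP=> t; elim/tensorP=> u; elim/tensorP=> v.
by rewrite !taddE; apply/tclsP/tc_addA.
Qed.
Fact taddC : commutative tadd.
Proof.
by elim/tensorP=> t; elim/tensorP=> u; rewrite !taddE; apply/tclsP/tc_addC.
Qed.
Fact tadd0 : left_id (tcls TZero) tadd.
Proof. by elim/tensorP=> t; rewrite taddE; apply/tclsP/tc_add0. Qed.
Fact taddN : left_inverse (tcls TZero) (tscale (-1)) tadd.
Proof. by elim/tensorP=> t; rewrite tscaleE taddE; apply/tclsP/tc_addN. Qed.
HB.instance Definition _ := GRing.isZmodule.Build tensor taddA taddC tadd0 taddN.

Fact tscaleA a b x : tscale a (tscale b x) = tscale (a * b) x.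
Proof. by elim/tensorP: x => t; rewrite !tscaleE; apply/tclsP/tc_scaleA. Qed.
Fact tscale1 : left_id 1 tscale.
Proof. by elim/tensorP=> t; rewrite tscaleE; apply/tclsP/tc_scale1. Qed.
Fact tscaleDr : right_distributive tscale +%R.
Proof.
move=> c; elim/tensorP=> t; elim/tensorP=> u; rewrite /GRing.add /=.
by rewrite !(tscaleE, taddE); apply/tclsP/tc_scaleDr.
Qed.
Fact tscaleDl x : {morph tscale^~ x : a b / a + b}.
Proof.
move=> a b; elim/tensorP: x => t; rewrite {2}/GRing.add /= !tscaleE taddE.
exact/tclsP/tc_scaleDl.
Qed.
HB.instance Definition _ :=
  GRing.Zmodule_isLmodule.Build C tensor tscaleA tscale1 tscaleDr tscaleDl.

Lemma tpureDl v v' w : tpure (v + v') w = tpure v w + tpure v' w.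
Proof. by rewrite {2}/GRing.add /= taddE; apply/tclsP/tc_pureDl. Qed.
Lemma tpureDr v w w' : tpure v (w + w') = tpure v w + tpure v w'.
Proof. by rewrite {2}/GRing.add /= taddE; apply/tclsP/tc_pureDr. Qed.
Lemma tpureZl c v w : tpure (c *: v) w = c *: tpure v w.
Proof. by rewrite {2}/GRing.scale /= tscaleE; apply/tclsP/tc_pureZl. Qed.
Lemma tpureZr c v w : tpure v (c *: w) = c *: tpure v w.
Proof. by rewrite {2}/GRing.scale /= tscaleE; apply/tclsP/tc_pureZr. Qed.

Lemma tensor_ind (P : tensor -> Prop) :
  (forall v w, P (tpure v w)) -> (forall x y, P x -> P y -> P (x + y)) ->
  (forall c x, P x -> P (c *: x)) -> forall x, P x.
Proof.
move=> Pp PD PZ; elim/tensorP; elim=> [|v w|t Pt u Pu|c t Pt].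
- have -> : tcls TZero = 0 *: tpure 0 0 by rewrite scale0r.
  exact/PZ/Pp.
- exact: Pp.
- by have := PD _ _ Pt Pu; rewrite /GRing.add /= taddE.
- by have := PZ c _ Pt; rewrite /GRing.scale /= tscaleE.
Qed.

Section Lift.
Variables (Z : lmodType C) (f : V -> W -> Z).

Fixpoint teval (t : tterm) : Z :=
  match t with
  | TZero => 0
  | TPure v w => f v w
  | TAdd t u => teval t + teval u
  | TScale c t => c *: teval t
  end.

(* The linear map induced by f, for a bilinear f. *)
Definition tlift (x : tensor) : Z := teval (repr x).

Hypotheses (f_linl : forall w, linear (f^~ w)) (f_linr : forall v, linear (f v)).

Lemma teval_cong t u : tcong t u -> teval t = teval u.
Proof.
have f0l w : f 0 w = 0 by have := f_linl w (-1) 0 0; rewrite scaler0 addr0 scaleN1r addNr.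
have f0r v : f v 0 = 0 by have := f_linr v (-1) 0 0; rewrite scaler0 addr0 scaleN1r addNr.
elim=> //=.
- by move=> ? ? ? _ -> _ ->.
- by move=> ? ? ? ? _ -> _ ->.
- by move=> ? ? ? _ ->.
- by move=> *; rewrite addrA.
- by move=> *; rewrite addrC.
- by move=> *; rewrite add0r.
- by move=> *; rewrite scaleN1r addNr.
- by move=> *; rewrite scalerA.
- by move=> *; rewrite scale1r.
- by move=> *; rewrite scalerDr.
- by move=> *; rewrite scalerDl.
- by move=> v v' w; have := f_linl w 1 v v'; rewrite !scale1r.
- by move=> v w w'; have := f_linr v 1 w w'; rewrite !scale1r.
- by move=> c v w; have := f_linl w c v 0; rewrite f0l !addr0.
- by move=> c v w; have := f_linr v c w 0; rewrite f0r !addr0.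
Qed.

Lemma tlift_cls t : tlift (tcls t) = teval t.
Proof. exact/teval_cong/tcong_repr. Qed.

Lemma tlift_pure v w : tlift (tpure v w) = f v w.
Proof. exact: tlift_cls. Qed.

Lemma tlift_linear : linear tlift.
Proof.
move=> c; elim/tensorP=> t; elim/tensorP=> u.
by rewrite /GRing.scale /GRing.add /= tscaleE taddE !tlift_cls.
Qed.
End Lift.
End Tensor.

Notation "V ⊗ W" := (tensor V W) (at level 40, left associativity) : type_scope.
Notation "v ⊗ w" := (tpure v w) (at level 40, left associativity) : ring_scope.

Section TensorRing.
Variables (C : comPzRingType) (G : Type) (rel : aterm C G -> aterm C G -> Prop).
Local Notation A := (palg rel).
Local Notation T := (tensor A A).

Definition tmul (x y : T) : T :=
  tlift (fun a b : A => tlift (fun c d : A => tpure (a * c) (b * d)) y) x.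

Fact tmul_inner_l (a b d : A) : linear (fun c : A => tpure (a * c) (b * d)).
Proof. by move=> k c c'; rewrite mulrDr -pscaleAr tpureDl tpureZl. Qed.
Fact tmul_inner_r (a b c : A) : linear (fun d : A => tpure (a * c) (b * d)).
Proof. by move=> k d d'; rewrite mulrDr -pscaleAr tpureDr tpureZr. Qed.

Let inner (a b : A) := tlift (fun c d : A => tpure (a * c) (b * d)).

Let inner_pure a b c d : inner a b (tpure c d) = tpure (a * c) (b * d).
Proof. exact/tlift_pure/tmul_inner_r/tmul_inner_l. Qed.

Let inner_lin a b : linear (inner a b).
Proof. exact/tlift_linear/tmul_inner_r/tmul_inner_l. Qed.

Let innerD a b x y : inner a b (x + y) = inner a b x + inner a b y.
Proof. by have := inner_lin a b 1 x y; rewrite !scale1r. Qed.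

Let innerZ a b k x : inner a b (k *: x) = k *: inner a b x.
Proof.
have i0 : inner a b 0 = 0.
  by have := inner_lin a b (-1) 0 0; rewrite scaler0 addr0 scaleN1r addNr.
by have := inner_lin a b k x 0; rewrite i0 !addr0.
Qed.

Let inner_linl y b : linear (fun a => inner a b y).
Proof.
move=> k a a'; elim/tensor_ind: y => [c d|x y hx hy|l x hx].
- by rewrite !inner_pure mulrDl -pscaleAl tpureDl tpureZl.
- by rewrite !innerD hx hy scalerDr addrACA.
- by rewrite !innerZ hx scalerDr !scalerA mulrC.
Qed.

Let inner_linr y a : linear (fun b => inner a b y).
Proof.
move=> k b b'; elim/tensor_ind: y => [c d|x y hx hy|l x hx].
- by rewrite !inner_pure mulrDl -pscaleAl tpureDr tpureZr.
- by rewrite !innerD hx hy scalerDr addrACA.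
- by rewrite !innerZ hx scalerDr !scalerA mulrC.
Qed.

Lemma tmul_linl y : linear (tmul^~ y).
Proof. by apply: tlift_linear => [b|a]; [exact: inner_linl|exact: inner_linr]. Qed.

Let tmul_inner a b y : tmul (tpure a b) y = inner a b y.
Proof.
by apply: tlift_pure => [b'|a']; [exact: inner_linl|exact: inner_linr].
Qed.

Lemma tmul_pure a b c d :
  tmul (tpure a b) (tpure c d) = tpure (a * c) (b * d).
Proof. by rewrite tmul_inner inner_pure. Qed.

Fact tmulDl : left_distributive tmul +%R.
Proof. by move=> x y z; have := tmul_linl z 1 x y; rewrite !scale1r. Qed.

Fact tmulZl k x y : tmul (k *: x) y = k *: tmul x y.
Proof.
have m0 : tmul 0 y = 0.
  by have := tmul_linl y (-1) 0 0; rewrite scaler0 addr0 scaleN1r addNr.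
by have := tmul_linl y k x 0; rewrite m0 !addr0.
Qed.

Fact tmulDr : right_distributive tmul +%R.
Proof.
move=> x y z; elim/tensor_ind: x => [a b|x x' hx hx'|k x hx].
- by rewrite !tmul_inner innerD.
- by rewrite !tmulDl hx hx' addrACA.
- by rewrite !tmulZl hx scalerDr.
Qed.

Fact tmulZr k x y : tmul x (k *: y) = k *: tmul x y.
Proof.
elim/tensor_ind: x => [a b|x x' hx hx'|l x hx].
- by rewrite !tmul_inner innerZ.
- by rewrite !tmulDl hx hx' scalerDr.
- by rewrite !tmulZl hx !scalerA mulrC.
Qed.

Fact tmulA : associative tmul.
Proof.
move=> x y z; elim/tensor_ind: x => [a b|x x' hx hx'|l x hx]; last 2 first.
- by rewrite !tmulDl hx hx'.
- by rewrite !tmulZl hx.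
elim/tensor_ind: y => [c d|y y' hy hy'|l y hy]; last 2 first.
- by rewrite tmulDl !tmulDr tmulDl hy hy'.
- by rewrite !(tmulZl, tmulZr) hy.
elim/tensor_ind: z => [e f|z z' hz hz'|l z hz].
- by rewrite !tmul_pure !mulrA.
- by rewrite !tmulDr hz hz'.
- by rewrite !tmulZr hz.
Qed.

Fact tmul1l : left_id (tpure (1 : A) (1 : A)) tmul.
Proof.
elim/tensor_ind=> [a b|x x' hx hx'|l x hx].
- by rewrite tmul_pure !mul1r.
- by rewrite tmulDr hx hx'.
- by rewrite tmulZr hx.
Qed.

Fact tmul1r : right_id (tpure (1 : A) (1 : A)) tmul.
Proof.
elim/tensor_ind=> [a b|x x' hx hx'|l x hx].
- by rewrite tmul_pure !mulr1.
- by rewrite tmulDl hx hx'.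
- by rewrite tmulZl hx.
Qed.

HB.instance Definition _ :=
  GRing.Zmodule_isPzRing.Build T tmulA tmul1l tmul1r tmulDl tmulDr.

Lemma tpureM (a b c d : A) :
  tpure a b * tpure c d = tpure (a * c) (b * d) :> T.
Proof. exact: tmul_pure. Qed.
Lemma tpureX (a b : A) n : tpure a b ^+ n = tpure (a ^+ n) (b ^+ n) :> T.
Proof. by elim: n => // n ih; rewrite !exprS ih tpureM. Qed.
Lemma tensor_scaleAl (c : C) (x y : T) : c *: (x * y) = (c *: x) * y.
Proof. by rewrite [RHS]tmulZl. Qed.
Lemma tensor_scaleAr (c : C) (x y : T) : c *: (x * y) = x * (c *: y).
Proof. by rewrite [RHS]tmulZr. Qed.
End TensorRing.

Section QuantumInt.
Variables (C : fieldType) (q : C).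
Definition qbrace (k : nat) : C := q ^+ k - q ^- k.
Definition qint (k : nat) : C := qbrace k / qbrace 1.
Definition qfact (k : nat) : C := \prod_(i < k) qint i.+1.
End QuantumInt.

(* The q-binomial formula at a root of unity of the same order. *)
Section QBinomial.
Variables (C : fieldType) (w : C).

Fixpoint gbin (n k : nat) : C :=
  match n, k with
  | _, 0 => 1
  | 0, _.+1 => 0
  | n'.+1, k'.+1 => gbin n' k' + w ^+ k * gbin n' k
  end.

Lemma gbin0 n : gbin n 0 = 1. Proof. by case: n. Qed.

Lemma gbin_gt n k : (n < k)%N -> gbin n k = 0.
Proof.
elim: n k => [|n ih] [|k] //= nk.
by rewrite !ih ?mulr0 ?addr0 // ltnW.
Qed.

Lemma gbinn n : gbin n n = 1.
Proof. by elim: n => //= n ->; rewrite gbin_gt // mulr0 addr0. Qed.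

Let P n : C := \prod_(i < n) (1 - w ^+ i.+1).

Let PS n : P n.+1 = P n * (1 - w ^+ n.+1).
Proof. exact: big_ord_recr. Qed.

Lemma gbin_prod n k : (k <= n)%N -> gbin n k * P k * P (n - k) = P n.
Proof.
elim: n k => [|n ih] [|k]; rewrite ?gbin0 ?subn0 ?mul1r //.
- by move=> _; rewrite /P big_ord0 mulr1.
- by move=> _; rewrite /P big_ord0 mul1r.
rewrite ltnS leq_eqVlt => /predU1P[->|kn].
  by rewrite gbinn subnn /P big_ord0 mul1r mulr1.
rewrite [gbin _ _]/= subSS mulrDl mulrDl.
have -> : gbin n k * P k.+1 * P (n - k) = P n * (1 - w ^+ k.+1).
  by rewrite PS -(ih k (ltnW kn)); rewrite !mulrA; rewrite [_ * P (n - k)]mulrAC.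
have -> : w ^+ k.+1 * gbin n k.+1 * P k.+1 * P (n - k)
  = P n * (w ^+ k.+1 - w ^+ n.+1).
  have -> : P (n - k) = P (n - k.+1) * (1 - w ^+ (n - k)).
    have -> : (n - k = (n - k.+1).+1)%N by rewrite -(subSn kn) subSS.
    exact: PS.
  have -> : w ^+ n.+1 = w ^+ k.+1 * w ^+ (n - k).
    by rewrite -exprD addSn subnKC // ltnW.
  by rewrite -(ih k.+1 kn); ring.
by rewrite -mulrDr addrA subrK PS.
Qed.

Lemma gbin_root n k : n.-primitive_root w -> (0 < k < n)%N -> gbin n k = 0.
Proof.
move=> wn /andP[k0 kn].
have Pneq0 j : (j < n)%N -> P j != 0.
  move=> jn; apply/prodf_neq0 => i _; rewrite subr_eq0 eq_sym.
  rewrite -(prim_order_dvd wn); apply/negP => /dvdn_leq -/(_ isT).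
  by rewrite leqNgt (leq_ltn_trans (ltn_ord i) jn).
have := gbin_prod (ltnW kn).
have -> : P n = 0.
  have n0 := prim_order_gt0 wn.
  by rewrite -(prednK n0) PS (prednK n0) prim_expr_order // subrr mulr0.
move/eqP; rewrite !mulf_eq0 (negPf (Pneq0 _ kn)).
rewrite (negPf (Pneq0 (n - k)%N _)) ?orbF => [/eqP //|].
by rewrite ltn_subrL k0 (leq_trans k0 (ltnW kn)).
Qed.
End QBinomial.

Section QBinomialAlg.
Variables (C : fieldType) (w : C) (G : Type).
Variable (rel : aterm C G -> aterm C G -> Prop).
Local Notation T := (tensor (palg rel) (palg rel)).
Variables (a b : T).
Hypothesis ba : b * a = w *: (a * b).

Let baX k : b * a ^+ k = w ^+ k *: (a ^+ k * b).
Proof.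
elim: k => [|k ih]; first by rewrite !expr0 mulr1 mul1r scale1r.
rewrite [a ^+ k.+1]exprSr mulrA ih -tensor_scaleAl -mulrA ba -tensor_scaleAr.
by rewrite scalerA mulrA -!exprSr.
Qed.

Lemma qbinomial n :
  (a + b) ^+ n = \sum_(k < n.+1) gbin w n k *: (a ^+ k * b ^+ (n - k)).
Proof.
elim: n => [|n ih]; first by rewrite big_ord1 /= scale1r mulr1.
rewrite exprS ih mulr_sumr.
under eq_bigr => k _ do rewrite -tensor_scaleAr mulrDl !mulrA -exprS baX
  -tensor_scaleAl -mulrA -exprS scalerDr scalerA.
rewrite big_split /= [in RHS]big_ord_recl gbin0 scale1r mul1r subn0.
under [in RHS]eq_bigr => k _ do rewrite /= /bump /= add1n subSS scalerDl.
rewrite big_split /= addrCA; congr (_ + _).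
rewrite big_ord_recl gbin0 expr0 mulr1 scale1r mul1r subn0; congr (_ + _).
rewrite [RHS]big_ord_recr /= gbin_gt // mulr0 scale0r addr0.
apply: eq_bigr => k _; rewrite /bump /= add1n mulrC -subSn //.
Qed.

Arguments gbin : simpl never.

Lemma qbinomial_root n : n.-primitive_root w -> (a + b) ^+ n = a ^+ n + b ^+ n.
Proof.
case: n => [/prim_order_gt0 //|n wn].
rewrite qbinomial big_ord_recr gbinn subnn mulr1 scale1r addrC.
congr (_ + _); rewrite big_ord_recl gbin0 scale1r mul1r subn0.
rewrite big1 => [|k _]; first exact: addr0.
by rewrite (gbin_root wn) ?scale0r //= /bump /= add1n ltnS ltn_ord.
Qed.
End QBinomialAlg.

Variant ugen := gK | gKi | gE | gF.

Section SmallQuantumGroup.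
Variables (C : fieldType) (q : C) (p : nat).
Local Notation term := (aterm C ugen).
Local Notation K := (Gen gK : term).
Local Notation K' := (Gen gKi : term).
Local Notation E := (Gen gE : term).
Local Notation F := (Gen gF : term).

Inductive urel : term -> term -> Prop :=
| ur_KKi : urel (Mul K K') (Cst 1)
| ur_KiK : urel (Mul K' K) (Cst 1)
| ur_KEKi : urel (Mul K (Mul E K')) (Mul (Cst (q ^+ 2)) E)
| ur_KFKi : urel (Mul K (Mul F K')) (Mul (Cst (q ^- 2)) F)
| ur_EF : urel (Add (Mul E F) (Mul (Cst (- 1)) (Mul F E)))
               (Mul (Cst (q - q^-1)^-1) (Add K (Mul (Cst (- 1)) K')))
| ur_Kp : urel (Pow K p) (Cst 1)
| ur_Ep : urel (Pow E p) (Cst 0)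
| ur_Fp : urel (Pow F p) (Cst 0).
End SmallQuantumGroup.

Notation uq q p := (palg (urel q p)).

Section Hopf.
Variables (C : fieldType) (q : C) (p : nat).
Local Notation U := (uq q p).
Local Notation UU := (tensor U U).
Local Notation K := (pgen (urel q p) gK).
Local Notation K' := (pgen (urel q p) gKi).
Local Notation E := (pgen (urel q p) gE).
Local Notation F := (pgen (urel q p) gF).

Definition Delta_gen (g : ugen) : UU :=
  match g with
  | gK => K ⊗ K
  | gKi => K' ⊗ K'
  | gE => E ⊗ K + (1 : U) ⊗ E
  | gF => F ⊗ (1 : U) + K' ⊗ F
  end.

Definition counit_gen (g : ugen) : C^o :=
  match g with gK | gKi => 1 | gE | gF => 0 end.

Definition antipode_gen (g : ugen) : U :=
  match g with
  | gK => K'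
  | gKi => K
  | gE => - (E * K')
  | gF => - (K * F)
  end.

Definition Delta : U -> UU := plift (1 : UU) *%R Delta_gen.
Definition counit : U -> C^o := plift (1 : C^o) *%R counit_gen.
(* An algebra morphism to the opposite algebra. *)
Definition antipode : U -> U := plift (1 : U) (fun x y : U => y * x) antipode_gen.

Lemma urelP t u : urel q p t u -> pcls (urel q p) t = pcls (urel q p) u.
Proof. by move=> tu; apply/pclsP/ac_rel. Qed.

Lemma uKKi : K * K' = 1.
Proof. by rewrite -pclsM (urelP (ur_KKi q p)) pclsC scale1r. Qed.
Lemma uKiK : K' * K = 1.
Proof. by rewrite -pclsM (urelP (ur_KiK q p)) pclsC scale1r. Qed.
Lemma uKE : K * E = q ^+ 2 *: (E * K).
Proof.
have := urelP (ur_KEKi q p); rewrite !pclsM pclsC -pscaleAl mul1r => h.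
rewrite pscaleAl -[pgen _ gE in RHS]/(pcls _ (Gen gE)) -h -!mulrA.
by rewrite -/(pgen _ _) uKiK mulr1.
Qed.
Lemma uKF : K * F = q ^- 2 *: (F * K).
Proof.
have := urelP (ur_KFKi q p); rewrite !pclsM pclsC -pscaleAl mul1r => h.
rewrite pscaleAl -[pgen _ gF in RHS]/(pcls _ (Gen gF)) -h -!mulrA.
by rewrite -/(pgen _ _) uKiK mulr1.
Qed.
Lemma uEF : E * F - F * E = (q - q^-1)^-1 *: (K - K').
Proof.
have := urelP (ur_EF q p); rewrite !(pclsM, pclsD) !pclsC -!pscaleAl !mul1r.
by rewrite !scaleN1r.
Qed.
Lemma uKp : K ^+ p = 1.
Proof. by rewrite -pclsX (urelP (ur_Kp q p)) pclsC scale1r. Qed.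
Lemma uEp : E ^+ p = 0.
Proof. by rewrite -pclsX (urelP (ur_Ep q p)) pclsC scale0r. Qed.
Lemma uFp : F ^+ p = 0.
Proof. by rewrite -pclsX (urelP (ur_Fp q p)) pclsC scale0r. Qed.
Lemma uKip : K' ^+ p = 1.
Proof.
have cKK : GRing.comm K K' by rewrite /GRing.comm uKKi uKiK.
by rewrite -[LHS]mul1r -{1}uKp -exprMn_comm // uKKi expr1n.
Qed.

Section Qnz.
Hypothesis q0 : q != 0.
Let q2K : q ^+ 2 * q ^- 2 = 1. Proof. by rewrite mulfV // expf_neq0. Qed.
Let q2Ki : q ^- 2 * q ^+ 2 = 1. Proof. by rewrite mulVf // expf_neq0. Qed.

Lemma uEKi : E * K' = q ^+ 2 *: (K' * E).
Proof.
rewrite -[LHS]mul1r -{1}uKiK -mulrA [K * _]mulrA uKE -pscaleAl -pscaleAr.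
by rewrite -[_ * K * K']mulrA uKKi mulr1.
Qed.
Lemma uFKi : F * K' = q ^- 2 *: (K' * F).
Proof.
rewrite -[LHS]mul1r -{1}uKiK -mulrA [K * _]mulrA uKF -pscaleAl -pscaleAr.
by rewrite -[_ * K * K']mulrA uKKi mulr1.
Qed.

Lemma uKEKi : K * (E * K') = q ^+ 2 *: E.
Proof. by rewrite mulrA uKE -pscaleAl -mulrA uKKi mulr1. Qed.
Lemma uKFKi : K * (F * K') = q ^- 2 *: F.
Proof. by rewrite mulrA uKF -pscaleAl -mulrA uKKi mulr1. Qed.

Let pure0l (x : U) : tpure (0 : U) x = 0.
Proof. by rewrite -(scale0r (0 : U)) tpureZl scale0r. Qed.
Let pure0r (x : U) : tpure x (0 : U) = 0.
Proof. by rewrite -(scale0r (0 : U)) tpureZr scale0r. Qed.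

Lemma Delta_rel : p.-primitive_root (q ^+ 2) ->
  forall t u, urel q p t u ->
  aeval (1 : UU) *%R Delta_gen t = aeval (1 : UU) *%R Delta_gen u.
Proof.
move=> qp t u.
have evX v n : aeval (1 : UU) *%R Delta_gen (Pow v n)
    = aeval (1 : UU) *%R Delta_gen v ^+ n.
  by elim: n => [|n ih]; rewrite /= ?scale1r // ih exprS.
have p0 := prim_order_gt0 qp.
case; rewrite ?evX /= ?scale1r ?scale0r.
- by rewrite tpureM !uKKi.
- by rewrite tpureM !uKiK.
- rewrite mulrDl mulrDr !tpureM mul1r !uKEKi uKKi mulr1.
  by rewrite -tensor_scaleAl mul1r scalerDr tpureZl tpureZr.
- rewrite mulrDl mulrDr !tpureM mul1r !uKFKi uKKi.
  rewrite mulrA uKKi mul1r.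
  by rewrite -tensor_scaleAl mul1r scalerDr tpureZl tpureZr.
- have eKF : tpure (E * K') (K * F) = tpure (K' * E) (F * K) :> UU.
    by rewrite uEKi uKF tpureZl tpureZr scalerA q2K scale1r.
  have eEF : E * F = F * E + (q - q^-1)^-1 *: (K - K') by rewrite -uEF addrC subrK.
  rewrite -!tensor_scaleAl !mul1r !scaleN1r !(mulrDl, mulrDr) !tpureM.
  rewrite !mul1r !mulr1 eKF eEF.
  have aux (V : zmodType) (a x b d g y : V) :
      a + x + b + (d + (g + y)) - (a + d + (b + g)) = x + y.
    apply/eqP; rewrite subr_eq; apply/eqP.
    by rewrite [LHS](AC (3*(1*2)) ((2*6)*((1*4)*(3*5)))).
  have pureNl (x y : U) : tpure (- x) y = - tpure x y :> UU.
    by rewrite -scaleN1r tpureZl scaleN1r.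
  have pureNr (x y : U) : tpure x (- y) = - tpure x y :> UU.
    by rewrite -scaleN1r tpureZr scaleN1r.
  rewrite [tpure (F * E + _) _]tpureDl [tpure K' (F * E + _)]tpureDr aux.
  rewrite tpureZl tpureZr -scalerDr tpureDl tpureDr pureNl pureNr.
  by rewrite addrA subrK.
- by rewrite tpureX uKp.
- rewrite addrC (@qbinomial_root _ (q ^+ 2)) //.
    by rewrite !tpureX uEp pure0l pure0r addr0.
  by rewrite !tpureM mul1r mulr1 uKE tpureZr.
- rewrite (@qbinomial_root _ (q ^+ 2)) //.
    by rewrite !tpureX uFp pure0l pure0r addr0.
  rewrite !tpureM mul1r mulr1 -tpureZl uFKi scalerA q2K scale1r //.
Qed.

Lemma counit_rel : (0 < p)%N -> forall t u, urel q p t u ->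
  aeval (1 : C^o) *%R counit_gen t = aeval (1 : C^o) *%R counit_gen u.
Proof.
move=> p0 t u.
have evX v n : aeval (1 : C^o) *%R counit_gen (Pow v n)
    = aeval (1 : C^o) *%R counit_gen v ^+ n.
  by elim: n => [|n ih]; rewrite /= ?scale1r // ih exprS.
case; rewrite ?evX /= ?scale1r ?scale0r ?expr1n ?expr0n ?(gtn_eqF p0) //.
- by rewrite mulr1.
- by rewrite mulr1.
- by rewrite !(mul0r, mulr0).
- by rewrite !(mul0r, mulr0).
- by rewrite !mulr0 addr0 mulr1 scaleN1r subrr mulr0.
Qed.

Lemma antipode_rel : forall t u, urel q p t u ->
  aeval (1 : U) (fun x y => y * x) antipode_gen t
  = aeval (1 : U) (fun x y => y * x) antipode_gen u.
Proof.
have evX v n : aeval (1 : U) (fun x y => y * x) antipode_gen (Pow v n)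
    = aeval (1 : U) (fun x y => y * x) antipode_gen v ^+ n.
  by elim: n => [|n ih]; rewrite /= ?scale1r // ih exprSr.
have pullX (x y : U) (k : C) n : y * x = k *: (x * y) ->
    exists c : C, (x * y) ^+ n = c *: (x ^+ n * y ^+ n).
  move=> yx; have yX m : y ^+ m * x = k ^+ m *: (x * y ^+ m).
    elim: m => [|m ih]; first by rewrite !expr0 mul1r mulr1 scale1r.
    rewrite exprS -mulrA ih -pscaleAr mulrA yx -pscaleAl scalerA -exprSr.
    by rewrite -mulrA.
  elim: n => [|n [c ih]]; first by exists 1; rewrite !expr0 mulr1 scale1r.
  exists (c * k ^+ n).
  rewrite exprSr ih -pscaleAl.
  have -> : x ^+ n * y ^+ n * (x * y) = k ^+ n *: (x ^+ n.+1 * y ^+ n.+1).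
    rewrite mulrA -[x ^+ n * y ^+ n * x]mulrA yX -pscaleAr -pscaleAl.
    by rewrite [x ^+ n * (x * _)]mulrA -exprSr -mulrA -exprSr.
  by rewrite scalerA.
move=> t u; case; rewrite ?evX /= ?scale1r ?scale0r.
- exact: uKKi.
- exact: uKiK.
- by rewrite mulrN uKEKi -pscaleAr mulr1 mulNr -pscaleAl scalerN.
- by rewrite mulrN mulNr -!mulrA uKFKi -!pscaleAr mulr1 scalerN.
- rewrite -!pscaleAr !mulr1 !scaleN1r !(mulrN, mulNr) !opprK.
  have -> : K * F * (E * K') = F * E.
    rewrite uKF -pscaleAl -mulrA [K * _]mulrA uKE -pscaleAl -mulrA uKKi mulr1.
    by rewrite -pscaleAr scalerA q2Ki scale1r.
  have -> : E * K' * (K * F) = E * F.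
    by rewrite mulrA -[E * K' * K]mulrA uKiK mulr1.
  by rewrite -opprB uEF -scalerN opprB.
- exact: uKip.
- have [|c EK] := pullX E K' (q ^- 2) p.
    by rewrite uEKi scalerA q2Ki scale1r.
  by rewrite exprNn EK uEp mul0r scaler0 mulr0.
- have [|c KF] := pullX K F (q ^+ 2) p.
    by rewrite uKF scalerA q2K scale1r.
  by rewrite exprNn KF uFp mulr0 scaler0 mulr0.
Qed.

Lemma DeltaP : p.-primitive_root (q ^+ 2) ->
  [/\ linear Delta, Delta 1 = 1, {morph Delta : x y / x * y}
    & forall g, Delta (pgen (urel q p) g) = Delta_gen g].
Proof.
move=> qp; have rel := Delta_rel qp.
have linl (y : UU) : linear (fun x : UU => x * y) by exact: tmul_linl.
have linr (x : UU) : linear (fun y : UU => x * y).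
  by move=> c y z; rewrite mulrDr -tensor_scaleAr.
split.
- exact: plift_linear linl linr (@mulrA _) (@mul1r _) (@mulr1 _) rel.
- exact: plift1 linl linr (@mulrA _) (@mul1r _) (@mulr1 _) rel.
- move=> x y.
  exact: pliftM linl linr (@mulrA _) (@mul1r _) (@mulr1 _) rel x y.
- exact: plift_gen linl linr (@mulrA _) (@mul1r _) (@mulr1 _) rel.
Qed.

Lemma counitP : (0 < p)%N ->
  [/\ linear counit, counit 1 = 1, {morph counit : x y / x * y}
    & forall g, counit (pgen (urel q p) g) = counit_gen g].
Proof.
move=> p0; have rel := counit_rel p0.
have linl (y : C^o) : linear (fun x : C^o => x * y).
  by move=> c x z; rewrite mulrDl -scalerAl.
have linr (x : C^o) : linear (fun y : C^o => x * y).
  by move=> c y z; rewrite mulrDr -scalerAr.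
split.
- exact: plift_linear linl linr (@mulrA _) (@mul1r _) (@mulr1 _) rel.
- exact: plift1 linl linr (@mulrA _) (@mul1r _) (@mulr1 _) rel.
- move=> x y.
  exact: pliftM linl linr (@mulrA _) (@mul1r _) (@mulr1 _) rel x y.
- exact: plift_gen linl linr (@mulrA _) (@mul1r _) (@mulr1 _) rel.
Qed.

Lemma antipodeP :
  [/\ linear antipode, antipode 1 = 1,
      forall x y, antipode (x * y) = antipode y * antipode x
    & forall g, antipode (pgen (urel q p) g) = antipode_gen g].
Proof.
have rel := antipode_rel; pose m (x y : U) := y * x.
have linl (y : U) : linear (m^~ y).
  by move=> c x z; rewrite /m mulrDr -pscaleAr.
have linr (x : U) : linear (m x).
  by move=> c y z; rewrite /m mulrDl -pscaleAl.
have mA : associative m by move=> x y z; rewrite /m mulrA.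
split.
- exact: plift_linear linl linr mA (@mulr1 _) (@mul1r _) rel.
- exact: plift1 linl linr mA (@mulr1 _) (@mul1r _) rel.
- by move=> x y; exact: pliftM linl linr mA (@mulr1 _) (@mul1r _) rel x y.
- exact: plift_gen linl linr mA (@mulr1 _) (@mul1r _) rel.
Qed.
End Qnz.
End Hopf.

(* Finite-dimensional modules in coordinates: x acts on the column
   vectors 'cV_n by the matrix uact x. *)
Record umod (C : fieldType) (q : C) (p : nat) := UMod {
  udim : nat;
  uact : uq q p -> 'M[C]_udim;
  uact_linear : linear uact;
  uact1 : uact 1 = 1%:M;
  uactM : forall x y, uact (x * y) = uact x *m uact y
}.

(* (s, true) stands for a strand coloured by the s-th module X_s, and
   (s, false) for one coloured by its dual. *)
Definition strand : Type := (nat * bool)%type.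
Definition flip (a : strand) : strand := (a.1, ~~ a.2).

(* Framed oriented tangle diagrams, read from bottom to top with the blackboard
   framing, so that the twist v_-, the inverse of the ribbon element v_+, enters
   as the value of a positive kink. A generator acts on the leftmost strands; tkeep adds a strand on
   the left. *)
Inductive tangle : seq strand -> seq strand -> Type :=
| tid w : tangle w w
| tcomp u v w : tangle v w -> tangle u v -> tangle u w
| tkeep a u v : tangle u v -> tangle (a :: u) (a :: v)
| tpos a b w : tangle (a :: b :: w) (b :: a :: w)
| tneg a b w : tangle (a :: b :: w) (b :: a :: w)
| tev s w : tangle ((s, false) :: (s, true) :: w) w
| tev' s w : tangle ((s, true) :: (s, false) :: w) w
| tcoev s w : tangle w ((s, true) :: (s, false) :: w)
| tcoev' s w : tangle w ((s, false) :: (s, true) :: w).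

Definition tcup (a : strand) w : tangle w (a :: flip a :: w) :=
  match a with (s, true) => tcoev s w | (s, false) => tcoev' s w end.

(* dualcat y w is the dual of the word y (reversed and flipped) followed by w. *)
Fixpoint dualcat (y w : seq strand) : seq strand :=
  if y is a :: y' then dualcat y' (flip a :: w) else w.

(* The nested cups that join y to its dual. *)
Fixpoint cups (y w : seq strand) : tangle w (y ++ dualcat y w) :=
  match y with
  | [::] => tid w
  | a :: y' => tcomp (tkeep a (cups y' (flip a :: w))) (tcup a w)
  end.

(* The object Y_1 ⊗ Y_1^* ⊗ ... ⊗ Y_d ⊗ Y_d^* . *)
Fixpoint blocks (Y : seq (seq strand)) : seq strand :=
  if Y is y :: Y' then y ++ dualcat y (blocks Y') else [::].

Definition arcs (k : nat) : seq (seq strand) :=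
  [seq [:: (s, true)] | s <- iota 0 k].

(* A Kirby link opened along its 1-handles and 2-handles: kdot lists, for each
   dotted component, the strands that cross its disc, and closing the s-th pair
   of top endpoints of ktan by an arc, and each bottom block by nested arcs
   through the corresponding dotted circle, gives back the link. The strands
   with label s are meant to be those of the s-th undotted component, that is,
   to form a single arc once the bottom is closed. *)
Record kirby := Kirby {
  kund : nat;
  kdot : seq (seq strand);
  ktan : tangle (blocks kdot) (blocks (arcs kund))
}.

Section J4.
Variables (C : fieldType) (q : C) (p : nat) (sqrtp'' : C).
Local Notation U := (uq q p).
Local Notation UU := (tensor U U).
Local Notation K := (pgen (urel q p) gK).
Local Notation K' := (pgen (urel q p) gKi).
Local Notation E := (pgen (urel q p) gE).
Local Notation F := (pgen (urel q p) gF).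

Definition Rmat : UU :=
  p%:R^-1 *: \sum_(a < p) \sum_(b < p) \sum_(c < p)
    (qbrace q 1 ^+ a / qfact q a * (q ^+ (a * a.-1)./2 / q ^+ (2 * b * c)))
      *: ((K ^+ b * E ^+ a : U) ⊗ (K ^+ c * F ^+ a : U)).

Section Evaluation.
Variable X : nat -> umod q p.

Definition sdim (a : strand) : nat := udim (X a.1).

Definition sact (a : strand) (x : U) : 'M[C]_(sdim a) :=
  if a.2 then uact (X a.1) x else (uact (X a.1) (antipode x))^T.

Fixpoint wdim (w : seq strand) : nat :=
  if w is a :: w' then (sdim a * wdim w')%N else 1%N.

Lemma wdim_cat v w : wdim (v ++ w) = (wdim v * wdim w)%N.
Proof. by elim: v => [|a v ih] /=; rewrite ?mul1n // ih mulnA. Qed.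

(* The action on a tensor product, through the iterated coproduct. *)
Fixpoint wact (w : seq strand) : U -> 'M[C]_(wdim w) :=
  match w with
  | [::] => fun x => (counit x : C)%:M
  | a :: w' => fun x => tlift (fun y z : U => sact a y *t wact w' z) (Delta x)
  end.

Definition swapmx (m n : nat) : 'M[C]_(n * m, m * n) :=
  \matrix_(i < n * m, j < m * n)
    [&& (mxtens_unindex i).1 == (mxtens_unindex j).2
      & (mxtens_unindex i).2 == (mxtens_unindex j).1]%:R.

Definition Ract (a b : strand) : 'M[C]_(sdim a * sdim b) :=
  tlift (fun x y : U => sact a x *t sact b y) Rmat.

(* c_(V,W) = flip \o R, and the inverse of c_(W,V). *)
Definition braiding (a b : strand) : 'M[C]_(sdim b * sdim a, sdim a * sdim b) :=
  swapmx (sdim a) (sdim b) *m Ract a b.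

Definition braiding_inv (a b : strand) :
    'M[C]_(sdim b * sdim a, sdim a * sdim b) :=
  invmx (Ract b a) *m swapmx (sdim a) (sdim b).

(* The left pairings, and the right ones, twisted by the pivotal element K. *)
Section Duality.
Variable s : nat.
Local Notation n := (udim (X s)).
Definition evmx : 'rV[C]_(n * n) :=
  \row_(j < n * n) ((mxtens_unindex j).1 == (mxtens_unindex j).2)%:R.
Definition evmx' : 'rV[C]_(n * n) :=
  \row_(j < n * n) uact (X s) K (mxtens_unindex j).2 (mxtens_unindex j).1.
Definition coevmx : 'cV[C]_(n * n) :=
  \col_(i < n * n) ((mxtens_unindex i).1 == (mxtens_unindex i).2)%:R.
Definition coevmx' : 'cV[C]_(n * n) :=
  \col_(i < n * n) uact (X s) K' (mxtens_unindex i).2 (mxtens_unindex i).1.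
End Duality.

Definition head22 m n m' n' d (M : 'M[C]_(m * n, m' * n')) :
    'M[C]_(m * (n * d), m' * (n' * d)) :=
  castmx (esym (mulnA m n d), esym (mulnA m' n' d)) (M *t (1%:M : 'M_d)).

Definition head02 m' n' d (M : 'rV[C]_(m' * n')) : 'M[C]_(d, m' * (n' * d)) :=
  castmx (mul1n d, esym (mulnA m' n' d)) (M *t (1%:M : 'M_d)).

Definition head20 m n d (M : 'cV[C]_(m * n)) : 'M[C]_(m * (n * d), d) :=
  castmx (esym (mulnA m n d), mul1n d) (M *t (1%:M : 'M_d)).

Fixpoint RT u v (T : tangle u v) : 'M[C]_(wdim v, wdim u) :=
  match T with
  | tid w => 1%:M
  | tcomp _ _ _ T2 T1 => RT T2 *m RT T1
  | tkeep a _ _ T => (1%:M : 'M_(sdim a)) *t RT T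
  | tpos a b w => head22 (wdim w) (braiding a b)
  | tneg a b w => head22 (wdim w) (braiding_inv a b)
  | tev s w => head02 (wdim w) (evmx s)
  | tev' s w => head02 (wdim w) (evmx' s)
  | tcoev s w => head20 (wdim w) (coevmx s)
  | tcoev' s w => head20 (wdim w) (coevmx' s)
  end.
End Evaluation.

Fixpoint tpow (n : nat) : lmodType C :=
  if n is n'.+1 then tensor U (tpow n') else C^o.

Fixpoint tpowx (x : U) (n : nat) : tpow n :=
  match n with 0 => (1 : C^o) | n'.+1 => tpure x (tpowx x n') end.

Definition adact (h x : U) : U :=
  tlift (fun h1 h2 : U => h1 * x * antipode h2) (Delta h).

(* The action of U on the tensor powers of the adjoint representation. *)
Fixpoint adpow (n : nat) (h : U) : tpow n -> tpow n :=
  match n with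
  | 0 => fun c : C^o => (counit h * c : C^o)
  | n'.+1 => fun t =>
      tlift (fun h1 h2 : U =>
        tlift (fun (x : U) (t' : tpow n') => tpure (adact h1 x) (adpow h2 t')) t)
        (Delta h)
  end.

(* j_(Y_1) ⊗ ... ⊗ j_(Y_d) *)
Fixpoint jmap (X : nat -> umod q p) (Y : seq (seq strand)) :
    tpow (size Y) -> 'cV[C]_(wdim X (blocks Y)) :=
  match Y with
  | [::] => fun c : C^o => (c : C)%:M
  | y :: Y' => fun t =>
      tlift (fun (x : U) (t' : tpow (size Y')) =>
        castmx (esym (wdim_cat X y (dualcat y (blocks Y'))),
                esym (wdim_cat X y (dualcat y (blocks Y'))))
          (wact X y x *t 1%:M)
        *m RT X (cups y (blocks Y')) *m jmap X t') t
  end.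

Definition normalization : C := sqrtp'' * qfact q p.-1 / qbrace q 1 ^+ p.-1.

Definition chosen_integral (lam : U -> C) : Prop :=
  forall a b c : 'I_p,
    let v := normalization *+ [&& a == p.-1 :> nat, b == p.-1 :> nat
                                & c == p.-1 :> nat] in
    lam (E ^+ a * F ^+ b * K ^+ c) = v /\ lam (F ^+ b * E ^+ a * K ^+ c) = v.

Definition cointegral : U :=
  normalization^-1 *: \sum_(a < p) E ^+ p.-1 * F ^+ p.-1 * K ^+ a.

Fixpoint lampow (lam : U -> C) (n : nat) : tpow n -> C :=
  match n with
  | 0 => fun c : C^o => c
  | n'.+1 => fun t =>
      tlift (fun (x : U) (t' : tpow n') => (lam x * lampow lam t' : C^o)) t
  end.

(* J4_eval D z holds when the intertwiner Phi exists and z is the resulting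
   scalar; lam and Phi are determined by their defining properties, so that at
   most one z qualifies. *)
Definition J4_eval (D : kirby) (z : C) : Prop :=
  exists (lam : {scalar U})
         (Phi : {linear tpow (size (kdot D)) -> tpow (size (arcs (kund D)))}),
  [/\ chosen_integral lam,
      forall h t, Phi (adpow h t) = adpow h (Phi t),
      forall (X : nat -> umod q p) t,
        RT X (ktan D) *m jmap X t = jmap X (Phi t)
    & z = lampow lam (Phi (tpowx cointegral _))].
End J4.

(* A kink of framing 1 (resp. -1) on an upward strand. *)
Definition poskink s w : tangle ((s, true) :: w) ((s, true) :: w) :=
  tcomp (tkeep (s, true) (tev' s w))
    (tcomp (tpos (s, true) (s, true) ((s, false) :: w))
       (tkeep (s, true) (tcoev s w))).

Definition negkink s w : tangle ((s, true) :: w) ((s, true) :: w) :=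
  tcomp (tkeep (s, true) (tev' s w))
    (tcomp (tneg (s, true) (s, true) ((s, false) :: w))
       (tkeep (s, true) (tcoev s w))).

(* The Hopf link with both framings 0, opened at the top of both components:
   the second leg of the first cup and the first leg of the second one cross
   twice, and the components have no self-crossing. *)
Definition hopf_tangle : tangle (blocks [::]) (blocks (arcs 2)) :=
  let w := [:: (1%N, false)] in
  tcomp (tkeep (0%N, true)
           (tcomp (tpos (1%N, true) (0%N, false) w)
                  (tpos (0%N, false) (1%N, true) w)))
    (tcomp (tcoev 0 [:: (1%N, true); (1%N, false)]) (tcoev 1 [::])).

(* The unlink with framings 1 and -1, opened in the same way. *)
Definition unlink_tangle : tangle (blocks [::]) (blocks (arcs 2)) :=
  let w := [:: (1%N, true); (1%N, false)] in
  tcomp (poskink 0 ((0%N, false) :: w))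
    (tcomp (tcoev 0 w) (tcomp (negkink 1 [:: (1%N, false)]) (tcoev 1 [::]))).

(* The complement of an open ball in S^2 x S^2. *)
Definition S2xS2_minus_ball : kirby := Kirby hopf_tangle.

(* The complement of an open ball in the twisted S^2-bundle over S^2. *)
Definition S2twS2_minus_ball : kirby := Kirby unlink_tangle.
Definition root_e2pi (R : realType) (r : nat) : R[i] :=
  (cos (2 * pi / r%:R) +i* sin (2 * pi / r%:R))%C.

Definition J4 (R : realType) (r : nat) : kirby -> R[i] -> Prop :=
  J4_eval (root_e2pi R r) (r %/ gcdn r 2)
    ((Num.sqrt (r %/ gcdn r 4)%:R)%:C)%C.

(* Main.v *)
(**
Neither handlebody has a 1-handle, so the intertwiner Phi is c |-> c M for one
ad-invariant M in U ⊗ U, and J_4 is (λ ⊗ λ)(M). Reading off the tangles gives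
M = (S ⊗ 1)(R_21 R) for the Hopf link and M = x ⊗ y for the unlink, where
x = sum R'' K R' and y = sum Rbar' K Rbar'' (with Rbar = R^-1) are the central
elements by which the kinks act. The invariance of M follows from
R Δ(h) = Δ^op(h) R.

The integral λ is a combination of matrix coefficients of the p^2-dimensional
modules U ⊗ C_m induced from the characters of the subalgebra generated by K.
This proves its existence, and it shows that (λ ⊗ λ)(M) depends only on the
action of M on modules, whence the uniqueness of the value.

As λ sees only the terms with E^(p-1) and F^(p-1), it remains to evaluate
sums of powers of w = q^2. For the Hopf link one gets
sum_(b,c) w^(1+2c-2b-2bc), which counts the b with 2b = 0 modulo p. For the
unlink one gets |sum_b w^(b^2+b)|^2 = p sum_(2b = 0) w^(b^2+b), which vanishes
when 8 divides r and produces the sign when r = 4 modulo 8.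
*)

Require Import Defs.
From HB Require Import structures.
From mathcomp Require Import all_boot all_order all_algebra.
From mathcomp Require Import mxtens complex ring.
From mathcomp Require Import boolp reals trigo.

Set Implicit Arguments.
Unset Strict Implicit.
Unset Printing Implicit Defensive.

Import Order.TTheory GRing.Theory Num.Theory.
Local Open Scope ring_scope.

(** * Linear and bilinear maps *)

(** U is a quotient of terms by a congruence, so no basis is at hand. That the monomials E^a F^b K^c
    span U gives the uniqueness of λ; its existence has to come from explicit modules, one for each
    of the p characters of K, and averaging over these characters isolates a single power of K. For
    the same reason Phi is compared with M only through modules. Maps out of U ⊗ U come from
    [tlift], whose rules hold for bilinear arguments, and identities are checked on generators and
    pure tensors.

    R is split into a Cartan factor and a quasi-R-matrix, since each has a simple exchange rule with
    the generators. An explicit inverse of R is required because negative crossings are interpreted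
    through [invmx].

    The constants cancel as follows. In both links λ meets only the term a = p-1 of R, whose
    coefficient cancels the normalization of λ up to s = sqrt(r''), a sign and a power of q. What
    remains is s^2/p, equal to 1 if p is odd and to 1/2 if p is even: the inverse of the number of b
    modulo p with 2b = 0. *)

Section Linear.
Variables (C : comPzRingType) (V W : lmodType C) (f : V -> W).
Hypothesis f_lin : linear f.
Let lf : {linear V -> W} := HB.pack f (GRing.isLinear.Build C V W *:%R f f_lin).

Lemma lin0 : f 0 = 0. Proof. exact: (raddf0 lf). Qed.
Lemma linD x y : f (x + y) = f x + f y. Proof. exact: (raddfD lf). Qed.
Lemma linN x : f (- x) = - f x. Proof. exact: (raddfN lf). Qed.
Lemma linB x y : f (x - y) = f x - f y. Proof. exact: (raddfB lf). Qed.
Lemma linZ c x : f (c *: x) = c *: f x.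
Proof. by have := f_lin c x 0; rewrite lin0 !addr0. Qed.
Lemma lin_sum I (r : seq I) (P : pred I) F :
  f (\sum_(i <- r | P i) F i) = \sum_(i <- r | P i) f (F i).
Proof. exact: (raddf_sum lf). Qed.
End Linear.

Lemma comp_lin (C : comPzRingType) (V W Z : lmodType C) (g : W -> Z) (f : V -> W) :
  linear g -> linear f -> linear (fun x => g (f x)).
Proof. by move=> gl fl k x y; rewrite fl gl. Qed.

Section Bilinear.
Variables (C : comPzRingType) (V W Z : lmodType C).

Definition bilin (f : V -> W -> Z) :=
  (forall w, linear (f^~ w)) /\ (forall v, linear (f v)).

Variable f : V -> W -> Z.
Hypothesis fb : bilin f.

Lemma tliftE v w : tlift f (tpure v w) = f v w.
Proof. exact: tlift_pure fb.1 fb.2 _ _. Qed.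
Lemma tliftL : linear (tlift f). Proof. exact: tlift_linear fb.1 fb.2. Qed.
End Bilinear.

Lemma tpure_bilin (C : comPzRingType) (V W : lmodType C) : bilin (@tpure C V W).
Proof.
by split=> [w k v v'|v k w w']; rewrite ?tpureDl ?tpureZl ?tpureDr ?tpureZr.
Qed.

Lemma eq_bilin (C : comPzRingType) (V W Z : lmodType C) (f g : V -> W -> Z) :
  (forall v w, f v w = g v w) -> bilin f -> bilin g.
Proof.
by move=> fg [fl fr]; split=> [w k v v'|v k w w']; rewrite -!fg ?fl ?fr.
Qed.

Lemma bilin_comp (C : comPzRingType) (V V' W W' Z : lmodType C)
    (h : V' -> W' -> Z) (f : V -> V') (g : W -> W') :
  bilin h -> linear f -> linear g -> bilin (fun v w => h (f v) (g w)).
Proof.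
by move=> [hl hr] fl gl; split=> [w k v v'|v k w w']; rewrite ?fl ?gl ?hl ?hr.
Qed.

Lemma eq_tlinear (C : comPzRingType) (V W Z : lmodType C) (f g : tensor V W -> Z) :
  linear f -> linear g -> (forall v w, f (tpure v w) = g (tpure v w)) -> f =1 g.
Proof.
move=> fl gl fg; elim/tensor_ind => [//|x y fx fy|c x fx].
  by rewrite (linD fl) (linD gl) fx fy.
by rewrite (linZ fl) (linZ gl) fx.
Qed.

Lemma id_lin (C : comPzRingType) (V : lmodType C) : linear (@id V).
Proof. by []. Qed.

Section PAlgLinear.
Variables (C : comPzRingType) (G : Type) (rel : aterm C G -> aterm C G -> Prop).
Local Notation A := (palg rel).

Lemma mul_bilin : bilin (fun x y : A => x * y).
Proof.
by split=> [w k v v'|v k w w']; rewrite ?mulrDl ?mulrDr -?pscaleAl -?pscaleAr.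
Qed.
Lemma mull_lin (a : A) : linear (fun x : A => a * x).
Proof. exact: mul_bilin.2. Qed.
Lemma mulr_lin (a : A) : linear (fun x : A => x * a).
Proof. exact: mul_bilin.1. Qed.
Lemma mullr_lin (a b : A) : linear (fun x : A => a * x * b).
Proof. exact: (comp_lin (mulr_lin b) (mull_lin a)). Qed.

Lemma tmul_bilin : bilin (fun x y : tensor A A => x * y).
Proof.
split=> [w k v v'|v k w w']; rewrite ?mulrDl ?mulrDr -?tensor_scaleAl //.
by rewrite -tensor_scaleAr.
Qed.

Lemma palg_ind (P : A -> Prop) :
  (forall c : C, P (c *: (1 : A))) -> (forall g, P (pgen rel g)) ->
  (forall x y, P x -> P y -> P (x + y)) ->
  (forall x y, P x -> P y -> P (x * y)) -> forall x, P x.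
Proof.
move=> P1 Pg PD PM; elim/palgP; elim=> [c|g|t Pt u Pu|t Pt u Pu].
- by rewrite pclsC.
- exact: Pg.
- by rewrite pclsD; apply: PD.
- by rewrite pclsM; apply: PM.
Qed.
End PAlgLinear.

(** * Tensor powers of the adjoint representation *)

Section SmallQG.
Variables (C : fieldType) (q : C) (p : nat).
Hypothesis qp : p.-primitive_root (q ^+ 2).
Local Notation U := (uq q p).
Local Notation UU := (tensor U U).
Local Notation K := (pgen (urel q p) gK).
Local Notation K' := (pgen (urel q p) gKi).
Local Notation E := (pgen (urel q p) gE).
Local Notation F := (pgen (urel q p) gF).
Local Notation Delta := (@Delta C q p).
Local Notation counit := (@counit C q p).
Local Notation antipode := (@antipode C q p).

Lemma p_gt0 : (0 < p)%N. Proof. exact: prim_order_gt0 qp. Qed.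

Lemma q_neq0 : q != 0.
Proof.
apply/eqP=> q0; have := prim_expr_order qp.
rewrite q0 expr0n /= expr0n; case: p p_gt0 => //= n _ /eqP.
by rewrite eq_sym oner_eq0.
Qed.

Lemma Delta_lin : linear Delta. Proof. by case: (DeltaP q_neq0 qp). Qed.
Lemma Delta1 : Delta 1 = 1. Proof. by case: (DeltaP q_neq0 qp). Qed.
Lemma DeltaM : {morph Delta : x y / x * y}.
Proof. by case: (DeltaP q_neq0 qp). Qed.
Lemma Delta_genE g : Delta (pgen _ g) = Delta_gen q p g.
Proof. by case: (DeltaP q_neq0 qp). Qed.
Lemma counit_lin : linear counit. Proof. by case: (counitP q p_gt0). Qed.
Lemma counit1 : counit 1 = 1. Proof. by case: (counitP q p_gt0). Qed.
Lemma counitM : {morph counit : x y / x * y}.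
Proof. by case: (counitP q p_gt0). Qed.
Lemma counit_genE g : counit (pgen _ g) = counit_gen C g.
Proof. by case: (counitP q p_gt0). Qed.
Lemma antipode_lin : linear antipode. Proof. by case: (antipodeP p q_neq0). Qed.
Lemma antipode1 : antipode 1 = 1. Proof. by case: (antipodeP p q_neq0). Qed.
Lemma antipodeM x y : antipode (x * y) = antipode y * antipode x.
Proof. by case: (antipodeP p q_neq0). Qed.
Lemma antipode_genE g : antipode (pgen _ g) = antipode_gen q p g.
Proof. by case: (antipodeP p q_neq0). Qed.

Lemma antipodeX x n : antipode (x ^+ n) = antipode x ^+ n.
Proof.
by elim: n => [|n ih]; rewrite ?expr0 ?antipode1 // exprS antipodeM ih -exprSr.
Qed.

Lemma scale_counit_bilin (V : lmodType C) :
  bilin (fun (x : V) (y : U) => (counit y : C) *: x).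
Proof.
split=> [w k v v'|v k w w'].
  by rewrite scalerDr !scalerA mulrC.
by rewrite counit_lin scalerDl -scalerA.
Qed.

(** The map id ⊗ ε is multiplicative on U ⊗ U, so both sides are algebra morphisms in [x] and the
    generators suffice. *)
Lemma counit_Delta (x : U) :
  tlift (fun y z : U => (counit z : C) *: y) (Delta x) = x.
Proof.
have bl := scale_counit_bilin U; have L := tliftL bl.
have tM (s t : UU) : tlift (fun y z : U => (counit z : C) *: y) (s * t) =
  tlift (fun y z : U => (counit z : C) *: y) s *
  tlift (fun y z : U => (counit z : C) *: y) t.
  elim/tensor_ind: s => [a b|s s' hs hs'|c s hs].
  - elim/tensor_ind: t => [a' b'|t t' ht ht'|c t ht].
    + by rewrite tpureM !tliftE // counitM -pscaleAl -pscaleAr scalerA.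
    + by rewrite mulrDr !(linD L) ht ht' mulrDr.
    + by rewrite -tensor_scaleAr !(linZ L) ht pscaleAr.
  - by rewrite mulrDl !(linD L) hs hs' mulrDl.
  - by rewrite -tensor_scaleAl !(linZ L) hs pscaleAl.
elim/palg_ind: x => [c|g|x y hx hy|x y hx hy].
- by rewrite (linZ Delta_lin) Delta1 (linZ L) tliftE // counit1 scale1r.
- rewrite Delta_genE; case: g; rewrite /= ?(linD L) !tliftE // ?counit1 !counit_genE /=;
    by rewrite ?scale1r ?scale0r ?addr0.
- by rewrite (linD Delta_lin) (linD L) hx hy.
- by rewrite DeltaM tM hx hy.
Qed.

Lemma adact_bilin0 (x : U) : bilin (fun h1 h2 : U => h1 * x * antipode h2).
Proof.
exact: (bilin_comp (mul_bilin _) (mulr_lin x) antipode_lin).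
Qed.

Lemma adact_pure_bilin (s : UU) :
  linear (fun x : U => tlift (fun h1 h2 : U => h1 * x * antipode h2) s).
Proof.
move=> k x y; elim/tensor_ind: s => [a b|s t hs ht|c s hs].
- rewrite !(tliftE (adact_bilin0 _)) mulrDr mulrDl.
  by rewrite -pscaleAr -pscaleAl.
- rewrite !(linD (tliftL (adact_bilin0 _))) hs ht scalerDr.
  by rewrite addrACA.
- rewrite !(linZ (tliftL (adact_bilin0 _))) hs scalerDr.
  by rewrite !scalerA mulrC.
Qed.

Lemma adact_bilin : bilin (@adact C q p).
Proof.
split=> [x k h h'|h k x y].
  by rewrite /adact Delta_lin (tliftL (adact_bilin0 _)).
exact: adact_pure_bilin.
Qed.

Lemma adactM (h h' x : U) : adact (h * h') x = adact h (adact h' x).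
Proof.
rewrite /adact DeltaM; move: (Delta h) (Delta h') => s t.
elim/tensor_ind: s => [a b|s s' hs hs'|c s hs].
- elim/tensor_ind: t => [a' b'|t t' ht ht'|c t ht].
  + by rewrite tpureM !(tliftE (adact_bilin0 _)) antipodeM !mulrA.
  + rewrite mulrDr !(linD (tliftL (adact_bilin0 _))) ht ht'.
    by rewrite !(tliftE (adact_bilin0 _)) !(mulrDr, mulrDl).
  + rewrite -tensor_scaleAr !(linZ (tliftL (adact_bilin0 _))) ht.
    by rewrite !(tliftE (adact_bilin0 _)) -pscaleAr -pscaleAl.
- by rewrite mulrDl !(linD (tliftL (adact_bilin0 _))) hs hs'.
- by rewrite -tensor_scaleAl !(linZ (tliftL (adact_bilin0 _))) hs.
Qed.

Lemma adact1 (x : U) : adact 1 x = x.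
Proof.
by rewrite /adact Delta1 (tliftE (adact_bilin0 _)) antipode1 mulr1 mul1r.
Qed.

Lemma adactK (x : U) : adact K x = K * x * K'.
Proof.
by rewrite /adact Delta_genE (tliftE (adact_bilin0 _)) antipode_genE.
Qed.

Lemma adactE (x : U) : adact E x = E * x * K' - x * E * K'.
Proof.
rewrite /adact Delta_genE (linD (tliftL (adact_bilin0 _))).
rewrite !(tliftE (adact_bilin0 _)) !antipode_genE /= mul1r mulrN.
by rewrite [x * (_ * _)]mulrA.
Qed.

Lemma adactF (x : U) : adact F x = F * x - K' * x * K * F.
Proof.
rewrite /adact Delta_genE (linD (tliftL (adact_bilin0 _))).
rewrite !(tliftE (adact_bilin0 _)) !antipode_genE antipode1 /= mulr1 mulrN.
by rewrite [_ * (K * _)]mulrA.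
Qed.

Section TensorRep.
Variables (V W : lmodType C) (al : U -> V -> V) (be : U -> W -> W).
Hypotheses (alb : bilin al) (beb : bilin be).
Hypotheses (alM : forall h h' x, al (h * h') x = al h (al h' x)).
Hypotheses (beM : forall h h' x, be (h * h') x = be h (be h' x)).

Let in1 (h1 h2 : U) : bilin (fun x t => tpure (al h1 x) (be h2 t)).
Proof. exact: (bilin_comp (tpure_bilin _ _) (alb.2 h1) (beb.2 h2)). Qed.

Let g (h1 h2 : U) := tlift (fun x t => tpure (al h1 x) (be h2 t)).

Let gb t : bilin (fun h1 h2 => g h1 h2 t).
Proof.
rewrite /g; elim/tensor_ind: t => [x y|s t hs ht|c s hs].
- apply: (eq_bilin (f := fun h1 h2 => tpure (al h1 x) (be h2 y))).
    by move=> h1 h2; rewrite tliftE.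
  exact: (bilin_comp (tpure_bilin _ _) (alb.1 x) (beb.1 y)).
- split=> [b k v v'|b k v v']; rewrite !(linD (tliftL (in1 _ _))).
    by rewrite hs.1 ht.1 scalerDr addrACA.
  by rewrite hs.2 ht.2 scalerDr addrACA.
- split=> [b k v v'|b k v v']; rewrite !(linZ (tliftL (in1 _ _))).
    by rewrite hs.1 scalerDr !scalerA mulrC.
  by rewrite hs.2 scalerDr !scalerA mulrC.
Qed.

(** This is the recursive clause of [adpow] with the actions on the two factors left general; a
    single induction then makes every [adpow n] bilinear and multiplicative. *)
Definition trep (h : U) (t : tensor V W) :=
  tlift (fun h1 h2 : U => tlift (fun x t => tpure (al h1 x) (be h2 t)) t) (Delta h).

Let glin s : linear (fun t => tlift (fun h1 h2 => g h1 h2 t) s).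
Proof.
move=> k x y; elim/tensor_ind: s => [a b|s t hs ht|c s hs].
- by rewrite !(tliftE (gb _)) /g (tliftL (in1 _ _)).
- by rewrite !(linD (tliftL (gb _))) hs ht scalerDr addrACA.
- by rewrite !(linZ (tliftL (gb _))) hs scalerDr !scalerA mulrC.
Qed.

Lemma trep_bilin : bilin trep.
Proof.
split=> [t k h h'|h]; first by rewrite /trep Delta_lin (tliftL (gb _)).
exact: glin.
Qed.

Lemma trepM h h' t : trep (h * h') t = trep h (trep h' t).
Proof.
rewrite /trep DeltaM; move: (Delta h) (Delta h') => s s'.
rewrite -!/(g _ _).
elim/tensor_ind: s => [a b|s1 s2 h1 h2|c s1 h1]; last 2 first.
- by rewrite mulrDl !(linD (tliftL (gb _))) h1 h2.
- by rewrite -tensor_scaleAl !(linZ (tliftL (gb _))) h1.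
elim/tensor_ind: s' => [a' b'|s1 s2 h1 h2|c s1 h1]; last 2 first.
- rewrite mulrDr !(linD (tliftL (gb _))) h1 h2.
  by rewrite !(tliftE (gb _)) /g (linD (tliftL (in1 _ _))).
- rewrite -tensor_scaleAr !(linZ (tliftL (gb _))) h1.
  by rewrite !(tliftE (gb _)) /g (linZ (tliftL (in1 _ _))).
rewrite tpureM !(tliftE (gb _)).
apply: (@eq_tlinear _ _ _ _ (g (a * a') (b * b')) (fun t => g a b (g a' b' t))).
- exact: tliftL.
- by apply: comp_lin; exact: tliftL.
by move=> v w; rewrite /g !(tliftE (in1 _ _)) alM beM.
Qed.

Lemma trep_pure h1 h2 h v w : Delta h = h1 ⊗ h2 ->
  trep h (v ⊗ w) = al h1 v ⊗ be h2 w.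
Proof. by move=> hE; rewrite /trep hE (tliftE (gb _)) /g (tliftE (in1 _ _)). Qed.

Lemma trep_pure2 h1 h2 h3 h4 h v w : Delta h = h1 ⊗ h2 + h3 ⊗ h4 ->
  trep h (v ⊗ w) = al h1 v ⊗ be h2 w + al h3 v ⊗ be h4 w.
Proof.
move=> hE.
by rewrite /trep hE (linD (tliftL (gb _))) !(tliftE (gb _)) /g !(tliftE (in1 _ _)).
Qed.
End TensorRep.

Lemma adpow_props n :
  bilin (@adpow C q p n) /\
  (forall (h h' : U) (x : tpow q p n), adpow (h * h') x = adpow h (adpow h' x)).
Proof.
elim: n => [|n [ihb ihM]].
  split; last by move=> h h' x /=; rewrite counitM mulrA.
  split=> [w k v v'|v k w w'] /=.
    by rewrite counit_lin mulrDl -scalerAl.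
  by rewrite mulrDr -scalerAr.
by split; [exact: trep_bilin adact_bilin ihb | exact: trepM adact_bilin ihb adactM ihM].
Qed.

(** The elements that act on [M] by the counit are closed under sums and products, so generators
    suffice; K' is reached through K' M = K' (K M) = M. *)
Lemma adpow_inv n (M : tpow q p n) :
  adpow K M = M -> adpow E M = 0 -> adpow F M = 0 ->
  adpow (1 : U) M = M ->
  forall h : U, adpow h M = (counit h : C) *: M.
Proof.
have [B PM] := adpow_props n; move=> hK hE hF h1.
elim/palg_ind=> [c|g|x y hx hy|x y hx hy].
- rewrite (linZ (B.1 _)) h1 (linZ counit_lin) counit1.
  by congr (_ *: _); rewrite -[LHS]mulr1.
- rewrite counit_genE; case: g => /=; rewrite ?scale1r ?scale0r //.
  by rewrite -{1}hK -PM uKiK.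
- by rewrite (linD (B.1 _)) hx hy (linD counit_lin) scalerDl.
- by rewrite PM hy (linZ (B.2 _)) hx counitM scalerA mulrC.
Qed.

(** A tensor power ends in a trivial factor C, on which U acts by the counit; the counit axiom
    absorbs it. *)
Lemma adpow1E (h x : U) : adpow h (x ⊗ (1 : C^o) : tpow q p 1) = adact h x ⊗ (1 : C^o).
Proof.
have [b0 _] := adpow_props 0.
rewrite [LHS]/=; set g := fun h1 h2 : U => _.
have bl : bilin (fun h1 h2 : U => adact h1 x ⊗ adpow h2 (1 : tpow q p 0)).
  exact: (bilin_comp (tpure_bilin _ _) (adact_bilin.1 x) (b0.1 _)).
have inb h1 h2 : bilin (fun (x : U) (t' : tpow q p 0) => adact h1 x ⊗ (adpow h2 t')).
  exact: (bilin_comp (tpure_bilin _ _) (adact_bilin.2 h1) (b0.2 h2)).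
have -> : g = fun h1 h2 : U => adact h1 x ⊗ adpow h2 (1 : tpow q p 0).
  by apply/funext => h1; apply/funext => h2; rewrite /g (tliftE (inb _ _)).
rewrite -[in RHS](counit_Delta h); move: (Delta h) => s.
apply: (@eq_tlinear _ _ _ _ _ (fun s =>
  adact (tlift (fun y z : U => (counit z : C) *: y) s) x ⊗ (1 : C^o))) s.
- exact: tliftL bl.
- apply: (comp_lin (g := fun y : U => adact y x ⊗ (1 : C^o))).
    exact: (comp_lin ((tpure_bilin _ _).1 _) (adact_bilin.1 x)).
  exact: tliftL (scale_counit_bilin U).
move=> v w; rewrite (tliftE bl) (tliftE (scale_counit_bilin U)) /=.
rewrite (linZ (adact_bilin.1 _)) tpureZl -tpureZr.
by congr (_ ⊗ _).
Qed.

Definition pure2 (x y : U) : tpow q p 2 := x ⊗ (y ⊗ (1 : C^o)).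

Lemma pure2_bilin : bilin pure2.
Proof.
apply: (bilin_comp (tpure_bilin _ _) (@id_lin _ _)).
exact: (tpure_bilin _ _).1.
Qed.

Lemma adpow2E (h : U) (t : tpow q p 2) :
  adpow h t = trep (@adact C q p) (@adpow C q p 1) h t.
Proof. by []. Qed.

Lemma adpow_pure2 (h1 h2 h v w : U) : Delta h = h1 ⊗ h2 ->
  adpow h (pure2 v w) = pure2 (adact h1 v) (adact h2 w).
Proof.
move=> hE; rewrite adpow2E (trep_pure adact_bilin (adpow_props 1).1 _ _ hE).
by rewrite adpow1E.
Qed.

Lemma adpow_pure2D (h1 h2 h3 h4 h v w : U) : Delta h = h1 ⊗ h2 + h3 ⊗ h4 ->
  adpow h (pure2 v w)
  = pure2 (adact h1 v) (adact h2 w) + pure2 (adact h3 v) (adact h4 w).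
Proof.
move=> hE; rewrite adpow2E (trep_pure2 adact_bilin (adpow_props 1).1 _ _ hE).
by rewrite !adpow1E.
Qed.
End SmallQG.

(** * Sums over a period *)

Section Sums.
Variable V : nmodType.

Lemma sum_periodic (g : nat -> V) p k : (forall n, g (n + p)%N = g n) ->
  \sum_(i < p) g (i + k)%N = \sum_(i < p) g i.
Proof.
move=> gp; elim: k => [|k ih]; first by under eq_bigr do rewrite addn0.
rewrite -ih; case: p gp {ih} => [|p] gp; first by rewrite !big_ord0.
rewrite big_ord_recr [RHS]big_ord_recl /= addrC addnS -addSn addnC gp add0n.
congr (_ + _); apply: eq_bigr => i _.
by rewrite /bump /= add1n addSn addnS.
Qed.

Lemma sum_shift (g : nat -> V) p : g p = g 0%N ->
  \sum_(i < p) g i.+1 = \sum_(i < p) g i.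
Proof.
case: p => [|p] gp; first by rewrite !big_ord0.
rewrite big_ord_recr [RHS]big_ord_recl /= addrC gp.
by congr (_ + _); apply: eq_bigr => i _; rewrite /bump /= add1n.
Qed.

(** In the exchange rules of [Rquasi] the two boundary terms vanish because a commutator with 1 is
    zero and because E^p = F^p = 0. *)
Lemma sum_offset (g h : nat -> V) p : (0 < p)%N -> h 0%N = 0 -> g p.-1 = 0 ->
  (forall a, (a.+1 < p)%N -> h a.+1 = g a) ->
  \sum_(a < p) h a = \sum_(a < p) g a.
Proof.
case: p => // p _ h0 gp hg; rewrite big_ord_recl h0 add0r big_ord_recr /= gp addr0.
by apply: eq_bigr => a _; rewrite /bump /= add1n hg // ltnS.
Qed.

(** Groups by n = i + j. It serves for the product of two truncated series in E ⊗ F, where degrees p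
    and above are zero. *)
Lemma sum_triangle (G : nat -> nat -> V) p :
  (forall i j, (p <= i + j)%N -> G i j = 0) ->
  \sum_(i < p) \sum_(j < p) G i j = \sum_(n < p) \sum_(j < n.+1) G (n - j)%N j.
Proof.
move=> G0; rewrite exchange_big /=.
transitivity (\sum_(0 <= j < p) \sum_(0 <= n < p | (j <= n)%N) G (n - j)%N j).
  rewrite big_mkord; apply: eq_bigr => j _.
  have jp : (j <= p)%N by exact: ltnW.
  rewrite (big_cat_nat _ (n := j)) //= [X in X + _]big1_seq ?add0r; last first.
    by move=> n /andP[jn]; rewrite mem_index_iota ltnNge jn.
  transitivity (\sum_(0 <= n < p - j) G n j).
    rewrite -(big_mkord xpredT (fun i => G i j)).
    rewrite (big_cat_nat _ (n := (p - j)%N)) //= ?leq_subr //.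
    rewrite [X in _ + X]big1_seq ?addr0 // => n /=.
    by rewrite mem_index_iota => /andP[h _]; rewrite G0 // addnC -leq_subLR.
  have -> : \sum_(j <= n < p | (j <= n)%N) G (n - j)%N j
      = \sum_(0 + j <= n < p | (j <= n)%N) G (n - j)%N j by rewrite add0n.
  rewrite big_addn.
  by apply: eq_big => [i|i _]; rewrite ?leq_addl ?addnK.
rewrite (exchange_big_dep_nat xpredT) //= big_mkord; apply: eq_bigr => n _.
rewrite -(big_mkord xpredT (fun j => G (n - j)%N j)).
by rewrite (big_nat_widen 0 n.+1 p) //=; apply: eq_bigl => j; rewrite ltnS.
Qed.
End Sums.

Lemma sum_root (C : fieldType) (w : C) p n : p.-primitive_root w ->
  \sum_(b < p) w ^+ (b * n) = if (p %| n)%N then p%:R else 0.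
Proof.
move=> wp; have p0 := prim_order_gt0 wp.
case: ifP => [/dvdnP[k ->]|/negP pn].
  rewrite (eq_bigr (fun=> 1)) ?sumr_const ?card_ord // => b _.
  by rewrite mulnA mulnC exprM (prim_expr_order wp) expr1n.
have w1 : w ^+ n - 1 != 0.
  by rewrite subr_eq0 -(prim_order_dvd wp); apply/negP.
apply: (mulfI w1); rewrite mulr0.
rewrite (eq_bigr (fun b : 'I_p => (w ^+ n) ^+ b)) => [|b _]; last first.
  by rewrite mulnC exprM.
by rewrite -subrX1 -exprM mulnC exprM (prim_expr_order wp) expr1n subrr.
Qed.

(** The inverse of [w] is w^(p-1), and p-1 is coprime to p. *)
Lemma prim_rootV (C : fieldType) (w : C) p :
  p.-primitive_root w -> p.-primitive_root w^-1.
Proof.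
move=> wp; have p0 := prim_order_gt0 wp.
have w0 : w != 0.
  apply: contra_eq_neq (prim_expr_order wp) => ->.
  by rewrite expr0n (gtn_eqF p0) eq_sym oner_eq0.
have -> : w^-1 = w ^+ p.-1.
  by apply: (mulfI w0); rewrite mulfV // -exprS (prednK p0) prim_expr_order.
by rewrite (prim_root_exp_coprime _ wp) coprime_sym -{1}(prednK p0) coprimeSn.
Qed.

(** * The R-matrix *)

Section Commutation.
Variables (C : fieldType) (q : C) (p : nat).
Hypothesis q0 : q != 0.
Local Notation U := (uq q p).
Local Notation K := (pgen (urel q p) gK).
Local Notation K' := (pgen (urel q p) gKi).
Local Notation E := (pgen (urel q p) gE).
Local Notation F := (pgen (urel q p) gF).

Lemma qcommX (x y : U) (k : C) n :
  y * x = k *: (x * y) -> y * x ^+ n = k ^+ n *: (x ^+ n * y).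
Proof.
move=> yx; elim: n => [|n ih]; first by rewrite !expr0 mul1r mulr1 scale1r.
rewrite exprSr mulrA ih -pscaleAl -[_ * y * x]mulrA yx -pscaleAr scalerA.
by rewrite mulrA -!exprSr.
Qed.

Lemma qcommXl (x y : U) (k : C) n :
  y * x = k *: (x * y) -> y ^+ n * x = k ^+ n *: (x * y ^+ n).
Proof.
move=> yx; elim: n => [|n ih]; first by rewrite !expr0 mul1r mulr1 scale1r.
rewrite exprSr -mulrA yx -pscaleAr mulrA ih -pscaleAl scalerA -mulrA -!exprSr.
by rewrite -exprS.
Qed.

Lemma uKiE : K' * E = q ^- 2 *: (E * K').
Proof. by rewrite uEKi scalerA mulVf ?expf_neq0 // scale1r. Qed.
Lemma uKiF : K' * F = q ^+ 2 *: (F * K').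
Proof. by rewrite uFKi scalerA mulfV ?expf_neq0 // scale1r. Qed.

Lemma uKXE n a : K ^+ n * E ^+ a = q ^+ (2 * n * a) *: (E ^+ a * K ^+ n).
Proof.
by rewrite (qcommX _ (qcommXl n (uKE q p))) !exprM.
Qed.
Lemma uKXF n a : K ^+ n * F ^+ a = q ^- (2 * n * a) *: (F ^+ a * K ^+ n).
Proof. by rewrite (qcommX _ (qcommXl n (uKF q p))) !exprVn !exprM. Qed.
Lemma uKiXE a : K' * E ^+ a = q ^- (2 * a) *: (E ^+ a * K').
Proof. by rewrite (qcommX _ uKiE) !exprVn !exprM. Qed.
Lemma uKiXF a : K' * F ^+ a = q ^+ (2 * a) *: (F ^+ a * K').
Proof. by rewrite (qcommX _ uKiF) !exprM. Qed.

Lemma qbraceSr n :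
  qbrace q n.+1 * q ^+ n.+2 + qbrace q 1 = qbrace q n.+2 * q ^+ n.+1.
Proof.
rewrite /qbrace !exprS expr0 mulr1; have qn : q ^+ n != 0 by rewrite expf_neq0.
by field; rewrite qn q0.
Qed.

Lemma qbraceSl n :
  qbrace q n.+1 * q ^- n.+2 + qbrace q 1 = qbrace q n.+2 * q ^- n.+1.
Proof.
rewrite /qbrace !exprS expr0 mulr1; have qn : q ^+ n != 0 by rewrite expf_neq0.
by field; rewrite qn q0.
Qed.

Hypothesis q1 : qbrace q 1 != 0.
Local Notation c1 := (q - q^-1)^-1.

(** This recursion and the next one close the inductions of [uEXF] and [uEFX]: one governs the
    coefficient of K, the other that of K'. *)
Lemma qintSr n : qint q n.+1 * q ^+ n.+2 + 1 = qint q n.+2 * q ^+ n.+1.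
Proof. by rewrite /qint [RHS]mulrAC -qbraceSr [RHS]mulrDl mulfV // mulrAC. Qed.
Lemma qintSl n : qint q n.+1 * q ^- n.+2 + 1 = qint q n.+2 * q ^- n.+1.
Proof. by rewrite /qint [RHS]mulrAC -qbraceSl [RHS]mulrDl mulfV // mulrAC. Qed.

Let EF : E * F = F * E + c1 *: (K - K').
Proof. by rewrite -uEF addrC subrK. Qed.

Let coefE (x y c d e : C) : x * d + 1 = y * e -> x * c * d + c = y * c * e.
Proof. by move=> h; rewrite [RHS]mulrAC -h; ring. Qed.

Let qexprD2 n : q ^+ n * q ^+ 2 = q ^+ n.+2.
Proof. by rewrite -exprD addn2. Qed.
Let qexprVD2 n : q ^- n / q ^+ 2 = q ^- n.+2.
Proof. by rewrite -invfM -exprD addnC. Qed.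

Lemma uEXF n : E ^+ n.+1 * F = F * E ^+ n.+1
  + (qint q n.+1 * c1) *: (q ^+ n *: (E ^+ n * K) - q ^- n *: (E ^+ n * K')).
Proof.
elim: n => [|n ih].
  rewrite !expr1 !expr0 invr1 !scale1r !mul1r EF /qint.
  by rewrite mulfV // div1r.
rewrite exprSr -mulrA EF mulrDr mulrA ih mulrDl -!addrA -mulrA -exprSr.
congr (_ + _); rewrite -pscaleAl mulrBl -!pscaleAl -!mulrA uKE uKiE.
rewrite -!pscaleAr !mulrA -exprSr mulrBr !scalerBr !scalerA.
rewrite addrACA -opprD -!scalerDl qexprD2 qexprVD2.
by rewrite (coefE c1 (qintSr n)) (coefE c1 (qintSl n)).
Qed.

Lemma uEFX n : E * F ^+ n.+1 = F ^+ n.+1 * E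
  + (qint q n.+1 * c1) *: (q ^- n *: (F ^+ n * K) - q ^+ n *: (F ^+ n * K')).
Proof.
elim: n => [|n ih].
  rewrite !expr1 !expr0 invr1 !scale1r !mul1r EF /qint.
  by rewrite mulfV // div1r.
rewrite exprSr mulrA ih mulrDl -[_ * E * F]mulrA EF mulrDr mulrA -addrA.
congr (_ + _); rewrite -pscaleAl mulrBl -!pscaleAl -!mulrA uKF uKiF.
rewrite -!pscaleAr !mulrA -exprSr mulrBr !scalerBr !scalerA.
rewrite addrC addrACA -opprD -!scalerDl qexprD2 qexprVD2.
by rewrite (coefE c1 (qintSr n)) (coefE c1 (qintSl n)).
Qed.
End Commutation.

Section QNumbers.
Variables (C : fieldType) (q : C) (p : nat).
Hypothesis qp : p.-primitive_root (q ^+ 2).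
Hypothesis p1 : (1 < p)%N.
Let q0 := q_neq0 qp.

Lemma qbrace_eq0 k : (qbrace q k == 0) = (p %| k)%N.
Proof.
rewrite (prim_order_dvd qp) -exprM mulnC exprM expr2 /qbrace subr_eq0.
have qk : q ^+ k != 0 by rewrite expf_neq0.
by rewrite -(inj_eq (mulIf qk)) mulVf.
Qed.

Lemma qbrace1_neq0 : qbrace q 1 != 0.
Proof. by rewrite qbrace_eq0 dvdn1 neq_ltn p1 orbT. Qed.

Lemma qint_neq0 k : (0 < k < p)%N -> qint q k != 0.
Proof.
move=> /andP[k0 kp]; rewrite mulf_neq0 ?invr_eq0 ?qbrace1_neq0 // qbrace_eq0.
by apply/negP => /dvdn_leq -/(_ k0); rewrite leqNgt kp.
Qed.

Lemma qint_p : qint q p = 0.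
Proof. by apply/eqP; rewrite mulf_eq0 qbrace_eq0 dvdnn. Qed.

Lemma qfact_neq0 k : (k < p)%N -> qfact q k != 0.
Proof.
move=> kp; apply/prodf_neq0 => i _; apply: qint_neq0 => /=.
exact: leq_ltn_trans (ltn_ord i) kp.
Qed.

Lemma qfactS k : qfact q k.+1 = qfact q k * qint q k.+1.
Proof. exact: big_ord_recr. Qed.
End QNumbers.

(** * Exchange rules and inverse of the R-matrix *)

Section RMatrix.
Variables (C : fieldType) (q : C) (p : nat).
Hypothesis qp : p.-primitive_root (q ^+ 2).
Hypothesis p1 : (1 < p)%N.
Let q0 := q_neq0 qp.
Let q1 := qbrace1_neq0 qp p1.
Local Notation U := (uq q p).
Local Notation UU := (tensor U U).
Local Notation K := (pgen (urel q p) gK).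
Local Notation K' := (pgen (urel q p) gKi).
Local Notation E := (pgen (urel q p) gE).
Local Notation F := (pgen (urel q p) gF).
Local Notation R := (Rmat q p).

Definition theta (a : nat) : C :=
  qbrace q 1 ^+ a / qfact q a * q ^+ (a * a.-1)./2.

(* R = Rdiag * Rquasi: the first factor is the Cartan part. *)
Definition Rdiag : UU :=
  p%:R^-1 *: \sum_(b < p) \sum_(c < p) q ^- (2 * b * c) *: (K ^+ b ⊗ K ^+ c).

Definition Rquasi : UU := \sum_(a < p) theta a *: (E ^+ a ⊗ F ^+ a).

Lemma RmatE : R = Rdiag * Rquasi.
Proof.
rewrite /Rmat /Rdiag /Rquasi -tensor_scaleAl; congr (_ *: _).
rewrite mulr_sumr; apply: eq_bigr => a _; rewrite mulr_suml.
apply: eq_bigr => b _; rewrite mulr_suml; apply: eq_bigr => c _.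
rewrite -tensor_scaleAl -tensor_scaleAr scalerA tpureM; congr (_ *: _).
by rewrite /theta mulrA mulrC.
Qed.

Lemma qK n : q ^+ (2 * p * n) = 1.
Proof. by rewrite !exprM (prim_expr_order qp) expr1n. Qed.

Lemma uKX_period n : K ^+ (n + p) = K ^+ n.
Proof. by rewrite exprD uKp mulr1. Qed.

Definition Ksum (f : nat -> nat -> C) : UU :=
  \sum_(b < p) \sum_(c < p) f b c *: (K ^+ b ⊗ K ^+ c).

Lemma eq_Ksum f g : f =2 g -> Ksum f = Ksum g.
Proof. by move=> fg; apply: eq_bigr => b _; apply: eq_bigr => c _; rewrite fg. Qed.

Lemma Ksum_comm f x y u v : K * x = u *: (x * K) -> K * y = v *: (y * K) ->
  Ksum f * (x ⊗ y) = (x ⊗ y) * Ksum (fun b c => f b c * (u ^+ b * v ^+ c)).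
Proof.
move=> xu yv; rewrite /Ksum mulr_suml mulr_sumr; apply: eq_bigr => b _.
rewrite mulr_suml mulr_sumr; apply: eq_bigr => c _.
rewrite -tensor_scaleAl -tensor_scaleAr !tpureM.
by rewrite (qcommXl _ xu) (qcommXl _ yv) tpureZl tpureZr !scalerA mulrA.
Qed.

Lemma Ksum_shift1 f g : (forall b c, f b c = g b.+1 c) ->
  (forall c, g p c = g 0%N c) -> (K ⊗ (1 : U)) * Ksum f = Ksum g.
Proof.
move=> fg gp; rewrite /Ksum mulr_sumr.
rewrite -(sum_shift (g := fun b => \sum_(c < p) g b c *: (K ^+ b ⊗ K ^+ c))).
  apply: eq_bigr => b _; rewrite mulr_sumr; apply: eq_bigr => c _.
  by rewrite -tensor_scaleAr tpureM mul1r -exprS fg.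
by apply: eq_bigr => c _; rewrite uKp gp.
Qed.

Lemma Ksum_shift2 f g : (forall b c, f b c = g b c.+1) ->
  (forall b, g b p = g b 0%N) -> ((1 : U) ⊗ K) * Ksum f = Ksum g.
Proof.
move=> fg gp; rewrite /Ksum mulr_sumr; apply: eq_bigr => b _.
rewrite -(sum_shift (g := fun c => g b c *: (K ^+ b ⊗ K ^+ c))).
  rewrite mulr_sumr; apply: eq_bigr => c _.
  by rewrite -tensor_scaleAr tpureM mul1r -exprS fg.
by rewrite uKp gp.
Qed.

Definition Rw b c : C := q ^- (2 * b * c).

Lemma RdiagE : Rdiag = p%:R^-1 *: Ksum Rw. Proof. by []. Qed.

Let KK1 : K * 1 = 1 *: (1 * K) :> U.
Proof. by rewrite scale1r mul1r mulr1. Qed.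
Let KKK : K * K = 1 *: (K * K) :> U.
Proof. by rewrite scale1r. Qed.

Let Rwp1 c : Rw p c = Rw 0 c.
Proof. by rewrite /Rw qK muln0 mul0n. Qed.
Let Rwp2 b : Rw b p = Rw b 0.
Proof. by rewrite /Rw mulnAC qK muln0. Qed.
Let RwS1 b c : Rw b.+1 c = Rw b c * (q ^- 2) ^+ c.
Proof. by rewrite /Rw exprVn -exprM -invfM -exprD mulnS addnC mulnDl. Qed.
Let RwS2 b c : Rw b c.+1 = Rw b c * (q ^- 2) ^+ b.
Proof. by rewrite /Rw exprVn -exprM -invfM -exprD mulnS addnC. Qed.
Let q2V : q ^- 2 * q ^+ 2 = 1. Proof. by rewrite mulVf // expf_neq0. Qed.

(** Passing E through K^b ⊗ K^c multiplies the coefficient by q^(2c), which amounts to shifting b by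
    one, hence to a factor K on the left leg. The next three rules arise in the same way, from a
    shift of b or of c. *)
Lemma Rdiag_1E : Rdiag * ((1 : U) ⊗ E) = (K ⊗ E) * Rdiag.
Proof.
rewrite RdiagE -tensor_scaleAl -tensor_scaleAr; congr (_ *: _).
rewrite (Ksum_comm Rw KK1 (uKE q p)).
rewrite -(@Ksum_shift1 Rw); last 2 first.
- by move=> b c; rewrite !expr1n mul1r RwS1 -mulrA -exprMn q2V expr1n mulr1.
- by move=> c; rewrite Rwp1 !expr1n.
by rewrite mulrA tpureM mul1r mulr1.
Qed.

Lemma Rdiag_E1 : Rdiag * (E ⊗ (1 : U)) = (E ⊗ K) * Rdiag.
Proof.
rewrite RdiagE -tensor_scaleAl -tensor_scaleAr; congr (_ *: _).
rewrite (Ksum_comm Rw (uKE q p) KK1).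
rewrite -(@Ksum_shift2 Rw); last 2 first.
- by move=> b c; rewrite !expr1n mulr1 RwS2 -mulrA -exprMn q2V expr1n mulr1.
- by move=> c; rewrite Rwp2 !expr1n.
by rewrite mulrA tpureM mul1r mulr1.
Qed.

Lemma Rdiag_KF : Rdiag * (K ⊗ F) = ((1 : U) ⊗ F) * Rdiag.
Proof.
rewrite RdiagE -tensor_scaleAl -tensor_scaleAr; congr (_ *: _).
rewrite (Ksum_comm Rw KKK (uKF q p)) 
  -(@Ksum_shift1 (fun b c => Rw b c * (1 ^+ b * (q ^- 2) ^+ c)) Rw _ Rwp1).
  by rewrite mulrA tpureM mul1r mulr1.
by move=> b c; rewrite RwS1 expr1n mul1r.
Qed.

Lemma Rdiag_FK : Rdiag * (F ⊗ K) = (F ⊗ (1 : U)) * Rdiag.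
Proof.
rewrite RdiagE -tensor_scaleAl -tensor_scaleAr; congr (_ *: _).
rewrite (Ksum_comm Rw (uKF q p) KKK) 
  -(@Ksum_shift2 (fun b c => Rw b c * ((q ^- 2) ^+ b * 1 ^+ c)) Rw _ Rwp2).
  by rewrite mulrA tpureM mul1r mulr1.
by move=> b c; rewrite RwS2 expr1n mulr1.
Qed.

Lemma Ksum_K f : GRing.comm (Ksum f) (K ⊗ K).
Proof.
rewrite /GRing.comm (Ksum_comm f KKK KKK); congr (_ * _).
by apply: eq_Ksum => b c; rewrite !expr1n !mulr1.
Qed.

Lemma Rdiag_K : Rdiag * (K ⊗ K) = (K ⊗ K) * Rdiag.
Proof. by rewrite RdiagE -tensor_scaleAl -tensor_scaleAr Ksum_K. Qed.

Let KK'2 : K * K' = 1 *: (K' * K). Proof. by rewrite scale1r uKKi uKiK. Qed.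

Lemma Rdiag_1K' : Rdiag * ((1 : U) ⊗ K') = ((1 : U) ⊗ K') * Rdiag.
Proof.
rewrite RdiagE -tensor_scaleAl -tensor_scaleAr (Ksum_comm _ KK1 KK'2).
congr (_ *: _); congr (_ * _).
by apply: eq_Ksum => b c; rewrite !expr1n !mulr1.
Qed.

Lemma half_rec a : ((a.+1 * a.+1.-1)./2 = (a * a.-1)./2 + a)%N.
Proof.
case: a => // a.
have -> : (a.+2 * a.+2.-1 = a.+1 * a.+1.-1 + a.+1.*2)%N.
  by rewrite /= -muln2 mulnC -mulnDr addn2.
by rewrite halfD odd_double andbF doubleK.
Qed.

(** The recursion of the coefficients that matches the commutators of E with F^(a+1) and of F with
    E^(a+1). *)
Lemma thetaS a : (a.+1 < p)%N ->
  theta a.+1 * (qint q a.+1 / qbrace q 1) = theta a * q ^+ a.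
Proof.
move=> ap; rewrite /theta (qfactS q a) exprS half_rec exprD.
move: (qint_neq0 qp p1 (k := a.+1) ap) (qfact_neq0 qp p1 (ltnW ap)) q1.
move: (qint q _) (qfact q _) (qbrace q 1) => x y z x0 y0 z0.
by field; rewrite x0 y0 z0.
Qed.

Lemma Rquasi_K : Rquasi * (K ⊗ K) = (K ⊗ K) * Rquasi.
Proof.
rewrite /Rquasi mulr_suml mulr_sumr; apply: eq_bigr => a _.
rewrite -tensor_scaleAl -tensor_scaleAr !tpureM; congr (_ *: _).
rewrite -[K]expr1 uKXE // uKXF // !muln1 tpureZl tpureZr scalerA.
by rewrite mulfV ?scale1r // expf_neq0.
Qed.

Let tpureBl (x x' y : U) : (x - x') ⊗ y = x ⊗ y - x' ⊗ y.
Proof. exact: (linB ((tpure_bilin _ _).1 y)). Qed.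
Let tpureBr (x y y' : U) : x ⊗ (y - y') = x ⊗ y - x ⊗ y'.
Proof. exact: (linB ((tpure_bilin _ _).2 x)). Qed.
Let tpure0l (y : U) : (0 : U) ⊗ y = 0.
Proof. exact: (lin0 ((tpure_bilin _ _).1 y)). Qed.
Let tpure0r (x : U) : x ⊗ (0 : U) = 0.
Proof. exact: (lin0 ((tpure_bilin _ _).2 x)). Qed.

Let c1E : (q - q^-1)^-1 = (qbrace q 1)^-1. Proof. by []. Qed.

Let eqD (a b c d g : UU) : a - d = g -> c - b = g -> a + b = c + d.
Proof.
move=> ag cg; have -> : a = g + d by rewrite -ag subrK.
have -> : c = g + b by rewrite -cg subrK.
by rewrite addrAC.
Qed.

(** The terms with E on the left leg leave the sum of the [g a], those with E on the right leg the
    sum of the [h a]. By [uEFX] and [thetaS], h (a+1) = g a, and the ends h 0 and g (p-1) are zero,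
    so the sums agree. [Rquasi_F] is the mirror image. *)
Lemma Rquasi_E :
  Rquasi * (E ⊗ K + (1 : U) ⊗ E) = ((1 : U) ⊗ E + E ⊗ K') * Rquasi.
Proof.
pose g a := theta a *: (E ^+ a.+1 ⊗ (F ^+ a * K - K' * F ^+ a)).
pose h a := theta a *: (E ^+ a ⊗ (E * F ^+ a - F ^+ a * E)).
have hg : \sum_(a < p) h a = \sum_(a < p) g a.
  apply: sum_offset => [||| a ap]; first exact: (p_gt0 qp).
  - by rewrite /h !expr0 mulr1 mul1r subrr tpure0r scaler0.
  - by rewrite /g (prednK (p_gt0 qp)) uEp tpure0l scaler0.
  rewrite /h /g (uEFX p q0 q1) addrC addKr c1E tpureZr scalerA thetaS //.
  rewrite -scalerA -tpureZr scalerBr !scalerA mulfV ?expf_neq0 // scale1r.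
  by rewrite uKiXF // -exprD addnn -mul2n.
rewrite mulrDr mulrDl; apply: (@eqD _ _ _ _ (\sum_(a < p) g a)).
  rewrite /Rquasi mulr_suml mulr_sumr -sumrB; apply: eq_bigr => a _.
  rewrite -tensor_scaleAl -tensor_scaleAr !tpureM -scalerBr -exprS -exprSr.
  by rewrite -tpureBr.
rewrite -hg /Rquasi mulr_suml mulr_sumr -sumrB; apply: eq_bigr => a _.
rewrite -tensor_scaleAl -tensor_scaleAr !tpureM -scalerBr mulr1 mul1r.
by rewrite -tpureBr.
Qed.

Lemma Rquasi_F :
  Rquasi * (F ⊗ (1 : U) + K' ⊗ F) = (K ⊗ F + F ⊗ (1 : U)) * Rquasi.
Proof.
pose g a := theta a *: ((K * E ^+ a - E ^+ a * K') ⊗ F ^+ a.+1).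
pose h a := theta a *: ((E ^+ a * F - F * E ^+ a) ⊗ F ^+ a).
have hg : \sum_(a < p) h a = \sum_(a < p) g a.
  apply: sum_offset => [||| a ap]; first exact: (p_gt0 qp).
  - by rewrite /h !expr0 mulr1 mul1r subrr tpure0l scaler0.
  - by rewrite /g (prednK (p_gt0 qp)) uFp tpure0r scaler0.
  rewrite /h /g (uEXF p q0 q1) addrC addKr c1E tpureZl scalerA thetaS //.
  rewrite -scalerA -tpureZl scalerBr !scalerA mulfV ?expf_neq0 // scale1r.
  by rewrite -{2}[K]expr1 uKXE // muln1 -exprD addnn -mul2n expr1.
rewrite mulrDr mulrDl [X in _ = X]addrC [X in X = _]addrC.
symmetry; apply: (@eqD _ _ _ _ (- \sum_(a < p) g a)).
  rewrite -hg /Rquasi mulr_suml mulr_sumr -sumrB -sumrN; apply: eq_bigr => a _.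
  rewrite -tensor_scaleAl -tensor_scaleAr !tpureM -scalerBr mulr1 mul1r.
  rewrite -tpureBl -scalerN /h; congr (_ *: _).
  by rewrite -(opprB (_ * F)) -scaleN1r tpureZl scaleN1r.
rewrite /Rquasi mulr_suml mulr_sumr -sumrB -sumrN; apply: eq_bigr => a _.
rewrite -tensor_scaleAl -tensor_scaleAr !tpureM -scalerBr -exprS -exprSr.
rewrite -tpureBl /g -scalerN; congr (_ *: _).
by rewrite -(opprB (K * _)) -scaleN1r tpureZl scaleN1r.
Qed.

Lemma Rmat_K : R * (K ⊗ K) = (K ⊗ K) * R.
Proof. by rewrite RmatE -mulrA Rquasi_K mulrA Rdiag_K mulrA. Qed.

(** This is R Δ(E) = Δ^op(E) R: [Rquasi] turns Δ(E) into an intermediate coproduct, in which K has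
    become K', and [Rdiag] turns that one into Δ^op(E). *)
Lemma Rmat_E : R * (E ⊗ K + (1 : U) ⊗ E) = (K ⊗ E + E ⊗ (1 : U)) * R.
Proof.
rewrite RmatE -mulrA Rquasi_E !mulrA; congr (_ * _).
rewrite mulrDr mulrDl Rdiag_1E; congr (_ + _).
have -> : E ⊗ K' = (E ⊗ (1 : U)) * ((1 : U) ⊗ K') :> UU.
  by rewrite tpureM mulr1 mul1r.
rewrite mulrA Rdiag_E1 -mulrA Rdiag_1K' mulrA tpureM mulr1.
by rewrite uKKi.
Qed.

Lemma Rmat_F : R * (F ⊗ (1 : U) + K' ⊗ F) = ((1 : U) ⊗ F + F ⊗ K') * R.
Proof.
rewrite RmatE -mulrA Rquasi_F !mulrA; congr (_ * _).
rewrite mulrDr mulrDl Rdiag_KF; congr (_ + _).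
have -> : F ⊗ K' = ((1 : U) ⊗ K') * (F ⊗ (1 : U)) :> UU.
  by rewrite tpureM mulr1 mul1r.
by rewrite -mulrA -Rdiag_FK mulrA -Rdiag_1K' -mulrA tpureM uKiK mul1r.
Qed.

(** [theta] with q replaced by its inverse: {1} changes sign and the quantum factorial is
    unchanged. *)
Definition theta' (a : nat) : C :=
  (- qbrace q 1) ^+ a / qfact q a * q ^- (a * a.-1)./2.

Definition Rquasi' : UU := \sum_(a < p) theta' a *: (E ^+ a ⊗ F ^+ a).
Definition Rdiag' : UU := p%:R^-1 *: Ksum (fun b c => q ^+ (2 * b * c)).
Definition Rinv : UU := Rquasi' * Rdiag'.

Lemma qintD m j : qint q (m + j) = q ^- j * qint q m + q ^+ m * qint q j.
Proof.
rewrite /qint /qbrace !exprD; have qm : q ^+ m != 0 by rewrite expf_neq0.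
have qj : q ^+ j != 0 by rewrite expf_neq0.
rewrite !mulrA -mulrDl; congr (_ / _).
by field; rewrite qm qj.
Qed.

Lemma qint0 : qint q 0 = 0.
Proof. by rewrite /qint /qbrace expr0 invr1 subrr mul0r. Qed.

Lemma thetaSE a : (a.+1 < p)%N ->
  theta a.+1 * qint q a.+1 = qbrace q 1 * theta a * q ^+ a.
Proof.
move=> ap; have := q1; have := thetaS ap.
move: (theta _) (theta a) (qint q _) (qbrace q 1) => x y z w h w0.
by rewrite -mulrA -h; field.
Qed.

Lemma theta'SE a : (a.+1 < p)%N ->
  theta' a.+1 * qint q a.+1 = - (qbrace q 1 * theta' a * q ^- a).
Proof.
move=> ap; rewrite /theta' (qfactS q a) exprS half_rec exprD.
move: (qint_neq0 qp p1 (k := a.+1) ap) (qfact_neq0 qp p1 (ltnW ap)).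
have qa : q ^+ a != 0 by rewrite expf_neq0.
have qh : q ^+ (a * a.-1)./2 != 0 by rewrite expf_neq0.
move: qa qh; set y := (- _) ^+ a.
move: (qint q _) (qfact q _) (qbrace q 1) (q ^+ a) (q ^+ _) => x z t u v u0 v0 x0 z0.
by field; rewrite x0 u0 v0 z0.
Qed.

(* The coefficients of Rquasi * Rquasi' vanish: splitting
   [n+1] = q^-j [n+1-j] + q^(n+1-j) [j] makes the sum telescope. *)
Lemma theta_conv n : (n.+1 < p)%N ->
  \sum_(j < n.+2) theta (n.+1 - j) * theta' j = 0.
Proof.
move=> np; apply: (mulfI (qint_neq0 qp p1 (k := n.+1) np)); rewrite mulr0.
pose H j := qbrace q 1 * q ^+ (n - j) * q ^- j * theta (n - j) * theta' j.
rewrite mulr_sumr.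
rewrite (eq_bigr (fun j : 'I_n.+2 =>
    q ^- j * qint q (n.+1 - j) * (theta (n.+1 - j) * theta' j)
    + q ^+ (n.+1 - j) * qint q j * (theta (n.+1 - j) * theta' j))); last first.
  move=> j _; have jn : (j <= n.+1)%N by rewrite -ltnS.
  by rewrite -{1}(subnK jn) qintD mulrDl.
rewrite big_split big_ord_recr [X in _ + X = _]big_ord_recl /= subnn qint0.
rewrite !mulr0 !mul0r addr0 add0r -big_split /= big1 //.
move=> [j /= jn] _; rewrite /bump /= add1n subSS.
rewrite ltnS in jn.
have -> : q ^- j * qint q (n.+1 - j) * (theta (n.+1 - j) * theta' j) = H j.
  rewrite subSn //.
  transitivity (q ^- j * (theta (n - j).+1 * qint q (n - j).+1) * theta' j).
    by ring.
  rewrite thetaSE; last by rewrite (leq_ltn_trans _ np) // ltnS leq_subr.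
  by rewrite /H; move: (theta _) (theta' _) (q ^- j) (q ^+ _) (qbrace q 1) => *; ring.
apply/eqP; rewrite addrC addr_eq0 eq_sym; apply/eqP.
transitivity (q ^+ (n - j) * theta (n - j) * (theta' j.+1 * qint q j.+1)).
  rewrite theta'SE; last by rewrite (leq_ltn_trans _ np).
  by rewrite /H; move: (theta _) (theta' _) (q ^- j) (q ^+ _) (qbrace q 1) => *; ring.
by ring.
Qed.

Lemma sum_comm (I J : finType) (f : I -> UU) (g : J -> UU) :
  (forall i j, f i * g j = g j * f i) ->
  (\sum_i f i) * (\sum_j g j) = (\sum_j g j) * (\sum_i f i).
Proof.
move=> fg; rewrite mulr_suml mulr_sumr; apply: eq_bigr => i _.
by rewrite mulr_suml mulr_sumr; apply: eq_bigr.
Qed.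

Lemma Rquasi_comm : Rquasi * Rquasi' = Rquasi' * Rquasi.
Proof.
apply: sum_comm => i j; rewrite -!tensor_scaleAl -!tensor_scaleAr.
by rewrite !tpureM -!exprD addnC !scalerA mulrC.
Qed.

(** In degree n of E ⊗ F the coefficient is the convolution of [theta] and [theta'], zero for n > 0
    by [theta_conv]; degrees from p on are killed by E^p = 0. *)
Lemma RquasiV : Rquasi * Rquasi' = 1.
Proof.
rewrite /Rquasi mulr_suml.
pose G i j := (theta i * theta' j) *: (E ^+ (i + j) ⊗ F ^+ (i + j)).
transitivity (\sum_(i < p) \sum_(j < p) G i j).
  apply: eq_bigr => i _; rewrite mulr_sumr; apply: eq_bigr => j _.
  by rewrite -tensor_scaleAl -tensor_scaleAr tpureM -!exprD scalerA.
rewrite sum_triangle => [|i j ij]; last first.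
  rewrite /G -(subnK ij) exprD uEp mulr0.
  by rewrite (lin0 ((tpure_bilin _ _).1 _)) scaler0.
rewrite (bigD1 (Ordinal (p_gt0 qp))) //= big_ord1 big1 ?addr0.
  rewrite /G /theta /theta' /= /qfact !big_ord0 !expr0 !invr1 !mulr1.
  by rewrite scale1r.
case=> [[|n] //= np] _.
transitivity ((\sum_(j < n.+2) theta (n.+1 - j) * theta' j)
   *: (E ^+ n.+1 ⊗ F ^+ n.+1)).
  rewrite scaler_suml; apply: eq_bigr => j _.
  by rewrite /G subnK // -ltnS.
by rewrite theta_conv ?scale0r.
Qed.

Lemma Ksum_shift f g i j : (forall b c, f b c = g (b + i)%N (c + j)%N) ->
  (forall b c, g (b + p)%N c = g b c) -> (forall b c, g b (c + p)%N = g b c) ->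
  (K ^+ i ⊗ K ^+ j) * Ksum f = Ksum g.
Proof.
move=> fg g1 g2; rewrite /Ksum mulr_sumr.
rewrite -(@sum_periodic _ (fun b => \sum_(c < p) g b c *: (K ^+ b ⊗ K ^+ c)) p i).
  apply: eq_bigr => b _.
  rewrite mulr_sumr.
  rewrite -(@sum_periodic _ (fun c => g (b + i)%N c *: (K ^+ (b + i) ⊗ K ^+ c)) p j).
    apply: eq_bigr => c _.
    by rewrite -tensor_scaleAr tpureM -!exprD fg addnC [(j + _)%N]addnC.
  by move=> n; rewrite g2 uKX_period.
by move=> n; rewrite uKX_period; apply: eq_bigr => c _; rewrite g1.
Qed.

Lemma Ksum_lin (I : finType) (s : I -> C) (g : I -> nat -> nat -> C) :
  \sum_i s i *: Ksum (g i) = Ksum (fun b c => \sum_i s i * g i b c).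
Proof.
rewrite /Ksum; under eq_bigr do rewrite scaler_sumr.
rewrite exchange_big; apply: eq_bigr => b _.
under eq_bigr do rewrite scaler_sumr.
rewrite exchange_big; apply: eq_bigr => c _.
by rewrite scaler_suml; apply: eq_bigr => i _; rewrite scalerA.
Qed.

Lemma Rdiag_comm : Rdiag * Rdiag' = Rdiag' * Rdiag.
Proof.
rewrite /Rdiag /Rdiag' -!tensor_scaleAl -!tensor_scaleAr; congr (_ *: (_ *: _)).
apply: sum_comm => b b'; apply: sum_comm => c c'.
rewrite -!tensor_scaleAl -!tensor_scaleAr !scalerA !tpureM -!exprD.
by rewrite addnC [(c + _)%N]addnC mulrC.
Qed.

Let p0 : p%:R != 0 :> C. Proof. exact: prim_root_natf_neq0 qp. Qed.

Lemma RdiagV : Rdiag * Rdiag' = 1.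
Proof.
have q0' n : q ^+ n != 0 by rewrite expf_neq0.
rewrite RdiagE /Rdiag' -!tensor_scaleAl -!tensor_scaleAr scalerA.
(* This is q^(2(b-i)(c-j)), the coefficient of [Rdiag'] translated by K^i ⊗ K^j, expanded because
   the exponents are natural numbers. *)
pose g i j b c := q ^+ (2 * b * c) * q ^- (2 * i * c) * q ^- (2 * j * b)
                  * q ^+ (2 * i * j).
have -> : Ksum Rw * Ksum (fun b c => q ^+ (2 * b * c))
    = \sum_(i < p) \sum_(j < p) Rw i j *: Ksum (g i j).
  rewrite {1}/Ksum mulr_suml; apply: eq_bigr => i _.
  rewrite mulr_suml; apply: eq_bigr => j _.
  rewrite -tensor_scaleAl (@Ksum_shift _ (g i j)) // => b c.
  - have -> : g i j (b + i)%N (c + j)%N =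
      q ^+ (2 * b * c + 2 * b * j + (2 * i * c + 2 * i * j))
      * q ^- (2 * i * c + 2 * i * j) * q ^- (2 * b * j + 2 * i * j) * q ^+ (2 * i * j).
      by rewrite /g; congr (q ^+ _ / q ^+ _ / q ^+ _ * _); ring.
    by rewrite !exprD; field; rewrite !q0'.
  - have -> : g i j (b + p)%N c = q ^+ (2 * b * c + 2 * p * c)
      * q ^- (2 * i * c) * q ^- (2 * j * b + 2 * p * j) * q ^+ (2 * i * j).
      by rewrite /g; congr (q ^+ _ / q ^+ _ / q ^+ _ * _); ring.
    by rewrite !exprD !qK !mulr1.
  - have -> : g i j b (c + p)%N = q ^+ (2 * b * c + 2 * p * b)
      * q ^- (2 * i * c + 2 * p * i) * q ^- (2 * j * b) * q ^+ (2 * i * j).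
      by rewrite /g; congr (q ^+ _ / q ^+ _ / q ^+ _ * _); ring.
    by rewrite !exprD !qK !mulr1.
have KsumZ c f : c *: Ksum f = Ksum (fun i j => c * f i j).
  rewrite /Ksum scaler_sumr; apply: eq_bigr => i _.
  by rewrite scaler_sumr; apply: eq_bigr => j _; rewrite scalerA.
under eq_bigr do rewrite Ksum_lin -[Ksum _]scale1r.
rewrite Ksum_lin KsumZ /Ksum.
have E b c : (b < p)%N -> (c < p)%N ->
    p%:R^-1 / p%:R * \sum_(i < p) 1 * (\sum_(j < p) Rw i j * g i j b c)
    = ((b == 0%N) && (c == 0%N))%:R.
  move=> bp cp.
  (* The factors in the product i j cancel, so the double sum splits into two geometric sums, which
     vanish unless c = 0 and b = 0. *)
  transitivity (p%:R^-1 / p%:R * (q ^+ (2 * b * c) *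
     ((\sum_(i < p) (q ^+ 2)^-1 ^+ (i * c)) * (\sum_(j < p) (q ^+ 2)^-1 ^+ (j * b))))).
    congr (_ * _); rewrite mulr_suml mulr_sumr; apply: eq_bigr => i _.
    rewrite mul1r !mulr_sumr; apply: eq_bigr => j _.
    rewrite /Rw /g !exprVn -!exprM !mulnA; field; by rewrite !q0'.
  have pd n : (n < p)%N -> (p %| n)%N = (n == 0%N).
    case: n => [|n] np; rewrite ?dvdn0 //; apply/negP => /dvdn_leq -/(_ isT).
    by rewrite leqNgt np.
  rewrite !(sum_root _ (prim_rootV qp)) !pd //.
  case: eqP => [->|_] /=; last by rewrite andbF mul0r !mulr0.
  case: eqP => [->|_] /=; last by rewrite !mulr0.
  by rewrite muln0 expr0 mul1r; field.
rewrite (bigD1 (Ordinal (p_gt0 qp))) //= (bigD1 (Ordinal (p_gt0 qp))) //=.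
have pp := p_gt0 qp.
rewrite E // !expr0 scale1r big1 ?addr0 ?big1 ?addr0 //.
  move=> [i ip] /= i0; rewrite big1 // => -[j jp] _ /=.
  by rewrite E // -[i == 0%N]/(Ordinal ip == Ordinal (p_gt0 qp)) (negPf i0) scale0r.
move=> [j jp] /= j0.
by rewrite E // andTb -[j == 0%N]/(Ordinal jp == Ordinal (p_gt0 qp)) (negPf j0) scale0r.
Qed.

Lemma RmatV : R * Rinv = 1.
Proof. by rewrite RmatE /Rinv mulrA -[_ * _ * Rquasi']mulrA RquasiV mulr1 RdiagV. Qed.

Lemma RinvK : Rinv * R = 1.
Proof.
rewrite RmatE /Rinv mulrA -[_ * _ * Rdiag]mulrA -Rdiag_comm RdiagV mulr1.
by rewrite -Rquasi_comm RquasiV.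
Qed.
End RMatrix.

(** * Kinks and the double braiding *)

Section Flip.
Variables (C : comPzRingType) (G : Type) (rel : aterm C G -> aterm C G -> Prop).
Local Notation A := (palg rel).
Local Notation T := (tensor A A).

Lemma flip_bilin : bilin (fun a b : A => b ⊗ a).
Proof. by split=> [w|v]; [exact: (tpure_bilin _ _).2|exact: (tpure_bilin _ _).1]. Qed.

Definition tflip : T -> T := tlift (fun a b : A => b ⊗ a).

Lemma tflip_lin : linear tflip. Proof. exact: tliftL flip_bilin. Qed.
Lemma tflip_pure (a b : A) : tflip (a ⊗ b) = b ⊗ a.
Proof. exact: tliftE flip_bilin _ _. Qed.

Lemma tflipM (s t : T) : tflip (s * t) = tflip s * tflip t.
Proof.
elim/tensor_ind: s => [a b|s s' hs hs'|c s hs].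
- elim/tensor_ind: t => [a' b'|t t' ht ht'|c t ht].
  + by rewrite tpureM !tflip_pure tpureM.
  + by rewrite mulrDr !(linD tflip_lin) ht ht' mulrDr.
  + by rewrite -tensor_scaleAr !(linZ tflip_lin) ht tensor_scaleAr.
- by rewrite mulrDl !(linD tflip_lin) hs hs' mulrDl.
- by rewrite -tensor_scaleAl !(linZ tflip_lin) hs tensor_scaleAl.
Qed.

(* A kink carried by R acts by R'' K R', one carried by R^-1 by R' K R''. *)
Definition fold_op (u : A) : T -> A := tlift (fun a b : A => b * u * a).
Definition fold (u : A) : T -> A := tlift (fun a b : A => a * u * b).

Lemma fold_bilin u : bilin (fun a b : A => a * u * b).
Proof. exact: (bilin_comp (mul_bilin _) (mulr_lin u) (@id_lin _ _)). Qed.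
Lemma fold_op_bilin u : bilin (fun a b : A => b * u * a).
Proof. by split; [exact: (fold_bilin u).2|exact: (fold_bilin u).1]. Qed.
Lemma fold_lin u : linear (fold u). Proof. exact: tliftL (fold_bilin u). Qed.
Lemma fold_op_lin u : linear (fold_op u).
Proof. exact: tliftL (fold_op_bilin u). Qed.
Lemma fold_pure u a b : fold u (a ⊗ b) = a * u * b.
Proof. exact: tliftE (fold_bilin u) _ _. Qed.
Lemma fold_op_pure u a b : fold_op u (a ⊗ b) = b * u * a.
Proof. exact: tliftE (fold_op_bilin u) _ _. Qed.

Lemma fold_op_l u a b s : fold_op u ((a ⊗ b) * s) = b * fold_op (u * a) s.
Proof.
elim/tensor_ind: s => [x y|s s' hs hs'|c s hs].
- by rewrite tpureM !fold_op_pure !mulrA.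
- by rewrite mulrDr !(linD (fold_op_lin _)) hs hs' mulrDr.
- by rewrite -tensor_scaleAr !(linZ (fold_op_lin _)) hs pscaleAr.
Qed.
Lemma fold_op_r u a b s : fold_op u (s * (a ⊗ b)) = fold_op (b * u) s * a.
Proof.
elim/tensor_ind: s => [x y|s s' hs hs'|c s hs].
- by rewrite tpureM !fold_op_pure !mulrA.
- by rewrite mulrDl !(linD (fold_op_lin _)) hs hs' mulrDl.
- by rewrite -tensor_scaleAl !(linZ (fold_op_lin _)) hs pscaleAl.
Qed.
Lemma fold_l u a b s : fold u ((a ⊗ b) * s) = a * fold (u * b) s.
Proof.
elim/tensor_ind: s => [x y|s s' hs hs'|c s hs].
- by rewrite tpureM !fold_pure !mulrA.
- by rewrite mulrDr !(linD (fold_lin _)) hs hs' mulrDr.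
- by rewrite -tensor_scaleAr !(linZ (fold_lin _)) hs pscaleAr.
Qed.
Lemma fold_r u a b s : fold u (s * (a ⊗ b)) = fold (a * u) s * b.
Proof.
elim/tensor_ind: s => [x y|s s' hs hs'|c s hs].
- by rewrite tpureM !fold_pure !mulrA.
- by rewrite mulrDl !(linD (fold_lin _)) hs hs' mulrDl.
- by rewrite -tensor_scaleAl !(linZ (fold_lin _)) hs pscaleAl.
Qed.
End Flip.

(** * Centrality of the kinks and invariance of the monodromy *)

Section Invariance.
Variables (C : fieldType) (q : C) (p : nat).
Hypothesis qp : p.-primitive_root (q ^+ 2).
Hypothesis p1 : (1 < p)%N.
Local Notation U := (uq q p).
Local Notation UU := (tensor U U).
Local Notation K := (pgen (urel q p) gK).
Local Notation K' := (pgen (urel q p) gKi).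
Local Notation E := (pgen (urel q p) gE).
Local Notation F := (pgen (urel q p) gF).
Local Notation R := (Rmat q p).
Local Notation Rinv := (Rinv q p).
Local Notation Delta := (@Delta C q p).

Let KKi : K * K' = 1. Proof. exact: uKKi. Qed.
Let KiK : K' * K = 1. Proof. exact: uKiK. Qed.

Lemma comm_KKi (s : UU) : s * (K ⊗ K) = (K ⊗ K) * s -> s * (K' ⊗ K') = (K' ⊗ K') * s.
Proof.
move=> sK; rewrite -[s in LHS]mul1r.
have -> : 1 = (K' ⊗ K') * (K ⊗ K) :> UU by rewrite tpureM KiK.
by rewrite -mulrA -[in LHS]mulrA [_ * (_ * (K' ⊗ K'))]mulrA -sK -mulrA tpureM KKi mulr1.
Qed.

Lemma Rinv_comm (s t : UU) : R * s = t * R -> s * Rinv = Rinv * t.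
Proof.
move=> st; rewrite -[s]mul1r -(RinvK qp p1) -[_ * R * s]mulrA st.
by rewrite -!mulrA (RmatV qp p1) mulr1.
Qed.

Definition kink_pos : U := fold_op K R.
Definition kink_neg : U := fold K Rinv.

Let R_K := Rmat_K qp.
Let R_Ki := comm_KKi R_K.
Let Ri_K : Rinv * (K ⊗ K) = (K ⊗ K) * Rinv.
Proof. by rewrite -(Rinv_comm R_K). Qed.
Let Ri_Ki := comm_KKi Ri_K.

Lemma kink_pos_K : kink_pos * K = K * kink_pos.
Proof.
have := congr1 (fold_op 1) R_K; rewrite fold_op_r fold_op_l.
by rewrite mulr1 mul1r.
Qed.

(** Folding R Δ(E) = Δ^op(E) R yields the claim plus, on each side, the same term with E caught
    inside the fold; these cancel. *)
Lemma kink_pos_E : kink_pos * E = E * kink_pos.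
Proof.
have := congr1 (fold_op 1) (Rmat_E qp p1); rewrite mulrDr mulrDl.
rewrite !(linD (fold_op_lin _)) !fold_op_r !fold_op_l !mulr1 !mul1r.
by move/addIr.
Qed.

Lemma kink_pos_F : kink_pos * F = F * kink_pos.
Proof.
have := congr1 (fold_op K) (Rmat_F qp p1); rewrite mulrDr mulrDl.
rewrite !(linD (fold_op_lin _)) !fold_op_r !fold_op_l !mulr1 !mul1r.
(* The terms with F inside the fold differ by the side on which K' stands. Commutation of R with K'
   ⊗ K', folded around K F K, identifies them. *)
have := congr1 (fold_op (K * F * K)) R_Ki; rewrite fold_op_r fold_op_l.
rewrite !mulrA KiK mul1r -[K * F * K * K']mulrA KKi mulr1 => ->.
by move/addIr.
Qed.

Lemma kink_neg_K : kink_neg * K = K * kink_neg.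
Proof.
have := congr1 (fold 1) Ri_K; rewrite fold_r fold_l.
by rewrite mulr1 mul1r.
Qed.

Lemma kink_neg_E : kink_neg * E = E * kink_neg.
Proof.
have := congr1 (fold 1) (Rinv_comm (Rmat_E qp p1)); rewrite mulrDr mulrDl.
rewrite !(linD (fold_lin _)) !fold_r !fold_l !mulr1 !mul1r.
by move/addIr.
Qed.

Lemma kink_neg_F : kink_neg * F = F * kink_neg.
Proof.
have := congr1 (fold K) (Rinv_comm (Rmat_F qp p1)); rewrite mulrDr mulrDl.
rewrite !(linD (fold_lin _)) !fold_r !fold_l !mulr1 !mul1r.
have := congr1 (fold (K * F * K)) Ri_Ki; rewrite fold_r fold_l.
rewrite !mulrA KiK mul1r -[K * F * K * K']mulrA KKi mulr1 => ->.
by move/addIr.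
Qed.

Definition monodromy : UU := tflip R * R.

(** Meant for s = Δ(h) and t = Δ^op(h): flipping R s = t R gives R_21 t = s R_21, and the two are
    chained. *)
Lemma monodromy_comm (s t : UU) : R * s = t * R -> tflip t = s ->
  tflip s = t -> monodromy * s = s * monodromy.
Proof.
move=> st ts ts'; rewrite /monodromy -mulrA st !mulrA; congr (_ * _).
by have := congr1 (@tflip _ _ _) st; rewrite !tflipM ts ts'.
Qed.

Lemma adactKi (x : U) : adact K' x = K' * x * K.
Proof.
by rewrite /adact (Delta_genE qp) (tliftE (adact_bilin0 qp _)) (antipode_genE qp).
Qed.

(** On an element commuting with K, E and F the adjoint action reduces to the counit, so both
    summands of Δ(E) and of Δ(F) annihilate [pure2 x y]. *)
Lemma adpow_central (x y : U) :
  x * K = K * x -> x * E = E * x -> x * F = F * x ->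
  y * K = K * y -> y * E = E * y -> y * F = F * y ->
  forall h, adpow h (pure2 x y) = (counit h : C) *: pure2 x y.
Proof.
have adc (z : U) : z * K = K * z -> z * E = E * z -> z * F = F * z ->
    [/\ adact K z = z, adact E z = 0, adact F z = 0 & adact K' z = z].
  move=> zK zE zF.
  have zKK : K * z * K' = z by rewrite -zK -mulrA KKi mulr1.
  have zKK' : K' * z * K = z by rewrite -mulrA zK mulrA KiK mul1r.
  rewrite (adactK qp) (adactE qp) (adactF qp) adactKi zKK' zF subrr.
  by rewrite zE subrr zKK.
move=> xK xE xF yK yE yF.
have [xK1 xE1 xF1 xK1'] := adc x xK xE xF.
have [yK1 yE1 yF1 yK1'] := adc y yK yE yF.
have B := pure2_bilin q p.
have p20l z : pure2 (0 : U) z = 0 by exact: (lin0 (B.1 z)).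
have p20r z : pure2 z (0 : U) = 0 by exact: (lin0 (B.2 z)).
apply: (adpow_inv qp).
- by rewrite (adpow_pure2 qp _ _ (Delta_genE qp gK)) xK1 yK1.
- by rewrite (adpow_pure2D qp _ _ (Delta_genE qp gE)) xE1 yE1 p20l p20r addr0.
- by rewrite (adpow_pure2D qp _ _ (Delta_genE qp gF)) xF1 yF1 p20l p20r addr0.
- by rewrite (adpow_pure2 qp _ _ (Delta1 qp)) !(adact1 qp).
Qed.

Local Notation S := (@antipode C q p).
Let S_lin := antipode_lin qp.

(* The four coefficients absorb both multiplications in [sand_l] and [sand_r], so
   that an identity in U ⊗ U can be tested against all of these maps. *)
Definition sand (c1 c2 c3 c4 : U) : UU -> tpow q p 2 :=
  tlift (fun a b : U => pure2 (c1 * S a * c2) (c3 * b * c4)).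

Let sand_bilin c1 c2 c3 c4 :
  bilin (fun a b : U => pure2 (c1 * S a * c2) (c3 * b * c4)).
Proof.
apply: (bilin_comp (pure2_bilin q p) _ (mullr_lin c3 c4)).
exact: (comp_lin (mullr_lin c1 c2) S_lin).
Qed.

Lemma sand_lin c1 c2 c3 c4 : linear (sand c1 c2 c3 c4).
Proof. exact: tliftL (sand_bilin _ _ _ _). Qed.
Lemma sand_pure c1 c2 c3 c4 a b :
  sand c1 c2 c3 c4 (a ⊗ b) = pure2 (c1 * S a * c2) (c3 * b * c4).
Proof. exact: tliftE (sand_bilin _ _ _ _) _ _. Qed.

Lemma sand_l c1 c2 c3 c4 a b s :
  sand c1 c2 c3 c4 ((a ⊗ b) * s) = sand c1 (S a * c2) (c3 * b) c4 s.
Proof.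
elim/tensor_ind: s => [x y|s s' hs hs'|c s hs].
- by rewrite tpureM !sand_pure (antipodeM qp) !mulrA.
- by rewrite mulrDr !(linD (sand_lin _ _ _ _)) hs hs'.
- by rewrite -tensor_scaleAr !(linZ (sand_lin _ _ _ _)) hs.
Qed.
Lemma sand_r c1 c2 c3 c4 a b s :
  sand c1 c2 c3 c4 (s * (a ⊗ b)) = sand (c1 * S a) c2 c3 (b * c4) s.
Proof.
elim/tensor_ind: s => [x y|s s' hs hs'|c s hs].
- by rewrite tpureM !sand_pure (antipodeM qp) !mulrA.
- by rewrite mulrDl !(linD (sand_lin _ _ _ _)) hs hs'.
- by rewrite -tensor_scaleAl !(linZ (sand_lin _ _ _ _)) hs.
Qed.

Lemma sandN1 c1 c2 c3 c4 s : sand (- c1) c2 c3 c4 s = - sand c1 c2 c3 c4 s.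
Proof.
elim/tensor_ind: s => [x y|s s' hs hs'|c s hs].
- by rewrite !sand_pure !mulNr (linN ((pure2_bilin q p).1 _)).
- by rewrite !(linD (sand_lin _ _ _ _)) hs hs' opprD.
- by rewrite !(linZ (sand_lin _ _ _ _)) hs scalerN.
Qed.
Lemma sandN2 c1 c2 c3 c4 s : sand c1 (- c2) c3 c4 s = - sand c1 c2 c3 c4 s.
Proof.
elim/tensor_ind: s => [x y|s s' hs hs'|c s hs].
- by rewrite !sand_pure !mulrN (linN ((pure2_bilin q p).1 _)).
- by rewrite !(linD (sand_lin _ _ _ _)) hs hs' opprD.
- by rewrite !(linZ (sand_lin _ _ _ _)) hs scalerN.
Qed.

Definition hopf_elt : tpow q p 2 := sand 1 1 1 1 monodromy.

Let adl := (adpow_props qp 2).1.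

Lemma adpow_sandK s : adpow K (sand 1 1 1 1 s) = sand K K' K K' s.
Proof.
have L1 := comp_lin (adl.2 K) (sand_lin 1 1 1 1).
apply: (eq_tlinear L1 (sand_lin _ _ _ _)) => a b.
rewrite !sand_pure !(mul1r, mulr1) (adpow_pure2 qp _ _ (Delta_genE qp gK)).
by rewrite !(adactK qp).
Qed.

Lemma adpow_sand1 s : adpow (1 : U) (sand 1 1 1 1 s) = sand 1 1 1 1 s.
Proof.
have L1 := comp_lin (adl.2 1) (sand_lin 1 1 1 1).
apply: (eq_tlinear L1 (sand_lin _ _ _ _)) => a b.
by rewrite !sand_pure (adpow_pure2 qp _ _ (Delta1 qp)) !(adact1 qp).
Qed.

Lemma adpow_sandE s : adpow E (sand 1 1 1 1 s) =
  sand E K' K K' s - sand 1 (E * K') K K' s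
  + (sand 1 1 E K' s - sand 1 1 1 (E * K') s).
Proof.
elim/tensor_ind: s => [a b|s s' hs hs'|c s hs].
- rewrite !sand_pure !(mul1r, mulr1).
  rewrite (adpow_pure2D qp _ _ (Delta_genE qp gE)) !(adactE qp) (adactK qp).
  rewrite (adact1 qp) (linB ((pure2_bilin q p).1 _)).
  by rewrite (linB ((pure2_bilin q p).2 _)) !mulrA.
- rewrite !(linD (sand_lin _ _ _ _)) (linD (adl.2 _)) hs hs'.
  by rewrite !opprD [RHS](AC ((2*2)*(2*2)) (((1*3)*(5*7))*((2*4)*(6*8)))).
- rewrite !(linZ (sand_lin _ _ _ _)) (linZ (adl.2 _)) hs.
  by rewrite !(scalerDr, scalerN).
Qed.

Lemma adpow_sandF s : adpow F (sand 1 1 1 1 s) =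
  sand F 1 1 1 s - sand K' (K * F) 1 1 s
  + (sand K' K F 1 s - sand K' K K' (K * F) s).
Proof.
elim/tensor_ind: s => [a b|s s' hs hs'|c s hs].
- rewrite !sand_pure !(mul1r, mulr1).
  rewrite (adpow_pure2D qp _ _ (Delta_genE qp gF)) !(adactF qp) adactKi.
  rewrite (adact1 qp) (linB ((pure2_bilin q p).1 _)).
  by rewrite (linB ((pure2_bilin q p).2 _)) !mulrA.
- rewrite !(linD (sand_lin _ _ _ _)) (linD (adl.2 _)) hs hs'.
  by rewrite !opprD [RHS](AC ((2*2)*(2*2)) (((1*3)*(5*7))*((2*4)*(6*8)))).
- rewrite !(linZ (sand_lin _ _ _ _)) (linZ (adl.2 _)) hs.
  by rewrite !(scalerDr, scalerN).
Qed.

Lemma monodromy_K : monodromy * (K ⊗ K) = (K ⊗ K) * monodromy.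
Proof. by apply: (monodromy_comm R_K); rewrite tflip_pure. Qed.
Lemma monodromy_E : monodromy * (E ⊗ K + (1 : U) ⊗ E)
  = (E ⊗ K + (1 : U) ⊗ E) * monodromy.
Proof.
by apply: (monodromy_comm (Rmat_E qp p1)); rewrite (linD (@tflip_lin _ _ _)) !tflip_pure.
Qed.
Lemma monodromy_F : monodromy * (F ⊗ (1 : U) + K' ⊗ F)
  = (F ⊗ (1 : U) + K' ⊗ F) * monodromy.
Proof.
by apply: (monodromy_comm (Rmat_F qp p1));
  rewrite (linD (@tflip_lin _ _ _)) !tflip_pure // addrC.
Qed.

(* The argument is h_1 S(Q') S(h_2) ⊗ h_3 Q'' S(h_4) = h_1 S(h_2) S(Q') ⊗ Q'' h_3 S(h_4),
   for Q = R_21 R commuting with Δ(h), written out on generators. *)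
Lemma hopf_inv h : adpow h hopf_elt = (counit h : C) *: hopf_elt.
Proof.
have SK : S K = K' by rewrite (antipode_genE qp).
have SK' : S K' = K by rewrite (antipode_genE qp).
have SE : S E = - (E * K') by rewrite (antipode_genE qp).
have SF : S F = - (K * F) by rewrite (antipode_genE qp).
apply: (adpow_inv qp).
- rewrite /hopf_elt adpow_sandK.
  have := congr1 (sand K 1 1 K') monodromy_K.
  by rewrite sand_l sand_r SK !(mul1r, mulr1) KKi => <-.
- rewrite /hopf_elt adpow_sandE.
  have := congr1 (sand 1 1 1 K') monodromy_E.
  rewrite mulrDr mulrDl !(linD (sand_lin _ _ _ _)) !sand_l !sand_r SE.
  rewrite (antipode1 qp) !(mul1r, mulr1) KKi sandN1 sandN2.
  have := congr1 (sand E 1 1 K') monodromy_K.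
  rewrite sand_l sand_r SK !(mul1r, mulr1) KKi => <- e.
  by rewrite -addrA [- _ + (_ - _)]addrA -e addrK subrr.
- rewrite /hopf_elt adpow_sandF.
  have := congr1 (sand K' 1 1 1) monodromy_F.
  rewrite mulrDr mulrDl !(linD (sand_lin _ _ _ _)) !sand_l !sand_r SK' SF.
  rewrite !(mul1r, mulr1) KiK mulrN mulrA KiK mul1r sandN1 sandN2.
  have := congr1 (sand K' 1 1 (K * F)) (comm_KKi monodromy_K).
  rewrite sand_l sand_r SK' !(mul1r, mulr1) KiK [K' * (K * F)]mulrA KiK mul1r => <- e.
  by rewrite -addrA [- _ + (_ - _)]addrA -e addrK subrr.
- exact: adpow_sand1.
Qed.
End Invariance.

(** * The integral *)

Section UMod.
Variables (C : fieldType) (q : C) (p n : nat) (g : ugen -> 'M[C]_n).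
Local Notation mul := (@mulmx C n n n).
Hypothesis g_rel : forall t u, urel q p t u ->
  aeval (1%:M : 'M_n) mul g t = aeval (1%:M : 'M_n) mul g u.

Let linl (y : 'M[C]_n) : linear (fun x => mul x y).
Proof. by move=> c u v; rewrite mulmxDl scalemxAl. Qed.
Let linr (x : 'M[C]_n) : linear (mul x).
Proof. by move=> c u v; rewrite mulmxDr scalemxAr. Qed.
Let mulA : associative mul. Proof. exact: mulmxA. Qed.
Let mul1 : left_id (1%:M : 'M_n) mul. Proof. exact: mul1mx. Qed.
Let mulr1 : right_id (1%:M : 'M_n) mul. Proof. exact: mulmx1. Qed.

Definition umod_of : umod q p :=
  UMod (plift_linear linl linr mulA mul1 mulr1 g_rel)
       (plift1 linl linr mulA mul1 mulr1 g_rel)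
       (pliftM linl linr mulA mul1 mulr1 g_rel).

Lemma umod_of_gen x : uact umod_of (pgen _ x) = g x.
Proof. exact: plift_gen linl linr mulA mul1 mulr1 g_rel x. Qed.
End UMod.

(** * The modules induced from the characters of K *)

Section Projective.
(* The left module U ⊗ C_m induced from the character K = q^(2m) of the
   subalgebra generated by K: the basis vector e b a stands for F^b E^a ⊗ 1. *)
Variables (C : fieldType) (q : C) (p : nat).
Hypothesis qp : p.-primitive_root (q ^+ 2).
Hypothesis p1 : (1 < p)%N.
Variable m : nat.
Let q0 := q_neq0 qp.
Local Notation n := (p * p)%N.

(** The indices are natural numbers and the vector is 0 when one of them reaches p, so that the
    formulas for the operators need no truncation at the boundary. *)
Definition evec b a : 'cV[C]_n :=
  \col_i (((mxtens_unindex i).1 == b :> nat) && ((mxtens_unindex i).2 == a :> nat))%:R.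

Lemma evec_ord (b a : 'I_p) : evec b a = delta_mx (mxtens_index (b, a)) 0.
Proof.
apply/matrixP=> i j; rewrite !mxE !ord1 andbT.
by case: (mxtens_indexP i) => i1 i2; rewrite mxtens_indexK (can_eq (@mxtens_indexK p p)).
Qed.

Lemma evec0 b a : (p <= b)%N || (p <= a)%N -> evec b a = 0.
Proof.
move=> h; apply/matrixP=> i j; rewrite !mxE.
case/orP: h => h; last rewrite andbC.
  case: eqP => [e|//]; have := ltn_ord (mxtens_unindex i).1.
  by rewrite [X in (X < _)%N]e ltnNge h.
case: eqP => [e|//]; have := ltn_ord (mxtens_unindex i).2.
by rewrite [X in (X < _)%N]e ltnNge h.
Qed.

Lemma evec_ext (A B : 'M[C]_n) :
  (forall b a, A *m evec b a = B *m evec b a) -> A = B.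
Proof.
move=> AB; apply/matrixP => i j; case: (mxtens_indexP j) => b a.
by have /matrixP/(_ i 0) := AB b a; rewrite evec_ord -!colE !mxE.
Qed.

Definition opmx (f : nat -> nat -> 'cV[C]_n) : 'M[C]_n :=
  \matrix_(i, j) f (mxtens_unindex j).1 (mxtens_unindex j).2 i 0.

Lemma opmxE f b a : ((p <= b)%N || (p <= a)%N -> f b a = 0) ->
  opmx f *m evec b a = f b a.
Proof.
move=> f0; have [ba|] := boolP ((p <= b) || (p <= a))%N.
  by rewrite f0 // evec0 // mulmx0.
rewrite negb_or -!ltnNge => /andP[bp ap].
rewrite -[b]/(nat_of_ord (Ordinal bp)) -[a]/(nat_of_ord (Ordinal ap)) evec_ord -colE.
by apply/matrixP => i j; rewrite !mxE mxtens_indexK ord1.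
Qed.

Definition weight b a : C := q ^+ (2 * (m + a)) / q ^+ (2 * b).
(** The coefficient of F^(b-1) E^a ⊗ 1 in E F^b E^a ⊗ 1 according to [uEFX]. There K acts on E^a ⊗ 1
    by [weight b a] times q^(2b), hence the exponent b+1. *)
Definition lower_coef b a : C := qint q b *
  ((weight b a * q ^+ b.+1 - (weight b a * q ^+ b.+1)^-1) / qbrace q 1).

Definition mxF := opmx (fun b a => evec b.+1 a).
Definition mxK := opmx (fun b a => weight b a *: evec b a).
Definition mxK' := opmx (fun b a => (weight b a)^-1 *: evec b a).
Definition mxEop := opmx (fun b a => evec b a.+1 + lower_coef b a *: evec b.-1 a).

Lemma weight_neq0 b a : weight b a != 0.
Proof. by rewrite mulf_neq0 ?invr_eq0 ?expf_neq0. Qed.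

Lemma mxF_e b a : mxF *m evec b a = evec b.+1 a.
Proof.
rewrite opmxE // => /orP[] h; rewrite evec0 //; first by rewrite ltnW.
by rewrite h orbT.
Qed.
Lemma mxK_e b a : mxK *m evec b a = weight b a *: evec b a.
Proof. by rewrite opmxE // => h; rewrite evec0 ?scaler0. Qed.
Lemma mxK'_e b a : mxK' *m evec b a = (weight b a)^-1 *: evec b a.
Proof. by rewrite opmxE // => h; rewrite evec0 ?scaler0. Qed.
Lemma lower_coef0 a : lower_coef 0 a = 0.
Proof. by rewrite /lower_coef qint0 mul0r. Qed.
Lemma mxE_e b a : mxEop *m evec b a = evec b a.+1 + lower_coef b a *: evec b.-1 a.
Proof.
rewrite opmxE // => /orP[] h; last first.
  by rewrite (@evec0 b.-1) ?h ?orbT // evec0 ?(leqW h) ?orbT // scaler0 addr0.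
(* For b = p the vector [evec p a] is 0 while [evec p.-1 a] need not be; the formula survives
   because its coefficient contains [p] = 0. *)
rewrite evec0 ?h // add0r; move: h; rewrite leq_eqVlt => /predU1P[<-|h].
  by rewrite /lower_coef (qint_p qp) mul0r scale0r.
by rewrite evec0 ?scaler0 //; case: b h => // b; rewrite ltnS => ->.
Qed.

Lemma weightSb b a : weight b.+1 a = weight b a / q ^+ 2.
Proof. by rewrite /weight [(2 * b.+1)%N]mulnS exprD invfM [X in _ * X]mulrC mulrA. Qed.
Lemma weightSa b a : weight b a.+1 = weight b a * q ^+ 2.
Proof. by rewrite /weight addnS mulnS exprD [q ^+ 2 * _]mulrC mulrAC. Qed.

Lemma mxKE_e b a : mxK *m (mxEop *m evec b a) = (q ^+ 2 * weight b a) *: (mxEop *m evec b a).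
Proof.
rewrite mxE_e mulmxDr -scalemxAr !mxK_e weightSa scalerDr mulrC; congr (_ + _).
rewrite !scalerA; case: b => [|b]; first by rewrite lower_coef0 !mulr0 mul0r !scale0r.
by rewrite /= weightSb mulrC [q ^+ 2 * _]mulrC divfK // expf_neq0.
Qed.

Lemma mxEF_e b a : mxEop *m (mxF *m evec b a) =
  mxF *m (mxEop *m evec b a)
  + ((q - q^-1)^-1 * (weight b a - (weight b a)^-1)) *: evec b a.
Proof.
rewrite mxF_e mxE_e mxE_e mulmxDr -scalemxAr !mxF_e -addrA; congr (_ + _).
have -> : lower_coef b a *: evec b.-1.+1 a = lower_coef b a *: evec b a.
  by case: b => // ; rewrite lower_coef0 !scale0r.
rewrite -scalerDl /=; congr (_ *: _).
rewrite /lower_coef weightSb /qint /qbrace !exprS expr0 !mulr1.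
have := weight_neq0 b a; move: (weight b a) => W W0.
have qb : q ^+ b != 0 by rewrite expf_neq0.
have q1' : q ^+ 2 - 1 != 0.
  rewrite subr_eq0; apply/eqP => q21.
  by have := prim_order_dvd qp 1; rewrite q21 expr1n eqxx dvdn1 (gtn_eqF p1).
by field; rewrite q1' W0 qb q0.
Qed.

Let wp b a : (weight b a) ^+ p = 1.
Proof.
have h k : (q ^+ (2 * k)) ^+ p = 1.
  by rewrite -exprM mulnAC !exprM (prim_expr_order qp) expr1n.
by rewrite /weight expr_div_n !h divr1.
Qed.

Lemma mxX_e (A : 'M[C]_n) k (v : 'cV[C]_n) : A ^+ k.+1 *m v = A *m (A ^+ k *m v).
Proof. by rewrite exprS -mulmxA. Qed.

Lemma mxFX_e k b a : mxF ^+ k *m evec b a = evec (b + k) a.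
Proof.
elim: k => [|k ih]; first by rewrite addn0 mul1mx.
by rewrite mxX_e ih mxF_e addnS.
Qed.

Lemma mxKX_e k b a : mxK ^+ k *m evec b a = weight b a ^+ k *: evec b a.
Proof.
elim: k => [|k ih]; first by rewrite mul1mx scale1r.
by rewrite mxX_e ih -scalemxAr mxK_e scalerA -exprSr.
Qed.

Lemma mxEX_0 k a : mxEop ^+ k *m evec 0 a = evec 0 (a + k).
Proof.
elim: k => [|k ih]; first by rewrite addn0 mul1mx.
by rewrite mxX_e ih mxE_e lower_coef0 scale0r addr0 addnS.
Qed.

Lemma mxKE : mxK *m mxEop = q ^+ 2 *: (mxEop *m mxK).
Proof.
apply: evec_ext => b a; rewrite -mulmxA mxKE_e -scalemxAl -mulmxA mxK_e.
by rewrite -scalemxAr scalerA.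
Qed.

Lemma mxKK' : mxK *m mxK' = 1%:M.
Proof.
apply: evec_ext => b a; rewrite -mulmxA mxK'_e -scalemxAr mxK_e scalerA.
by rewrite mulVf ?weight_neq0 // scale1r mul1mx.
Qed.

Lemma mxK'K : mxK' *m mxK = 1%:M.
Proof. exact: mulmx1C mxKK'. Qed.

Lemma mxKF : mxK *m mxF = q ^- 2 *: (mxF *m mxK).
Proof.
apply: evec_ext => b a; rewrite -mulmxA mxF_e mxK_e -scalemxAl -mulmxA mxK_e.
by rewrite -scalemxAr mxF_e scalerA weightSb mulrC.
Qed.

Lemma mxEF : mxEop *m mxF = mxF *m mxEop + (q - q^-1)^-1 *: (mxK - mxK').
Proof.
apply: evec_ext => b a; rewrite -mulmxA mxEF_e mulmxDl -mulmxA -scalemxAl.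
by rewrite mulmxBl mxK_e mxK'_e -scalerBl scalerA.
Qed.

Lemma mxEXK k : mxK *m mxEop ^+ k = q ^+ (2 * k) *: (mxEop ^+ k *m mxK).
Proof.
elim: k => [|k ih]; first by rewrite muln0 scale1r mul1mx mulmx1.
rewrite exprSr -[mxEop ^+ k * _]/(_ *m _) mulmxA ih -scalemxAl -mulmxA mxKE.
by rewrite -scalemxAr scalerA -exprD mulnSr mulmxA.
Qed.

Lemma mxEXK' k : mxK' *m mxEop ^+ k = q ^- (2 * k) *: (mxEop ^+ k *m mxK').
Proof.
have -> : mxK' *m mxEop ^+ k = mxK' *m (mxEop ^+ k *m mxK) *m mxK'.
  by rewrite -!mulmxA mxKK' mulmx1.
have -> : mxEop ^+ k *m mxK = q ^- (2 * k) *: (mxK *m mxEop ^+ k).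
  by rewrite mxEXK scalerA mulVf ?scale1r // expf_neq0.
by rewrite -scalemxAr -scalemxAl mulmxA mxK'K mul1mx.
Qed.

(** The rule [uEXF] inside the module. It is proved on the matrices because E^p = 0, and with it the
    action of U, is deduced from it. *)
Lemma mxEXF_e k b a : mxEop ^+ k *m evec b.+1 a = mxF *m (mxEop ^+ k *m evec b a)
  + (qint q k / qbrace q 1 * (weight b a * q ^+ k / q - (weight b a * q ^+ k / q)^-1))
    *: (mxEop ^+ k.-1 *m evec b a).
Proof.
elim: k => [|k ih]; first by rewrite qint0 !mul0r scale0r addr0 !mul1mx mxF_e.
rewrite mxX_e ih mulmxDr -scalemxAr [mxEop *m (mxF *m _)]mulmxA mxEF mulmxDl -mulmxA.
rewrite -mxX_e -addrA; congr (_ + _).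
have -> : qint q k / qbrace q 1 * (weight b a * q ^+ k / q - (weight b a * q ^+ k / q)^-1)
    *: (mxEop *m (mxEop ^+ k.-1 *m evec b a)) =
  qint q k / qbrace q 1 * (weight b a * q ^+ k / q - (weight b a * q ^+ k / q)^-1)
    *: (mxEop ^+ k *m evec b a).
  by case: k {ih} => [|k]; rewrite ?qint0 ?mul0r ?scale0r // -mxX_e.
rewrite -scalemxAl mulmxBl !mulmxA mxEXK mxEXK' -!scalemxAl -!mulmxA mxK_e mxK'_e.
rewrite -!scalemxAr !scalerA -scalerBl scalerA -scalerDl /=; congr (_ *: _).
rewrite /qint /qbrace !exprS expr0 !mulr1.
have := weight_neq0 b a; move: (weight b a) => W W0.
have qb : q ^+ k != 0 by rewrite expf_neq0.
have q1' : q ^+ 2 - 1 != 0.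
  rewrite subr_eq0; apply/eqP => q21.
  by have := prim_order_dvd qp 1; rewrite q21 expr1n eqxx dvdn1 (gtn_eqF p1).
rewrite mulnC exprM expr2.
by field; rewrite q1' W0 qb q0.
Qed.

(* E^p commutes with F because [p] = 0, and it kills the vectors e 0 a. *)
Lemma mxEp : mxEop ^+ p = 0.
Proof.
apply: evec_ext => b a; rewrite mul0mx; elim: b => [|b ih].
  by rewrite mxEX_0 evec0 // leq_addl orbT.
by rewrite mxEXF_e ih mulmx0 (qint_p qp) !mul0r scale0r addr0.
Qed.

Definition proj_gen (g : ugen) : 'M[C]_n :=
  match g with gK => mxK | gKi => mxK' | gE => mxEop | gF => mxF end.

Lemma proj_rel t u : urel q p t u ->
  aeval (1%:M : 'M_n) (@mulmx C n n n) proj_gen t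
  = aeval (1%:M : 'M_n) (@mulmx C n n n) proj_gen u.
Proof.
have evX v k : aeval (1%:M : 'M_n) (@mulmx C n n n) proj_gen (Pow v k)
    = aeval (1%:M : 'M_n) (@mulmx C n n n) proj_gen v ^+ k.
  by elim: k => [|k ih]; rewrite /= ?scale1r // ih exprS.
case; rewrite ?evX /= ?scale1r ?scale0r.
- exact: mxKK'.
- exact: mxK'K.
- by rewrite mulmxA mxKE -scalemxAl -mulmxA mxKK' mulmx1 -scalemxAl mul1mx.
- by rewrite mulmxA mxKF -scalemxAl -mulmxA mxKK' mulmx1 -scalemxAl mul1mx.
- by rewrite -!scalemxAl !mul1mx mxEF !scaleN1r addrC addKr.
- by apply: evec_ext => b a; rewrite mxKX_e wp scale1r mul1mx.
- exact: mxEp.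
- apply: evec_ext => b a; rewrite mxFX_e mul0mx evec0 //.
  by rewrite leq_addl.
Qed.

Definition proj_umod : umod q p := umod_of proj_rel.
End Projective.

(** * The monomials span U *)

Section Span.
Variables (C : fieldType) (q : C) (p : nat).
Hypothesis qp : p.-primitive_root (q ^+ 2).
Hypothesis p1 : (1 < p)%N.
Let q0 := q_neq0 qp.
Let q1 := qbrace1_neq0 qp p1.
Local Notation U := (uq q p).
Local Notation K := (pgen (urel q p) gK).
Local Notation K' := (pgen (urel q p) gKi).
Local Notation E := (pgen (urel q p) gE).
Local Notation F := (pgen (urel q p) gF).

Lemma uKi_pow : K' = K ^+ p.-1.
Proof.
by rewrite -[RHS]mul1r -(uKiK q p) -mulrA -exprS (prednK (p_gt0 qp)) uKp mulr1.
Qed.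

Definition vanish (h : U -> C^o) :=
  forall a b c, h (E ^+ a * F ^+ b * K ^+ c) = 0.

(** A dual form of the fact that the span of the monomials E^a F^b K^c is a left ideal: forms
    vanishing on it stay so under translation by [x]. As 1 is a monomial, such a form is zero. Only
    left multiplication by F needs more than reordering, namely [uEXF]. *)
Lemma vanish_mul (x : U) (h : U -> C^o) :
  linear h -> vanish h -> vanish (fun y => h (x * y)).
Proof.
elim/palg_ind: x h => [k|g|x y ihx ihy|x y ihx ihy] h hl hv a b c.
- by rewrite -pscaleAl mul1r (linZ hl) hv scaler0.
- have hK b' c' a' : h (E ^+ a' * (K * (F ^+ b' * K ^+ c'))) = 0.
    rewrite [K * _]mulrA -{1}[K]expr1 uKXF -pscaleAl -pscaleAr (linZ hl).
    by rewrite -[_ * K ^+ 1 * _]mulrA -exprD mulrA hv scaler0.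
  have hK' b' c' a' : h (E ^+ a' * (K' * (F ^+ b' * K ^+ c'))) = 0.
    rewrite [K' * _]mulrA (uKiXF _ q0) -pscaleAl -pscaleAr (linZ hl).
    by rewrite -[_ * K' * _]mulrA uKi_pow -exprD mulrA hv scaler0.
  case: g.
  + rewrite !mulrA -{1}[K]expr1 uKXE -!pscaleAl (linZ hl) expr1 -!mulrA.
    by rewrite hK scaler0.
  + by rewrite !mulrA (uKiXE _ q0) -!pscaleAl (linZ hl) -!mulrA hK' scaler0.
  + by rewrite !mulrA -exprS hv.
  + case: a => [|a]; first by have := hv 0%N b.+1 c; rewrite !expr0 !mul1r mulrA -exprS.
    have FE : F * E ^+ a.+1 = E ^+ a.+1 * F - (qint q a.+1 / (q - q^-1)) *:
        (q ^+ a *: (E ^+ a * K) - q ^- a *: (E ^+ a * K')).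
      by rewrite (uEXF _ q0 q1) addrK.
    rewrite !mulrA FE !mulrBl (linB hl) -!pscaleAl (linZ hl) !mulrBl (linB hl).
    rewrite -!pscaleAl !(linZ hl) -!mulrA [F * (_ * _)]mulrA -exprS hK hK'.
    rewrite !scaler0 subr0 scaler0 subr0.
    by rewrite mulrA hv.
- by rewrite mulrDl (linD hl) ihx // ihy // addr0.
- rewrite -mulrA.
  have hl' : linear (fun z => h (x * z)) by apply: (comp_lin hl (mull_lin x)).
  (* The hypothesis for [y] is applied to the form already translated by [x]; this is why the
     induction is over all [h]. *)
  exact: (ihy (fun z => h (x * z)) hl' (ihx h hl hv)).
Qed.

Lemma uK_mod c : K ^+ c = K ^+ (c %% p).
Proof. by rewrite {1}(divn_eq c p) exprD mulnC exprM uKp expr1n mul1r. Qed.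

Lemma eq_on_monomials (f g : U -> C^o) : linear f -> linear g ->
  (forall a b c : 'I_p, f (E ^+ a * F ^+ b * K ^+ c) = g (E ^+ a * F ^+ b * K ^+ c)) ->
  f =1 g.
Proof.
move=> fl gl fg x; apply/eqP; rewrite -subr_eq0; apply/eqP.
pose h y := f y - g y.
have hl : linear h.
  by move=> k y z; rewrite /h fl gl scalerBr opprD addrACA.
have hv : vanish h.
  move=> a b c; rewrite /h.
  have [pa|ap] := leqP p a.
    by rewrite -(subnK pa) exprD uEp mulr0 !mul0r (lin0 fl) (lin0 gl) subrr.
  have [pb|bp] := leqP p b.
    by rewrite -(subnK pb) exprD uFp !mulr0 !mul0r (lin0 fl) (lin0 gl) subrr.
  rewrite uK_mod; have cp : (c %% p < p)%N by rewrite ltn_mod (p_gt0 qp).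
  by rewrite (fg (Ordinal ap) (Ordinal bp) (Ordinal cp)) subrr.
by have := vanish_mul x hl hv 0 0 0; rewrite !mulr1.
Qed.
End Span.

(** * Existence and uniqueness of λ *)

Section Integral.
Variables (C : fieldType) (q : C) (p : nat) (s : C).
Hypothesis qp : p.-primitive_root (q ^+ 2).
Hypothesis p1 : (1 < p)%N.
Local Notation U := (uq q p).
Local Notation K := (pgen (urel q p) gK).
Local Notation E := (pgen (urel q p) gE).
Local Notation F := (pgen (urel q p) gF).
Local Notation PX m := (proj_umod qp p1 m).
Local Notation evec := (@evec C p).

Let N_ltp : (p.-1 < p)%N. Proof. by rewrite (prednK (p_gt0 qp)). Qed.
Definition top_ord : 'I_(p * p) := mxtens_index (Ordinal N_ltp, Ordinal N_ltp).
Definition bot_ord : 'I_(p * p) :=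
  mxtens_index (Ordinal (p_gt0 qp), Ordinal (p_gt0 qp)).

(* Taking the coefficient of F^(p-1) E^(p-1) and summing over m against q^(2m)
   extracts the coefficient of F^(p-1) E^(p-1) K^(p-1). *)
Definition int0 (x : U) : C :=
  normalization q p s / p%:R * \sum_(m < p) q ^+ (2 * m) *
    uact (PX m) x top_ord bot_ord.

Lemma int0_linear : linear (int0 : U -> C^o).
Proof.
move=> k x y; change (int0 (k *: x + y) = k * int0 x + int0 y).
rewrite /int0 mulrCA -mulrDr; congr (_ * _).
rewrite mulr_sumr -big_split; apply: eq_bigr => m _.
by rewrite (uact_linear (PX m)) !mxE mulrDr mulrCA.
Qed.

Definition chosen_lam : {scalar U} :=
  HB.pack int0 (GRing.isLinear.Build C U C *%R int0 int0_linear).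

Lemma uactX m x k : uact (PX m) (x ^+ k) = uact (PX m) x ^+ k.
Proof.
elim: k => [|k ih]; first exact: uact1 (PX m).
by rewrite !exprS (uactM (PX m)) ih.
Qed.

Lemma uact_X_gen m g : uact (PX m) (pgen _ g) = proj_gen q p m g.
Proof. exact: umod_of_gen. Qed.

Lemma uact_bot m x : uact (PX m) x top_ord bot_ord
  = (uact (PX m) x *m evec 0 0) top_ord 0.
Proof.
have -> : evec 0 0 = delta_mx bot_ord 0.
  exact: (evec_ord _ (Ordinal (p_gt0 qp)) (Ordinal (p_gt0 qp))).
by rewrite -colE mxE.
Qed.

Lemma evec_top b a : evec b a top_ord 0 = ((p.-1 == b) && (p.-1 == a))%:R.
Proof. by rewrite mxE mxtens_indexK. Qed.

(** Each E either raises a by one or lowers b by one. To reach a second index of at least a + k in k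
    steps all of them must raise a, so the complicated lowering terms are never seen. *)
Lemma mxEX_lead m k b a (i j : 'I_p) : (b <= i)%N -> (a + k <= j)%N ->
  (mxEop q p m ^+ k *m evec b a) (mxtens_index (i, j)) 0
  = ((i == b :> nat) && (j == (a + k)%N :> nat))%:R.
Proof.
elim: k b a => [|k ih] b a bi aj.
  by rewrite expr0 mul1mx mxE mxtens_indexK addn0.
rewrite exprSr -mulmxA (mxE_e qp) mulmxDr -scalemxAr mxE [X in _ + X]mxE.
have jk : (a + k < j)%N by rewrite -addnS.
rewrite ih ?addSnnS // ih ?(leq_trans (leq_pred b)) ?(ltnW jk) //.
by rewrite (gtn_eqF jk) andbF mulr0 addr0.
Qed.

Lemma weight0 m : weight q m 0 0 = q ^+ (2 * m).
Proof. by rewrite /weight addn0 muln0 divr1. Qed.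

(** On the generating vector K^c contributes q^(2mc). With the weight q^(2m) the sum over m runs
    over powers of w^(c+1), and is nonzero only for c = p-1. *)
Lemma int0_E (x : U) (t : C) c : (forall m, uact (PX m) (x * K ^+ c) *m evec 0 0 =
   q ^+ (2 * m) ^+ c *: (uact (PX m) x *m evec 0 0)) -> 
  (forall m, (uact (PX m) x *m evec 0 0) top_ord 0 = t) -> (c < p)%N ->
  int0 (x * K ^+ c) = normalization q p s * t *+ (c == p.-1).
Proof.
move=> hx ht cp; rewrite /int0.
under eq_bigr do rewrite uact_bot hx mxE ht.
have p0 : p%:R != 0 :> C by exact: prim_root_natf_neq0 qp.
rewrite (eq_bigr (fun m : 'I_p => (q ^+ 2) ^+ (m * c.+1) * t)) => [|m _]; last first.
  by rewrite mulrA -exprM -exprD -exprM; congr (q ^+ _ * _); ring.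
rewrite -mulr_suml (sum_root _ qp).
have -> : (p %| c.+1)%N = (c == p.-1).
  apply/idP/eqP => [/dvdn_leq -/(_ isT) pc|->]; last by rewrite (prednK (p_gt0 qp)).
  by apply/eqP; rewrite -eqSS (prednK (p_gt0 qp)) eqn_leq cp.
case: eqP => _; last by rewrite mul0r mulr0 mulr0n.
by rewrite mulr1n mulrA divfK.
Qed.

(** In the order F^b E^a the generating vector is sent to a basis vector; in the order E^a F^b lower
    terms appear, and [mxEX_lead] shows that the top coefficient ignores them. *)
Lemma int0_chosen : chosen_integral s int0.
Proof.
have mxKXe m c : uact (PX m) (K ^+ c) *m evec 0 0 = q ^+ (2 * m) ^+ c *: evec 0 0.
  by rewrite uactX uact_X_gen mxKX_e weight0.
move=> a b c v.
have tE (t : bool) :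
  normalization q p s * t%:R *+ (c == p.-1 :> nat)
  = normalization q p s *+ (t && (c == p.-1 :> nat)).
  by case: t; case: (c == _ :> nat); rewrite ?mulr1 ?mulr0 ?mul0rn.
split.
  rewrite (@int0_E _ (((a == p.-1 :> nat) && (b == p.-1 :> nat))%:R)) ?tE /v ?andbA //.
    by move=> m; rewrite (uactM (PX m)) -mulmxA mxKXe -scalemxAr.
  move=> m; rewrite (uactM (PX m)) !uactX !uact_X_gen /proj_gen -mulmxA mxFX_e add0n.
  have lt_le (i : 'I_p) : (i <= Ordinal N_ltp)%N by rewrite -ltnS /= (prednK (p_gt0 qp)).
  rewrite /top_ord (mxEX_lead m (lt_le b) (lt_le a : 0 + a <= _)%N) add0n.
  by rewrite andbC ![_ == p.-1 :> nat]eq_sym.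
rewrite (@int0_E _ (((a == p.-1 :> nat) && (b == p.-1 :> nat))%:R)) ?tE /v ?andbA //.
  by move=> m; rewrite (uactM (PX m)) -mulmxA mxKXe -scalemxAr.
move=> m; rewrite (uactM (PX m)) !uactX !uact_X_gen /proj_gen -mulmxA.
rewrite [X in _ *m X](mxEX_0 qp m a 0) mxFX_e !add0n.
by rewrite evec_top andbC ![p.-1 == _]eq_sym.
Qed.

Lemma chosen_integral_uniq (lam : {scalar U}) : chosen_integral s lam -> lam =1 int0.
Proof.
move=> ch; apply: (eq_on_monomials qp p1).
- by move=> k x y; rewrite linearP.
- exact: int0_linear.
by move=> a b c; rewrite (ch a b c).1 (int0_chosen a b c).1.
Qed.
End Integral.

(** * Evaluation of the two tangles *)

Section TensorEntries.
Variable C : fieldType.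
Implicit Types m n d : nat.
Local Notation "[ 'ix' i , j ]" := (mxtens_index (i, j)) (format "[ 'ix'  i ,  j ]").

Lemma cast_ixA m n d (e : (m * (n * d) = m * n * d)%N) i j k :
  cast_ord e [ix i, [ix j, k]] = [ix [ix i, j], k].
Proof. by apply: val_inj; rewrite /= mulnDl mulnA addnA. Qed.

Lemma cast_ix1 d (e : (d = 1 * d)%N) i : cast_ord e i = [ix ord0, i].
Proof. by apply: val_inj. Qed.

Lemma cast_ixr1 m d (e : (m * d = m * 1 * d)%N) i j :
  cast_ord e [ix i, j] = [ix [ix i, ord0], j].
Proof. by apply: val_inj; rewrite /= muln1 addn0. Qed.

Lemma sum_tens (V : nmodType) m n (F : 'I_(m * n) -> V) :
  \sum_k F k = \sum_i \sum_j F [ix i, j].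
Proof.
rewrite pair_big /= (reindex (@mxtens_index m n)) /=.
  by apply: eq_bigr => -[i j].
by exists (@mxtens_unindex m n) => i _; rewrite (mxtens_indexK, mxtens_unindexK).
Qed.

Lemma sum_delta m (i : 'I_m) (F : 'I_m -> C) : \sum_j (i == j)%:R * F j = F i.
Proof.
rewrite (bigD1 i) //= eqxx mul1r big1 ?addr0 // => j ji.
by rewrite eq_sym (negPf ji) mul0r.
Qed.

Lemma head20E m n d (M : 'cV[C]_(m * n)) (v : 'cV[C]_d) i j k :
  (head20 d M *m v) [ix i, [ix j, k]] 0 = M [ix i, j] 0 * v k 0.
Proof.
rewrite mxE; under eq_bigr => l _.
  rewrite castmxE cast_ixA cast_ix1 tensmxE mxE -mulrA.
over.
by rewrite -mulr_sumr sum_delta.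
Qed.

Lemma head02E m n d (M : 'rV[C]_(m * n)) (v : 'cV[C]_(m * (n * d))) k :
  (head02 d M *m v) k 0 = \sum_i \sum_j M 0 [ix i, j] * v [ix i, [ix j, k]] 0.
Proof.
rewrite mxE sum_tens; apply: eq_bigr => i _.
rewrite sum_tens; apply: eq_bigr => j _.
under eq_bigr => l _.
  rewrite castmxE cast_ixA cast_ix1 tensmxE mxE -mulrA.
over.
by rewrite -mulr_sumr sum_delta.
Qed.

Lemma head22E m n m' n' d (M : 'M[C]_(m * n, m' * n')) (v : 'cV[C]_(m' * (n' * d))) i j k :
  (head22 d M *m v) [ix i, [ix j, k]] 0 =
  \sum_i' \sum_j' M [ix i, j] [ix i', j'] * v [ix i', [ix j', k]] 0.
Proof.
rewrite mxE sum_tens; apply: eq_bigr => i' _.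
rewrite sum_tens; apply: eq_bigr => j' _.
under eq_bigr => l _.
  rewrite castmxE !cast_ixA tensmxE mxE -mulrA.
over.
by rewrite -mulr_sumr sum_delta.
Qed.

Lemma keepE m d d' (M : 'M[C]_(d, d')) (v : 'cV[C]_(m * d')) i k :
  (((1%:M : 'M_m) *t M) *m v) [ix i, k] 0
  = (M *m \col_l v [ix i, l] 0) k 0.
Proof.
rewrite mxE sum_tens exchange_big mxE; apply: eq_bigr => l _ /=.
under eq_bigr => j _ do rewrite tensmxE !mxE -mulrA.
by rewrite sum_delta mxE.
Qed.

Lemma swapmxE m n m' (M : 'M[C]_(m * n, m')) i j k :
  (swapmx C m n *m M) [ix i, j] k = M [ix j, i] k.
Proof.
rewrite mxE sum_tens exchange_big (bigD1 i) //= (bigD1 j) //= !mxE !mxtens_indexK !eqxx mul1r.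
rewrite big1 ?addr0 => [|j' jj]; last first.
  by rewrite !mxE !mxtens_indexK /= [j == _]eq_sym (negPf jj) andbF mul0r.
rewrite big1 ?addr0 // => i' ii; rewrite big1 // => j' _.
by rewrite !mxE !mxtens_indexK /= [i == _]eq_sym (negPf ii) mul0r.
Qed.

Lemma mul_swapmxE m n m' (M : 'M[C]_(m', n * m)) i j k :
  (M *m swapmx C m n) k [ix j, i] = M k [ix i, j].
Proof.
rewrite mxE sum_tens (bigD1 i) //= (bigD1 j) //= !mxE !mxtens_indexK !eqxx mulr1.
rewrite big1 ?addr0 => [|j' jj]; last first.
  by rewrite !mxE !mxtens_indexK /= (negPf jj) andbF mulr0.
rewrite big1 ?addr0 // => i' ii; rewrite big1 // => j' _.
by rewrite !mxE !mxtens_indexK /= (negPf ii) mulr0.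
Qed.
End TensorEntries.

(** * Kinks, tangles and the maps j in coordinates *)

Section Evaluation.
Variables (C : fieldType) (q : C) (p : nat).
Hypothesis qp : p.-primitive_root (q ^+ 2).
Hypothesis p1 : (1 < p)%N.
Variable X : nat -> umod q p.
Local Notation "[ 'ix' i , j ]" := (mxtens_index (i, j)) (format "[ 'ix'  i ,  j ]").
Local Notation U := (uq q p).
Local Notation UU := (tensor U U).
Local Notation K := (pgen (urel q p) gK).
Local Notation R := (Rmat q p).
Local Notation Rinv := (Rinv q p).
Local Notation sdim := (sdim X).
Local Notation sact := (sact X).
Local Notation wdim := (wdim X).
Local Notation uX s := (uact (X s)).

Lemma sact_lin a : linear (sact a).
Proof.
case: a => s [] k x y; rewrite /Defs.sact /=; first exact: (uact_linear (X s)).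
by rewrite (antipode_lin qp) (uact_linear (X s)) linearP.
Qed.

Lemma sactM a x y : sact a (x * y) = sact a x *m sact a y.
Proof.
case: a => s []; rewrite /Defs.sact /=; first exact: (uactM (X s)).
by rewrite (antipodeM qp) (uactM (X s)) trmx_mul.
Qed.

Lemma sact1 a : sact a 1 = 1%:M.
Proof.
case: a => s []; rewrite /Defs.sact /=; first exact: (uact1 (X s)).
by rewrite (antipode1 qp) (uact1 (X s)) trmx1.
Qed.

Lemma tens_bilin m n m' n' : bilin (fun (A : 'M[C]_(m, n)) (B : 'M[C]_(m', n')) => A *t B).
Proof.
split=> [B k A A'|A k B B']; apply/matrixP=> i j.
  by rewrite !mxE mulrDl mulrA.
by rewrite !mxE mulrDr mulrCA.
Qed.

Lemma tens11 m n : (1%:M : 'M[C]_m) *t (1%:M : 'M[C]_n) = 1%:M.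
Proof.
apply/matrixP=> k l; case: (mxtens_indexP k) => i j; case: (mxtens_indexP l) => i' j'.
rewrite tensmxE !mxE (can_eq (@mxtens_indexK m n)) xpair_eqE.
by case: (i == i'); case: (j == j'); rewrite ?mulr0 ?mulr1.
Qed.

Definition act2 a b : UU -> 'M[C]_(sdim a * sdim b) :=
  tlift (fun x y : U => sact a x *t sact b y).

Lemma act2_bilin a b : bilin (fun x y : U => sact a x *t sact b y).
Proof. exact: (bilin_comp (tens_bilin _ _ _ _) (@sact_lin a) (@sact_lin b)). Qed.
Lemma act2_lin a b : linear (act2 a b). Proof. exact: tliftL (act2_bilin a b). Qed.
Lemma act2_pure a b x y : act2 a b (x ⊗ y) = sact a x *t sact b y.
Proof. exact: tliftE (act2_bilin a b) x y. Qed.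

Lemma act2M a b s t : act2 a b (s * t) = act2 a b s *m act2 a b t.
Proof.
elim/tensor_ind: s => [x y|s s' hs hs'|c s hs].
- elim/tensor_ind: t => [x' y'|t t' ht ht'|c t ht].
  + by rewrite tpureM !act2_pure !sactM tensmx_mul.
  + by rewrite mulrDr !(linD (act2_lin _ _)) ht ht' mulmxDr.
  + by rewrite -tensor_scaleAr !(linZ (act2_lin _ _)) ht scalemxAr.
- by rewrite mulrDl !(linD (act2_lin _ _)) hs hs' mulmxDl.
- by rewrite -tensor_scaleAl !(linZ (act2_lin _ _)) hs scalemxAl.
Qed.

Lemma act2_flip a b s i j i' j' :
  act2 b a s [ix i, j] [ix i', j'] = act2 a b (tflip s) [ix j, i] [ix j', i'].
Proof.
elim/tensor_ind: s => [x y|s s' hs hs'|c s hs].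
- by rewrite tflip_pure !act2_pure !tensmxE mulrC.
- rewrite (linD (@tflip_lin _ _ _)) !(linD (act2_lin _ _)).
  by rewrite [LHS]mxE [RHS]mxE hs hs'.
- rewrite (linZ (@tflip_lin _ _ _)) !(linZ (act2_lin _ _)).
  by rewrite [LHS]mxE [RHS]mxE hs.
Qed.

Lemma braidingE a b i j k l :
  braiding X a b [ix i, j] [ix k, l] = act2 a b R [ix j, i] [ix k, l].
Proof. by rewrite /braiding swapmxE. Qed.

(** The function [invmx] gives the inverse only for an invertible matrix; the algebraic inverse
    [Rinv] supplies the invertibility as well as the value. *)
Lemma Ract_inv a b : invmx (Ract X a b) = act2 a b Rinv.
Proof.
have RV : Ract X a b *m act2 a b Rinv = 1%:M.
  by rewrite -act2M (RmatV qp p1) act2_pure !sact1 tens11.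
have [RU _] := mulmx1_unit RV.
by rewrite -[LHS]mulmx1 -RV mulmxA mulVmx // mul1mx.
Qed.

Lemma braiding_invE a b i j k l :
  braiding_inv X a b [ix i, j] [ix k, l] = act2 b a Rinv [ix i, j] [ix l, k].
Proof. by rewrite /braiding_inv Ract_inv mul_swapmxE. Qed.

Lemma coevE s w (v : 'cV[C]_(wdim w)) i j k :
  (RT X (tcoev s w) *m v) [ix i, [ix j, k]] 0 = (i == j)%:R * v k 0.
Proof. by rewrite /= (head20E _ v) mxE mxtens_indexK. Qed.

Lemma ev'E s w (v : 'cV[C]_(wdim [:: (s, true), (s, false) & w])) k :
  (RT X (tev' s w) *m v) k 0
  = \sum_i \sum_j uX s K j i * v [ix i, [ix j, k]] 0.
Proof.
rewrite /= (head02E _ v); apply: eq_bigr => i _; apply: eq_bigr => j _.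
by rewrite mxE mxtens_indexK.
Qed.

Lemma RT_keepE a u w (T : tangle u w) (v : 'cV[C]_(wdim (a :: u))) i k :
  (RT X (tkeep a T) *m v) [ix i, k] 0 = (RT X T *m \col_l v [ix i, l] 0) k 0.
Proof. exact: keepE. Qed.

Lemma tposE a b w (v : 'cV[C]_(wdim [:: a, b & w])) i j k :
  (RT X (tpos a b w) *m v) [ix i, [ix j, k]] 0 =
  \sum_i' \sum_j' act2 a b R [ix j, i] [ix i', j'] * v [ix i', [ix j', k]] 0.
Proof.
rewrite /= (head22E _ v); apply: eq_bigr => i' _; apply: eq_bigr => j' _.
by rewrite braidingE.
Qed.

Lemma tnegE a b w (v : 'cV[C]_(wdim [:: a, b & w])) i j k :
  (RT X (tneg a b w) *m v) [ix i, [ix j, k]] 0 =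
  \sum_i' \sum_j' act2 b a Rinv [ix i, j] [ix j', i'] * v [ix i', [ix j', k]] 0.
Proof.
rewrite /= (head22E _ v); apply: eq_bigr => i' _; apply: eq_bigr => j' _.
by rewrite braiding_invE.
Qed.

Lemma tcompE u v w (T : tangle v w) (S : tangle u v) (x : 'cV[C]_(wdim u)) :
  RT X (tcomp T S) *m x = RT X T *m (RT X S *m x).
Proof. by rewrite /= mulmxA. Qed.

(** The partial trace made by a kink: following the strand through its loop composes the second leg
    of R, the pivotal element of the right evaluation and the first leg, in this order. *)
Lemma fold_op_act s u (t : UU) i i' : \sum_j \sum_k
   uX s u k j * act2 (s, true) (s, true) t [ix j, i] [ix i', k]
  = uX s (fold_op u t) i i'.
Proof.
elim/tensor_ind: t => [x y|t t' ht ht'|c t ht].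
- rewrite fold_op_pure !(uactM (X s)) mxE; apply: eq_bigr => j _.
  rewrite mxE mulr_suml; apply: eq_bigr => k _.
  by rewrite act2_pure tensmxE /Defs.sact /=; ring.
- rewrite (linD (fold_op_lin _)) (linD (uact_linear (X s))) mxE -ht -ht' -big_split.
  apply: eq_bigr => j _; rewrite -big_split; apply: eq_bigr => k _.
  by rewrite (linD (act2_lin _ _)) mxE mulrDr.
- rewrite (linZ (fold_op_lin _)) (linZ (uact_linear (X s))) mxE -ht mulr_sumr.
  apply: eq_bigr => j _; rewrite mulr_sumr; apply: eq_bigr => k _.
  by rewrite (linZ (act2_lin _ _)) mxE mulrCA.
Qed.

Lemma fold_act s u (t : UU) i i' : \sum_j \sum_k
   uX s u k j * act2 (s, true) (s, true) t [ix i, j] [ix k, i']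
  = uX s (fold u t) i i'.
Proof.
elim/tensor_ind: t => [x y|t t' ht ht'|c t ht].
- rewrite fold_pure !(uactM (X s)) mxE; apply: eq_bigr => j _.
  rewrite mxE mulr_suml; apply: eq_bigr => k _.
  by rewrite act2_pure tensmxE /Defs.sact /=; ring.
- rewrite (linD (fold_lin _)) (linD (uact_linear (X s))) mxE -ht -ht' -big_split.
  apply: eq_bigr => j _; rewrite -big_split; apply: eq_bigr => k _.
  by rewrite (linD (act2_lin _ _)) mxE mulrDr.
- rewrite (linZ (fold_lin _)) (linZ (uact_linear (X s))) mxE -ht mulr_sumr.
  apply: eq_bigr => j _; rewrite mulr_sumr; apply: eq_bigr => k _.
  by rewrite (linZ (act2_lin _ _)) mxE mulrCA.
Qed.

Let sum_deltaV m (i : 'I_m) (G : 'I_m -> C) : \sum_j (j == i)%:R * G j = G i.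
Proof. by rewrite -(sum_delta i G); apply: eq_bigr => j _; rewrite eq_sym. Qed.

Lemma poskinkE s w (v : 'cV[C]_(wdim ((s, true) :: w))) i r :
  (RT X (poskink s w) *m v) [ix i, r] 0
  = \sum_i' uX s (kink_pos q p) i i' * v [ix i', r] 0.
Proof.
rewrite !tcompE RT_keepE ev'E.
transitivity (\sum_j \sum_k \sum_i' uX s K k j
   * act2 (s, true) (s, true) R [ix j, i] [ix i', k] * v [ix i', r] 0).
  apply: eq_bigr => j _; apply: eq_bigr => k _; rewrite mxE tposE mulr_sumr.
  apply: eq_bigr => i' _.
  under eq_bigr => j' _.
    rewrite RT_keepE coevE mxE mulrCA.
  over.
  by rewrite sum_deltaV mulrA.
rewrite (eq_bigr _ (fun j _ => exchange_big _ _ _ _ _ _)) exchange_big /=.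
apply: eq_bigr => i' _; rewrite -fold_op_act mulr_suml.
by apply: eq_bigr => j _; rewrite mulr_suml.
Qed.

Lemma negkinkE s w (v : 'cV[C]_(wdim ((s, true) :: w))) i r :
  (RT X (negkink s w) *m v) [ix i, r] 0
  = \sum_i' uX s (kink_neg q p) i i' * v [ix i', r] 0.
Proof.
rewrite !tcompE RT_keepE ev'E.
transitivity (\sum_j \sum_k \sum_i' uX s K k j
   * act2 (s, true) (s, true) Rinv [ix i, j] [ix k, i'] * v [ix i', r] 0).
  apply: eq_bigr => j _; apply: eq_bigr => k _; rewrite mxE tnegE mulr_sumr.
  apply: eq_bigr => i' _.
  under eq_bigr => j' _.
    rewrite RT_keepE coevE mxE mulrCA.
  over.
  by rewrite sum_deltaV mulrA.
rewrite (eq_bigr _ (fun j _ => exchange_big _ _ _ _ _ _)) exchange_big /=.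
apply: eq_bigr => i' _; rewrite -fold_act mulr_suml.
by apply: eq_bigr => j _; rewrite mulr_suml.
Qed.

Local Notation "[ 'ix4' i , j , k , l ]" :=
  [ix i, [ix j, [ix k, [ix l, ord0]]]].

Lemma ix4P m n (t : 'I_(m * (m * (n * (n * 1))))) :
  exists i j k l, t = [ix4 i, j, k, l].
Proof.
case: (mxtens_indexP t) => i t1; case: (mxtens_indexP t1) => j t2.
case: (mxtens_indexP t2) => k t3; case: (mxtens_indexP t3) => l o.
by exists i, j, k, l; rewrite [o]ord1.
Qed.

Lemma RT_unlinkE i j k l :
  RT X unlink_tangle [ix4 i, j, k, l] 0
  = uX 0 (kink_pos q p) i j * uX 1 (kink_neg q p) k l.
Proof.
rewrite -[RT X _]mulmx1 /unlink_tangle tcompE poskinkE.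
under eq_bigr => i' _.
  rewrite tcompE coevE tcompE negkinkE.
  under eq_bigr => k' _.
    rewrite coevE mxE eqxx mulr1 mulrC.
  over.
  rewrite sum_deltaV mulrCA.
over.
by rewrite sum_deltaV.
Qed.

(** The two crossings form the double braiding of X_0^* and X_1, and the cups fill in the outer
    indices. The action on the dual strand is the transpose of the antipode; this is where the S of
    [hopf_elt] comes from. *)
Lemma RT_hopfE i j k l :
  RT X hopf_tangle [ix4 i, j, k, l] 0
  = act2 (0%N, false) (1%N, true) (monodromy q p) [ix j, k] [ix i, l].
Proof.
rewrite -[RT X _]mulmx1 /hopf_tangle !tcompE RT_keepE tcompE tposE /monodromy.
rewrite act2M mxE sum_tens exchange_big; apply: eq_bigr => k1 _; apply: eq_bigr => j1 _.
rewrite act2_flip; congr (_ * _).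
rewrite tposE.
under eq_bigr => j' _.
  under eq_bigr => k' _.
    rewrite mxE coevE coevE mxE eqxx mulr1 mulrA mulrC.
  over.
  rewrite sum_deltaV mulrC.
over.
by rewrite sum_delta.
Qed.

Lemma wact_lin w : linear (wact X w).
Proof.
elim: w => [|a w ih] /=.
  move=> k x y; rewrite (counit_lin qp).
  by apply/matrixP=> i j; rewrite !mxE mulrnDl mulrnAr.
apply: comp_lin (Delta_lin qp); apply: tliftL.
exact: (bilin_comp (tens_bilin _ _ _ _) (@sact_lin a) ih).
Qed.

(** The action on a word ends with the counit on the empty word, which the counit axiom removes. *)
Lemma wact1E a x : wact X [:: a] x = sact a x *t (1%:M : 'M_1).
Proof.
rewrite -[x in RHS](counit_Delta qp) /=.
have L1 : linear (fun y : U => sact a y *t (1%:M : 'M[C]_1)).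
  exact: comp_lin ((tens_bilin _ _ _ _).1 _) (@sact_lin a).
have bl : bilin (fun y z : U => sact a y *t ((counit z : C)%:M : 'M_1)).
  exact: (bilin_comp (tens_bilin _ _ _ _) (@sact_lin a) (wact_lin [::])).
apply: (eq_tlinear (tliftL bl) (comp_lin L1 (tliftL (scale_counit_bilin qp U)))).
move=> y z /=; rewrite (tliftE bl) (tliftE (scale_counit_bilin qp U)) (linZ L1).
rewrite -(linZ ((tens_bilin _ _ _ _).2 _)); congr (_ *t _).
by apply/matrixP=> i j; rewrite !mxE mulr_natr.
Qed.

Lemma jmap_bilin y Y : linear (@jmap C q p X Y) -> bilin (fun (x : U) t =>
  castmx (esym (wdim_cat X y (dualcat y (blocks Y))),
          esym (wdim_cat X y (dualcat y (blocks Y))))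
    (wact X y x *t 1%:M)
  *m RT X (cups y (blocks Y)) *m @jmap C q p X Y t).
Proof.
move=> jl; split=> [t k x x'|x k t t'].
  rewrite (wact_lin y) (tens_bilin _ _ _ _).1.
  rewrite -!mulmxA scalemxAl -mulmxDl; congr (_ *m _).
  by apply/matrixP=> i j; rewrite !(mxE, castmxE).
by rewrite jl mulmxDr scalemxAr.
Qed.

Lemma jmap_lin Y : linear (@jmap C q p X Y).
Proof.
elim: Y => [|y Y ih].
  move=> k x y; apply/matrixP=> i j; rewrite !mxE.
  by rewrite mulrnDl mulrnAr.
exact: tliftL (jmap_bilin y ih).
Qed.

Lemma jmap_arcE s Y (x : U) (t : tpow q p (size Y)) i j r :
  jmap X ((x ⊗ t) : tpow q p (size ([:: (s, true)] :: Y))) [ix i, [ix j, r]] 0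
  = uX s x i j * @jmap C q p X Y t r 0.
Proof.
rewrite [jmap _ _](tliftE (@jmap_bilin [:: (s, true)] _ (@jmap_lin Y))) -mulmxA wact1E.
have uE k l r' : (RT X (cups [:: (s, true)] (blocks Y)) *m jmap X t) [ix k, [ix l, r']] 0
    = (k == l)%:R * jmap X t r' 0.
  by rewrite tcompE RT_keepE /= mul1mx mxE coevE.
move: (RT X _ *m _) uE => u uE; rewrite mxE sum_tens.
transitivity (\sum_k uX s x i k * u [ix k, [ix j, r]] 0).
  apply: eq_bigr => k _.
  under eq_bigr => z _.
    rewrite castmxE !cast_ixr1 !tensmxE !mxE mulr1 -mulrA mulrCA.
  over.
  by rewrite sum_delta.
under eq_bigr => k _ do rewrite uE mulrCA.
by rewrite sum_deltaV.
Qed.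

Lemma jmap_pure2E (x y : U) i j k l :
  jmap X (Y := arcs 2) (pure2 x y) [ix4 i, j, k, l] 0 = uX 0 x i j * uX 1 y k l.
Proof.
rewrite [LHS](@jmap_arcE 0 [:: [:: (1%N, true)]]); congr (_ * _).
rewrite [LHS](@jmap_arcE 1 [::] y (1 : C^o)).
by rewrite /= mxE eqxx mulr1.
Qed.

Lemma RT_unlink :
  RT X unlink_tangle = jmap X (Y := arcs 2) (pure2 (kink_pos q p) (kink_neg q p)).
Proof.
apply/matrixP => t o; rewrite [o]ord1; have [i [j [k [l ->]]]] := ix4P t.
by rewrite [LHS]RT_unlinkE [RHS]jmap_pure2E.
Qed.

Lemma RT_hopf : RT X hopf_tangle = jmap X (Y := arcs 2) (hopf_elt q p).
Proof.
apply/matrixP => t o; rewrite [o]ord1; have [i [j [k [l ->]]]] := ix4P t.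
rewrite [LHS]RT_hopfE /hopf_elt.
have jl := comp_lin (@jmap_lin (arcs 2)) (sand_lin qp 1 1 1 1).
elim/tensor_ind: (monodromy q p) => [x y|s s' hs hs'|c s hs].
- rewrite act2_pure tensmxE sand_pure // !(mul1r, mulr1) [RHS]jmap_pure2E.
  by rewrite /Defs.sact /= mxE.
- by rewrite (linD (act2_lin _ _)) (linD jl) [LHS]mxE [RHS]mxE hs hs'.
- by rewrite (linZ (act2_lin _ _)) (linZ jl) [LHS]mxE [RHS]mxE hs.
Qed.
End Evaluation.

(** * The value of J_4 *)

Section Evaluate.
Variables (C : fieldType) (q : C) (p : nat) (s : C).
Hypothesis qp : p.-primitive_root (q ^+ 2).
Hypothesis p1 : (1 < p)%N.
Local Notation U := (uq q p).

Lemma pure2_span (V : lmodType C) (f g : tpow q p 2 -> V) : linear f -> linear g ->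
  (forall x y, f (pure2 x y) = g (pure2 x y)) -> f =1 g.
Proof.
move=> fl gl fg; apply: eq_tlinear => // x.
apply: (@eq_tlinear _ _ _ _ (fun t => f (x ⊗ t)) (fun t => g (x ⊗ t))) => [||y c].
- exact: (comp_lin fl ((tpure_bilin _ _).2 x)).
- exact: (comp_lin gl ((tpure_bilin _ _).2 x)).
have -> : c = c *: (1 : C^o) by rewrite /GRing.scale /= mulr1.
rewrite !(linZ ((tpure_bilin _ _).2 _)) (linZ fl) (linZ gl).
by congr (_ *: _); exact: fg.
Qed.

Lemma lampow_props (lam : U -> C) (laml : linear (lam : U -> C^o)) n :
  linear (@lampow C q p lam n : _ -> C^o) /\
  bilin (fun (x : U) (t' : tpow q p n) => (lam x * @lampow C q p lam n t' : C^o)).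
Proof.
have st n' : linear (@lampow C q p lam n' : _ -> C^o) ->
    bilin (fun (x : U) (t' : tpow q p n') => (lam x * @lampow C q p lam n' t' : C^o)).
  move=> ih; split=> [t k x y|x k t t'].
    have e : lam (k *: x + y) = k * lam x + lam y := laml k x y.
    by rewrite e mulrDl -mulrA.
  have e : lampow lam (k *: t + t') = k * lampow lam t + lampow lam t' := ih k t t'.
  by rewrite e mulrDr mulrCA.
elim: n => [|n [ih ihb]]; first by split => //; exact: st.
have ih' : linear (@lampow C q p lam n.+1 : _ -> C^o) by exact: tliftL ihb.
by split => //; exact: st.
Qed.

Lemma lampow_pure2 (lam : U -> C) (laml : linear (lam : U -> C^o)) x y :
  lampow lam (pure2 x y) = lam x * lam y.
Proof.
rewrite [LHS](tliftE (lampow_props laml 1).2); congr (_ * _).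
by rewrite [LHS](tliftE (lampow_props laml 0).2) /= mulr1.
Qed.

Local Notation lam0 := (@int0 C q p s qp p1).

(* int0 being built from matrix coefficients, int0 ⊗ int0 factors through jmap. *)
Lemma lampow_int0_jmap (t t' : tpow q p 2) :
  (forall X : nat -> umod q p, jmap X (Y := arcs 2) t = jmap X (Y := arcs 2) t') ->
  lampow lam0 t = lampow lam0 t'.
Proof.
move=> tt; pose X m m' (i : nat) := proj_umod qp p1 (if i == 0%N then m else m').
pose b := bot_ord qp; pose a := top_ord qp.
pose ix : 'I_(p * p * (p * p * (p * p * (p * p * 1)))) :=
  mxtens_index (a, mxtens_index (b, mxtens_index (a, mxtens_index (b, ord0)))).
pose f (t : tpow q p 2) : C^o := (normalization q p s / p%:R) ^+ 2 *
  \sum_(m < p) \sum_(m' < p) q ^+ (2 * m) * q ^+ (2 * m') *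
     jmap (X m m') (Y := arcs 2) t ix 0.
suff fE : @lampow C q p lam0 2 =1 f.
  rewrite !fE /f; congr (_ * _); apply: eq_bigr => m _; apply: eq_bigr => m' _.
  by rewrite tt.
apply: (@pure2_span C^o _ f) => [||x y]; first exact: (lampow_props (int0_linear s qp p1) 2).1.
  move=> k u v; rewrite /f -[RHS]/(k * (_ * _) + _ * _) mulrCA -mulrDr; congr (_ * _).
  rewrite mulr_sumr -big_split; apply: eq_bigr => m _.
  rewrite mulr_sumr -big_split; apply: eq_bigr => m' _.
  by rewrite (@jmap_lin _ _ _ qp (X m m') (arcs 2)) !mxE mulrDr mulrCA.
rewrite (lampow_pure2 (int0_linear s qp p1)) /f /int0 mulrACA expr2; congr (_ * _).
rewrite mulr_suml; apply: eq_bigr => m _.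
rewrite mulr_sumr; apply: eq_bigr => m' _.
rewrite [X in _ = _ * X](@jmap_pure2E _ _ _ qp (X m m')) mulrACA //.
Qed.

Section Closed.
Variables (T : tangle (blocks [::]) (blocks (arcs 2))) (M : tpow q p 2).
Hypothesis TM : forall X : nat -> umod q p, RT X T = jmap X (Y := arcs 2) M.
Hypothesis M_inv : forall h : U, adpow h M = (counit h : C) *: M.

(** For any admissible Phi, the elements Phi(1) and [M] have the same image under all [jmap], which
    is all that [lam0] ⊗ [lam0] sees. Conversely [M_inv] makes c |-> c M an intertwiner. *)
Lemma J4_evalP z : J4_eval q p s (@Kirby 2 [::] T) z <-> z = lampow lam0 M.
Proof.
split=> [[lam [Phi [lamC _ PhiE ->]]]|->].
  have -> : (lam : U -> C) = lam0.
    by apply/funext => x; exact: (chosen_integral_uniq qp p1 lamC).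
  apply: lampow_int0_jmap => X; rewrite -(PhiE X) TM.
  by rewrite [X in _ *m X]/(1%:M) mulmx1.
pose phi (c : C^o) : tpow q p 2 := (c : C) *: M.
have phil : linear phi by move=> k x y; rewrite /phi scalerDl scalerA.
pose Phi : {linear C^o -> tpow q p 2} := HB.pack phi
  (GRing.isLinear.Build C C^o (tpow q p 2) *:%R phi phil).
exists (@chosen_lam C q p s qp p1), Phi; split.
- exact: int0_chosen.
- move=> h t; rewrite [LHS]/((counit h * t : C) *: M).
  rewrite [Phi t]/((t : C) *: M) (linZ ((adpow_props qp 2).1.2 h)) M_inv scalerA.
  by rewrite mulrC.
- move=> X t; rewrite TM [Phi t]/((t : C) *: M) (linZ (@jmap_lin _ _ _ qp X (arcs 2))).
  by rewrite [X in _ *m X]/((t : C)%:M) mul_mx_scalar.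
- by rewrite [Phi _](_ : _ = M) //; exact: (scale1r M).
Qed.
End Closed.
End Evaluate.

(** * Reduction to sums of roots of unity *)

Section Values.
Variables (C : fieldType) (q : C) (p : nat) (s : C).
Hypothesis qp : p.-primitive_root (q ^+ 2).
Hypothesis p1 : (1 < p)%N.
Let q0 := q_neq0 qp.
Let q1 := qbrace1_neq0 qp p1.
Local Notation U := (uq q p).
Local Notation UU := (tensor U U).
Local Notation K := (pgen (urel q p) gK).
Local Notation K' := (pgen (urel q p) gKi).
Local Notation E := (pgen (urel q p) gE).
Local Notation F := (pgen (urel q p) gF).
Local Notation N := p.-1.
Local Notation Z := (normalization q p s).
Local Notation lam := (@int0 C q p s qp p1).
Local Notation S := (@antipode C q p).
Local Notation R := (Rmat q p).
Local Notation Rinv := (Rinv q p).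

Let laml : linear (lam : U -> C^o). Proof. exact: int0_linear. Qed.
Let pN : p = N.+1. Proof. by rewrite (prednK (p_gt0 qp)). Qed.
Let N_ltp : (N < p)%N. Proof. by rewrite -pN. Qed.

(** Integer exponents allow differences to be treated by [ring] and reduced modulo p by [W_mod],
    whose witness [z] is the multiple of p left over after N = p-1 is substituted. *)
Definition W (z : int) : C := (q ^+ 2) ^ z.

Let w0 : q ^+ 2 != 0. Proof. by rewrite expf_neq0. Qed.

Lemma WD x y : W (x + y) = W x * W y. Proof. exact: expfzDr. Qed.
Lemma W0 : W 0 = 1. Proof. by []. Qed.
Lemma Wn n : W n%:Z = q ^+ (2 * n). Proof. by rewrite exprM. Qed.
Lemma WN x : W (- x) = (W x)^-1. Proof. by rewrite /W invr_expz. Qed.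
Lemma WX x n : W x ^+ n = W (x * n%:Z).
Proof. by rewrite /W exprnP exprz_exp. Qed.

Lemma W_mod x y z : x = y + p%:Z * z -> W x = W y.
Proof.
move=> ->; rewrite WD.
suff -> : W (p%:Z * z) = 1 by rewrite mulr1.
by rewrite /W -exprz_exp -exprnP (prim_expr_order qp) exp1rz.
Qed.

Lemma W_eq1 x : (W x == 1) = (p %| `|x|)%N.
Proof.
rewrite (prim_order_dvd qp); case: (intP x) => [|n|n] //.
by rewrite abszN WN invr_eq1.
Qed.

Lemma sum_W x : \sum_(b < p) W (x * b%:Z) = if (p %| `|x|)%N then p%:R else 0.
Proof.
rewrite (eq_bigr (fun b : 'I_p => W x ^+ b)) => [|b _]; last by rewrite WX.
rewrite -W_eq1; case: eqP => [->|/eqP x1].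
  by rewrite (eq_bigr (fun=> 1)) ?sumr_const ?card_ord // => b _; rewrite expr1n.
apply: (mulfI (x := W x - 1)); first by rewrite subr_eq0.
rewrite -subrX1 mulr0 WX; apply/eqP; rewrite subr_eq0 W_eq1 abszM.
exact: dvdn_mull.
Qed.

Lemma NZ : N%:Z = p%:Z - 1.
Proof. by rewrite {2}pN intS addrC addKr. Qed.

(** The condition selects the single class of -k modulo p, and (p-1)k is a natural number in that
    class. It collapses each sum in which λ fixes the power of K. *)
Lemma sum_residue (V : nmodType) (G : nat -> V) k : (forall n, G (n + p)%N = G n) ->
  \sum_(c < p) (if (p %| c + k)%N then G c else 0) = G (N * k)%N.
Proof.
move=> Gp; rewrite -(@sum_periodic _ (fun c => if (p %| c + k)%N then G c else 0) p (N * k)).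
  rewrite (bigD1 (Ordinal (p_gt0 qp))) //= add0n.
  rewrite -mulSnr -pN dvdn_mulr // big1 ?addr0 // => -[c cp] /= c0.
  rewrite -addnA -mulSnr -pN dvdn_addl ?dvdn_mulr //.
  case: ifP => // /dvdn_leq pc; move: c0; rewrite -val_eqE /= => c0.
  by have := pc; rewrite lt0n => /(_ c0); rewrite leqNgt cp.
by move=> n; rewrite Gp addnAC dvdn_addl.
Qed.

Let dvd_last c : (p %| c + 1)%N = (c %% p == N)%N.
Proof.
have cp : (c %% p < p)%N by rewrite ltn_mod (p_gt0 qp).
rewrite {1}(divn_eq c p) -addnA dvdn_addr ?dvdn_mull // addn1.
apply/idP/eqP => [/dvdn_leq -/(_ isT) pc|->]; last by rewrite -pN.
by apply/eqP; rewrite -eqSS -pN eqn_leq cp.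
Qed.

Lemma sum4_rev (V : nmodType) (f : nat -> nat -> nat -> nat -> V) :
  \sum_(i < p) \sum_(j < p) \sum_(k < p) \sum_(l < p) f i j k l =
  \sum_(k < p) \sum_(l < p) \sum_(j < p) \sum_(i < p) f i j k l.
Proof.
transitivity (\sum_(i < p) \sum_(k < p) \sum_(j < p) \sum_(l < p) f i j k l).
  by apply: eq_bigr => i _; rewrite exchange_big.
rewrite exchange_big; apply: eq_bigr => k _.
transitivity (\sum_(i < p) \sum_(l < p) \sum_(j < p) f i j k l).
  by apply: eq_bigr => i _; rewrite exchange_big.
by rewrite exchange_big; apply: eq_bigr => l _; rewrite exchange_big.
Qed.

Lemma lam_EF a b c : (a < p)%N -> (b < p)%N ->
  lam (E ^+ a * F ^+ b * K ^+ c) = Z *+ [&& a == N, b == N & (p %| c + 1)%N].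
Proof.
move=> ap bp; rewrite uK_mod; have cp : (c %% p < p)%N by rewrite ltn_mod (p_gt0 qp).
have [-> _] := int0_chosen s qp p1 (Ordinal ap) (Ordinal bp) (Ordinal cp).
by rewrite dvd_last.
Qed.

Lemma lam_FE a b c : (a < p)%N -> (b < p)%N ->
  lam (F ^+ b * E ^+ a * K ^+ c) = Z *+ [&& a == N, b == N & (p %| c + 1)%N].
Proof.
move=> ap bp; rewrite uK_mod; have cp : (c %% p < p)%N by rewrite ltn_mod (p_gt0 qp).
have [_ ->] := int0_chosen s qp p1 (Ordinal ap) (Ordinal bp) (Ordinal cp).
by rewrite dvd_last.
Qed.

Lemma uKF_mono (i a : nat) (x : U) :
  K ^+ i * F ^+ a * x = q ^- (2 * i * a) *: (F ^+ a * (K ^+ i * x)).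
Proof. by rewrite uKXF -pscaleAl mulrA. Qed.
Lemma uKE_mono (i a : nat) (x : U) :
  K ^+ i * E ^+ a * x = q ^+ (2 * i * a) *: (E ^+ a * (K ^+ i * x)).
Proof. by rewrite uKXE -pscaleAl mulrA. Qed.

Lemma mono_pos b c a :
  lam (fold_op K ((K ^+ b * E ^+ a) ⊗ (K ^+ c * F ^+ a)))
  = q ^- (2 * c * a) * q ^+ (2 * (c + b.+1) * a)
    * lam (F ^+ a * E ^+ a * K ^+ (c + b.+1)).
Proof.
rewrite fold_op_pure -[_ * K * _]mulrA [K * (_ * _)]mulrA -exprS uKF_mono.
rewrite [K ^+ c * (_ * _)]mulrA -exprD uKXE -pscaleAr scalerA mulrA.
by rewrite (linZ laml).
Qed.

Lemma mono_neg b c a :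
  lam (fold K ((E ^+ a * K ^+ b) ⊗ (F ^+ a * K ^+ c)))
  = q ^- (2 * b.+1 * a) * lam (E ^+ a * F ^+ a * K ^+ (b.+1 + c)).
Proof.
rewrite fold_pure -[E ^+ a * _ * K]mulrA -exprSr -mulrA [K ^+ _ * (_ * _)]mulrA.
rewrite uKXF -pscaleAl -pscaleAr (linZ laml) -[F ^+ a * _ * _]mulrA -exprD.
by rewrite [_ * (F ^+ a * _)]mulrA.
Qed.

Lemma R_sum (V : lmodType C) (L : UU -> V) : linear L ->
  L R = p%:R^-1 *: \sum_(a < p) \sum_(b < p) \sum_(c < p)
    (theta q a * q ^- (2 * b * c)) *: L ((K ^+ b * E ^+ a) ⊗ (K ^+ c * F ^+ a)).
Proof.
move=> Ll; rewrite /Rmat (linZ Ll) (lin_sum Ll); congr (_ *: _).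
apply: eq_bigr => a _; rewrite (lin_sum Ll); apply: eq_bigr => b _.
rewrite (lin_sum Ll); apply: eq_bigr => c _; rewrite (linZ Ll).
by rewrite /theta !mulrA.
Qed.

(** For maps [L] built from λ, which kills each term of R below the top power a = p-1. *)
Lemma R_sum_top (V : lmodType C) (L : UU -> V) : linear L ->
  (forall a b c, (a < p)%N -> a != N -> L ((K ^+ b * E ^+ a) ⊗ (K ^+ c * F ^+ a)) = 0) ->
  L R = (theta q N / p%:R) *: \sum_(b < p) \sum_(c < p)
    q ^- (2 * b * c) *: L ((K ^+ b * E ^+ N) ⊗ (K ^+ c * F ^+ N)).
Proof.
move=> Ll L0; rewrite R_sum // mulrC -scalerA; congr (_ *: _).
rewrite (bigD1 (Ordinal N_ltp)) //= [X in _ + X]big1 ?addr0 => [|a aN].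
  rewrite scaler_sumr; apply: eq_bigr => b _.
  by rewrite scaler_sumr; apply: eq_bigr => c _; rewrite scalerA.
by rewrite big1 // => b _; rewrite big1 // => c _; rewrite L0 ?scaler0.
Qed.

Lemma Rinv_sum_top (V : lmodType C) (L : UU -> V) : linear L ->
  (forall a b c, (a < p)%N -> a != N -> L ((E ^+ a * K ^+ b) ⊗ (F ^+ a * K ^+ c)) = 0) ->
  L Rinv = (theta' q N / p%:R) *: \sum_(b < p) \sum_(c < p)
    q ^+ (2 * b * c) *: L ((E ^+ N * K ^+ b) ⊗ (F ^+ N * K ^+ c)).
Proof.
move=> Ll L0; rewrite /Rinv /Rdiag' -tensor_scaleAr (linZ Ll) mulrC -scalerA.
congr (_ *: _); rewrite /Rquasi' mulr_suml (lin_sum Ll).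
rewrite (bigD1 (Ordinal N_ltp)) //= [X in _ + X]big1 ?addr0 => [|a aN].
  rewrite -tensor_scaleAl (linZ Ll); congr (_ *: _).
  rewrite /Ksum mulr_sumr (lin_sum Ll); apply: eq_bigr => b _.
  rewrite mulr_sumr (lin_sum Ll); apply: eq_bigr => c _.
  by rewrite -tensor_scaleAr (linZ Ll) tpureM.
rewrite /Ksum mulr_sumr (lin_sum Ll) big1 // => b _.
rewrite mulr_sumr (lin_sum Ll) big1 // => c _.
rewrite -tensor_scaleAr -tensor_scaleAl !(linZ Ll) tpureM L0 ?scaler0 //.
Qed.

Lemma Wn2 a b : q ^+ (2 * a * b) = W (a%:Z * b%:Z).
Proof. by rewrite -mulnA -Wn PoszM. Qed.

Let lam_fold_op : linear (fun t => lam (fold_op K t) : C^o).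
Proof. exact: (comp_lin laml (fold_op_lin K)). Qed.
Let lam_fold : linear (fun t => lam (fold K t) : C^o).
Proof. exact: (comp_lin laml (fold_lin K)). Qed.

(* Half the exponent of q in the Gauss sums giving the framings ±1. *)
Let gauss (b : nat) : int := b%:Z * b%:Z + b%:Z - 1.

Let scaleCE (a : C) (x : C^o) : a *: x = (a * x : C). Proof. by []. Qed.

Lemma lam_kink_pos : lam (kink_pos q p)
  = theta q N * Z / p%:R * \sum_(b < p) W (gauss b).
Proof.
rewrite [LHS](R_sum_top lam_fold_op) => [|a b c ap aN]; last first.
  by rewrite mono_pos lam_FE // (negPf aN) mulr0.
transitivity (theta q N / p%:R * (Z * \sum_(b < p) W (gauss b))); last by ring.
congr (_ * _); rewrite mulr_sumr; apply: eq_bigr => b _.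
(* λ requires c + b + 1 = -1 modulo p. At c = -(b+2), and with N = -1 modulo p, the exponent becomes
   b(b+2) - (b+1) = [gauss b]. *)
pose G (c : nat) := W (- (b%:Z * c%:Z) + b.+1%:Z * N%:Z).
have Gp c : G (c + p)%N = G c.
  by apply: (W_mod (z := - b%:Z)); rewrite PoszD; ring.
transitivity (Z * \sum_(c < p) (if (p %| c + b.+2)%N then G c else 0)).
  rewrite mulr_sumr; apply: eq_bigr => c _.
  rewrite scaleCE mono_pos lam_FE // !eqxx /=.
  have -> : (c + b.+1 + 1 = c + b.+2)%N by rewrite addn1 !addnS.
  case: ifP => _; last by rewrite mulr0n !mulr0.
  rewrite mulr1n !Wn2 -!WN; set x := (X in W X * _); set y := (X in _ * (W X * _ * _)).
  set z := (X in _ * (_ * W X * _)).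
  transitivity (Z * (W x * W y * W z)); first by ring.
  rewrite -!WD; congr (_ * W _); rewrite /x /y /z !PoszD; ring.
congr (_ * _); rewrite sum_residue //; apply: (W_mod (z := - b%:Z * (b%:Z + 2) + b.+1%:Z)).
by rewrite PoszM NZ /gauss !intS; ring.
Qed.

Lemma lam_kink_neg : lam (kink_neg q p)
  = theta' q N * Z / p%:R * \sum_(b < p) W (- gauss b).
Proof.
rewrite [LHS](Rinv_sum_top lam_fold) => [|a b c ap aN]; last first.
  by rewrite mono_neg lam_EF // (negPf aN) mulr0.
transitivity (theta' q N / p%:R * (Z * \sum_(b < p) W (- gauss b))); last by ring.
congr (_ * _); rewrite mulr_sumr; apply: eq_bigr => b _.
pose G (c : nat) := W (b%:Z * c%:Z - b.+1%:Z * N%:Z).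
have Gp c : G (c + p)%N = G c.
  by apply: (W_mod (z := b%:Z)); rewrite PoszD; ring.
transitivity (Z * \sum_(c < p) (if (p %| c + b.+2)%N then G c else 0)).
  rewrite mulr_sumr; apply: eq_bigr => c _.
  rewrite scaleCE mono_neg lam_EF // !eqxx /=.
  have -> : (b.+1 + c + 1 = c + b.+2)%N by rewrite addn1 addnC !addnS.
  case: ifP => _; last by rewrite mulr0n !mulr0.
  rewrite mulr1n !Wn2 -!WN; set x := (X in W X * _); set y := (X in _ * (W X * _)).
  transitivity (Z * (W x * W y)); first by ring.
  by rewrite -!WD.
congr (_ * _); rewrite sum_residue //; apply: (W_mod (z := b%:Z * (b%:Z + 2) - b.+1%:Z)).
by rewrite PoszM NZ /gauss !intS; ring.
Qed.

Lemma expEKi n : (E * K') ^+ n = q ^- (n * n.-1) *: (E ^+ n * K' ^+ n).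
Proof.
elim: n => [|n ih]; first by rewrite !expr0 mul1r invr1 scale1r.
rewrite exprS ih -pscaleAr -mulrA [K' * (_ * _)]mulrA uKiXE // -!pscaleAl -pscaleAr.
rewrite scalerA -invfM -exprD -[E ^+ n * K' * _]mulrA -exprS mulrA -exprS.
by congr (q ^- _ *: _); case: n {ih} => //= n; ring.
Qed.

Lemma expKF n : (K * F) ^+ n = q ^+ (n * n.-1) *: (K ^+ n * F ^+ n).
Proof.
elim: n => [|n ih]; first by rewrite !expr0 mul1r scale1r.
have FK : F ^+ n * K = q ^+ (2 * n) *: (K * F ^+ n).
  by rewrite -[K]expr1 uKXF muln1 scalerA mulfV ?scale1r // expf_neq0.
rewrite exprSr ih -pscaleAl mulrA -[K ^+ n * _ * K]mulrA FK -pscaleAr -pscaleAl.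
rewrite scalerA -exprD [K ^+ n * (K * _)]mulrA -exprSr -mulrA -exprSr.
by congr (q ^+ _ *: _); case: n {ih FK} => //= n; ring.
Qed.

Lemma K'X n : K' ^+ n = K ^+ (N * n).
Proof. by rewrite (uKi_pow qp) -exprM. Qed.

Lemma K'XK n : K' ^+ n * K ^+ n = 1.
Proof. by rewrite -exprMn_comm ?uKiK ?expr1n // /GRing.comm uKiK uKKi. Qed.

Lemma opp_sandwich (x y z : U) n : (- x) ^+ n * y * (- z) ^+ n = x ^+ n * y * z ^+ n.
Proof.
rewrite (exprNn x) (exprNn z) -[_ * x ^+ n * y]mulrA.
rewrite -(commr_sign (x ^+ n * y) n).
have e : (-1) ^+ n * (-1) ^+ n = 1 :> U by rewrite -expr2 sqrr_sign.
by rewrite mulrA -[_ * (-1) ^+ n * (-1) ^+ n]mulrA e mulr1.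
Qed.

(** The signs of S(E)^N and S(F)^N cancel, and so do the powers q^(-N(N-1)) and q^(N(N-1)) from
    reordering (E K')^N and (K F)^N. Inverse powers of K are then rewritten as powers with factor
    N. *)
Lemma antipode_mono b c : S (K ^+ c * F ^+ N * (K ^+ b * E ^+ N)) =
  W (- (b%:Z * N%:Z * N%:Z)) *: (E ^+ N * F ^+ N * K ^+ (N * b + N * c)).
Proof.
rewrite !(antipodeM qp) !(antipodeX qp) !(antipode_genE qp) /=.
rewrite mulrA opp_sandwich expEKi expKF -!pscaleAl -pscaleAr -pscaleAl scalerA.
rewrite mulVf ?expf_neq0 // scale1r.
have -> : E ^+ N * K' ^+ N * K' ^+ b * (K ^+ N * F ^+ N) = E ^+ N * (K' ^+ b * F ^+ N).
  rewrite -!mulrA; congr (_ * _); rewrite !mulrA; congr (_ * _).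
  by rewrite -exprD addnC exprD -mulrA K'XK mulr1.
rewrite !K'X uKXF -pscaleAr -pscaleAl !mulrA -mulrA -exprD.
congr (_ *: _); rewrite Wn2 -WN PoszM; congr W; ring.
Qed.

Lemma mono_snd a a' b c : K ^+ b * E ^+ a' * (K ^+ c * F ^+ a) =
  (q ^+ (2 * b * a') * q ^- (2 * (b + c) * a)) *: (E ^+ a' * F ^+ a * K ^+ (b + c)).
Proof.
rewrite uKE_mono [K ^+ b * (_ * _)]mulrA -exprD uKXF -pscaleAr scalerA.
by rewrite [_ * (F ^+ a * _)]mulrA.
Qed.

Let psi (t : UU) : C^o := lampow lam (sand 1 1 1 1 t).

Let psi_lin : linear psi.
Proof. exact: (comp_lin (lampow_props laml 2).1 (sand_lin qp 1 1 1 1)). Qed.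
Let psi_pure a b : psi (a ⊗ b) = lam (S a) * lam b.
Proof. by rewrite /psi (sand_pure qp) !(mul1r, mulr1) (lampow_pure2 laml). Qed.

Definition two_torsion : C := \sum_(b < p) ((p %| 2 * b)%N)%:R.

Let hopf_exp (b c : nat) : int := 1 + 2 * c%:Z - 2 * b%:Z - 2 * b%:Z * c%:Z.

Lemma hopf_lin_sum : lampow lam (hopf_elt q p) =
  (theta q N * Z / p%:R) ^+ 2 * \sum_(b < p) \sum_(c < p) W (hopf_exp b c).
Proof.
have l1 : linear (fun t => psi (tflip t * R)).
  exact: (comp_lin psi_lin (comp_lin ((tmul_bilin _).1 R) (@tflip_lin _ _ _))).
have l2 (u : UU) : linear (fun t => psi (u * t)).
  exact: (comp_lin psi_lin ((tmul_bilin _).2 u)).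
have mono a a' b c b' c' : (a < p)%N -> (a' < p)%N ->
  psi (((K ^+ c' * F ^+ a') ⊗ (K ^+ b' * E ^+ a'))
       * ((K ^+ b * E ^+ a) ⊗ (K ^+ c * F ^+ a)))
  = lam (S (K ^+ c' * F ^+ a' * (K ^+ b * E ^+ a)))
    * ((q ^+ (2 * b' * a') * q ^- (2 * (b' + c) * a))
       * (Z *+ [&& a' == N, a == N & (p %| b' + c + 1)%N])).
  move=> ap a'p; rewrite tpureM psi_pure mono_snd (linZ laml) lam_EF //.
rewrite [LHS](R_sum_top l1) => [|a' b' c' ap' aN']; last first.
  rewrite tflip_pure (R_sum (l2 _)) big1 ?scaler0 // => a _.
  rewrite big1 // => b _; rewrite big1 // => c _.
  by rewrite mono // (negPf aN') !mulr0 scaler0.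
transitivity (theta q N / p%:R * \sum_(b' < p) \sum_(c' < p) q ^- (2 * b' * c') *
   (theta q N / p%:R * \sum_(b < p) \sum_(c < p) q ^- (2 * b * c) *
   (Z ^+ 2 * (W (- (b%:Z * N%:Z * N%:Z)) * W (b'%:Z * N%:Z) * W (- ((b' + c)%:Z * N%:Z)) *
    ((p %| N * b + N * c' + 1)%N && (p %| b' + c + 1)%N)%:R)))).
  rewrite scaleCE; congr (_ * _); apply: eq_bigr => b' _; apply: eq_bigr => c' _.
  rewrite scaleCE tflip_pure; congr (_ * _).
  rewrite [LHS](R_sum_top (l2 _)) => [|a b c ap aN]; last first.
    by rewrite mono // (negPf aN) /= !andbF !mulr0.
  rewrite scaleCE; congr (_ * _); apply: eq_bigr => b _; apply: eq_bigr => c _.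
  rewrite scaleCE mono // antipode_mono (linZ laml) scaleCE lam_EF // !eqxx /=.
  rewrite !Wn2 -!WN -mulnb natrM -[Z *+ _]mulr_natr -[Z *+ (p %| b' + c + 1)]mulr_natr.
  by ring.
pose e (b' c' b c : nat) : int := - (b'%:Z * c'%:Z) - b%:Z * c%:Z
  - b%:Z * N%:Z * N%:Z + b'%:Z * N%:Z - (b' + c)%:Z * N%:Z.
transitivity ((theta q N * Z / p%:R) ^+ 2 *
    \sum_(b' < p) \sum_(c' < p) \sum_(b < p) \sum_(c < p)
      W (e b' c' b c) * ((p %| N * b + N * c' + 1)%N && (p %| b' + c + 1)%N)%:R).
  rewrite !mulr_sumr; apply: eq_bigr => b' _; rewrite !mulr_sumr; apply: eq_bigr => c' _.
  rewrite !mulr_sumr; apply: eq_bigr => b _; rewrite !mulr_sumr; apply: eq_bigr => c _.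
  by rewrite /e !WD !Wn2 -!WN; ring.
congr (_ * _).
(* The two divisibilities force c' = 1 - b and b' = -(c+1) modulo p. The reordering makes b' and c'
   the inner variables, to be eliminated by [sum_residue]. *)
rewrite (sum4_rev (fun b' c' b c =>
  W (e b' c' b c) * ((p %| N * b + N * c' + 1)%N && (p %| b' + c + 1)%N)%:R)).
apply: eq_bigr => b _; apply: eq_bigr => c _.
transitivity (\sum_(c' < p) if (p %| c' + (b + N))%N then
    \sum_(b' < p) (if (p %| b' + (c + 1))%N then W (e b' c' b c) else 0) else 0).
  apply: eq_bigr => c' _.
  have -> : (p %| N * b + N * c' + 1)%N = (p %| c' + (b + N))%N.
    have dv : (p %| (N * b + N * c' + 1) + (c' + (b + N)))%N.
      apply/dvdnP; exists (b + c' + 1)%N.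
      by rewrite [X in _ = (_ * X)%N]pN mulnS; ring.
    by apply/idP/idP => h; [rewrite -(dvdn_addr _ h)|rewrite -(dvdn_addl _ h)].
  case: ifP => _; last by rewrite big1 // => b' _; rewrite mulr0.
  apply: eq_bigr => b' _; rewrite addnA /=.
  by case: ifP => _; rewrite ?mulr1 ?mulr0.
have ep b' c' n : W (e (b' + p * n)%N c' b c) = W (e b' c' b c).
  apply: (W_mod (z := - (n%:Z * c'%:Z))); rewrite /e !PoszD PoszM; ring.
have ep' b' c' n : W (e b' (c' + p * n)%N b c) = W (e b' c' b c).
  apply: (W_mod (z := - (n%:Z * b'%:Z))); rewrite /e !PoszD PoszM; ring.
have in_sum c' : \sum_(b' < p) (if (p %| b' + (c + 1))%N then W (e b' c' b c) else 0)
    = W (e (N * (c + 1))%N c' b c).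
  rewrite (sum_residue (G := fun b' => W (e b' c' b c))) // => n.
  by have := ep n c' 1%N; rewrite muln1.
under eq_bigr => c' _ do rewrite in_sum.
rewrite (sum_residue (G := fun c' => W (e (N * (c + 1))%N c' b c))) => [|n]; last first.
  by have := ep' (N * (c + 1))%N n 1%N; rewrite muln1.
apply: (W_mod (z := - (c%:Z + 1 + (p%:Z - 2) * (c%:Z + 1) * (b%:Z - 1 + p%:Z))
   - (p%:Z - 2) * b%:Z - c%:Z)).
by rewrite /e /hopf_exp !(PoszM, PoszD) NZ; ring.
Qed.

Let p0 : p%:R != 0 :> C. Proof. exact: prim_root_natf_neq0 qp. Qed.
Let hN := (N * N.-1)./2.

(** The normalization of λ contains the inverse of the fraction {1}^N / [N]! occurring in
    [theta q N]. For [theta'] the sign (-1)^N of (-{1})^N survives. *)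
Lemma theta_norm : theta q N * Z = s * q ^+ hN.
Proof.
rewrite /theta /normalization -/hN.
have := qfact_neq0 qp p1 N_ltp; have : qbrace q 1 ^+ N != 0 by rewrite expf_neq0.
move: (qbrace q 1 ^+ N) (qfact q N) (q ^+ hN) => x y z x0 y0.
by field; rewrite x0 y0.
Qed.

Lemma theta'_norm : theta' q N * Z = (-1) ^+ N * (s * q ^- hN).
Proof.
have e : (- qbrace q 1) ^+ N = (-1) ^+ N * qbrace q 1 ^+ N :> C by exact: exprNn.
rewrite /theta' /normalization -/hN e.
have := qfact_neq0 qp p1 N_ltp; have : qbrace q 1 ^+ N != 0 by rewrite expf_neq0.
move: (qbrace q 1 ^+ N) (qfact q N) (q ^- hN) ((-1) ^+ N) => x y z t x0 y0.
by field; rewrite x0 y0.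
Qed.

(** The exponent is linear in c with slope 2 - 2b, so the sum over c forces 2b = 2 modulo p; then
    W(1-2b) = W(-1). Translating b by one turns the condition into 2b = 0. *)
Lemma sum_hopf_exp :
  \sum_(b < p) \sum_(c < p) W (hopf_exp b c) = p%:R * W (-1) * two_torsion.
Proof.
pose f n : C := (p %| absz (2 - 2 * n%:Z)%R)%N%:R.
transitivity (\sum_(b < p) p%:R * W (-1) * f b).
  apply: eq_bigr => b _.
  transitivity (W (1 - 2 * b%:Z) * \sum_(c < p) W ((2 - 2 * b%:Z) * c%:Z)).
    rewrite mulr_sumr; apply: eq_bigr => c _.
    by rewrite -WD; congr W; rewrite /hopf_exp; ring.
  rewrite sum_W /f -W_eq1; case: eqP => [e|_]; last by rewrite !mulr0.
  have -> : 1 - 2 * b%:Z = (-1) + (2 - 2 * b%:Z) by ring.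
  by rewrite WD e !mulr1 mulrC.
rewrite -mulr_sumr; congr (_ * _); rewrite -(@sum_periodic _ f p 1).
  apply: eq_bigr => b _; rewrite /f PoszD.
  have -> : 2 - 2 * (b%:Z + 1) = - (2 * b)%N%:Z by rewrite PoszM; ring.
  by rewrite abszN.
move=> n; rewrite /f -!W_eq1; congr (_ == _)%:R.
by apply: (W_mod (z := -2)); rewrite PoszD; ring.
Qed.

Lemma hopf_value :
  lampow lam (hopf_elt q p) = s ^+ 2 / p%:R * (q ^+ p) ^+ N * two_torsion.
Proof.
rewrite hopf_lin_sum sum_hopf_exp theta_norm.
(* The exponent of q on the left is N(N-1) - 2 = (N+1)(N-2) = pN - 2p, and q^(2p) = 1. *)
have <- : q ^+ hN ^+ 2 * W (-1) = (q ^+ p) ^+ N.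
  rewrite WN -[W 1]/(q ^+ 2) -!exprM; apply: (mulIf w0); rewrite divfK // -exprD.
  rewrite -[LHS]mulr1 -(expr1n _ 1) -(prim_expr_order qp) expr1 -exprM -exprD.
  congr (q ^+ _).
  have -> : (hN * 2 = N * N.-1)%N.
    rewrite muln2 /hN halfK; case: (N) => // n.
    by rewrite oddM /= andNb subn0.
  have N0 : (0 < N)%N by rewrite -ltnS -pN.
  rewrite [X in (_ + 2 * X)%N]pN [X in (X * N + 2)%N]pN.
  by case: (N) N0 => // n _ /=; ring.
by field.
Qed.

Lemma unlink_value :
  lampow lam (pure2 (kink_pos q p) (kink_neg q p))
  = (-1) ^+ N * (s ^+ 2 / p%:R)
    * \sum_(b < p) (p %| 2 * b)%N%:R * W (b%:Z * (b%:Z + 1)).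
Proof.
rewrite (lampow_pure2 laml) lam_kink_pos lam_kink_neg theta_norm theta'_norm.
(* Translating b by d makes the exponent linear in d: [gauss] (b+d) - [gauss] d = b(b+1) + 2bd. The
   sum over d then selects 2b = 0. *)
have key : (\sum_(b < p) W (gauss b)) * (\sum_(d < p) W (- gauss d))
   = p%:R * \sum_(b < p) (p %| 2 * b)%N%:R * W (b%:Z * (b%:Z + 1)).
  rewrite mulr_sumr.
  transitivity (\sum_(d < p) \sum_(b < p)
      W (b%:Z * (b%:Z + 1)) * W ((2 * b)%N%:Z * d%:Z)).
    apply: eq_bigr => d _; rewrite mulr_suml.
    rewrite -(@sum_periodic _ (fun b => W (gauss b) * W (- gauss d)) p d).
      apply: eq_bigr => b _; rewrite -!WD; congr W.
      by rewrite /gauss !(PoszD, PoszM); ring.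
    move=> n; congr (_ * _); apply: (W_mod (z := 2 * n%:Z + p%:Z + 1)).
    by rewrite /gauss PoszD; ring.
  rewrite exchange_big mulr_sumr; apply: eq_bigr => b _ /=.
  rewrite -mulr_sumr sum_W /=; case: ifP => _; last by rewrite mul0r !mulr0.
  by rewrite mul1r mulrC.
transitivity ((-1) ^+ N * s ^+ 2 / p%:R ^+ 2 *
  ((\sum_(b < p) W (gauss b)) * (\sum_(d < p) W (- gauss d)))); last first.
  rewrite key; move: ((-1) ^+ N) (\sum_(b < p) _) => x y.
  by field.
have qh : q ^+ hN != 0 by rewrite expf_neq0.
move: ((-1) ^+ N) (\sum_(b < p) _) (\sum_(d < p) _) => x y z.
by field; rewrite qh p0.
Qed.
End Values.

(** * Two-torsion modulo p and the cases of r *)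

Lemma sum_two_torsion_odd (C : fieldType) p (f : nat -> C) : odd p ->
  \sum_(b < p) (p %| 2 * b)%N%:R * f b = f 0%N.
Proof.
move=> op; have p0 : (0 < p)%N by case: p op.
rewrite (bigD1 (Ordinal p0)) //= muln0 dvdn0 mul1r big1 ?addr0 // => -[b bp].
rewrite -val_eqE /= => b0; rewrite Gauss_dvdr ?coprimen2 //.
by rewrite gtnNdvd ?lt0n ?mul0r.
Qed.

Lemma sum_two_torsion_even (C : fieldType) h (f : nat -> C) : (0 < h)%N ->
  \sum_(b < 2 * h) (2 * h %| 2 * b)%N%:R * f b = f 0%N + f h.
Proof.
move=> h0; rewrite mul2n -addnn big_split_ord /=; congr (_ + _).
  rewrite (bigD1 (Ordinal h0)) //= addnn -mul2n muln0 dvdn0 mul1r big1 ?addr0 //.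
  move=> -[b bh]; rewrite -val_eqE /= => b0.
  by rewrite dvdn_pmul2l // gtnNdvd ?lt0n ?mul0r.
rewrite (bigD1 (Ordinal h0)) //= addnn -mul2n dvdn_pmul2l // addn0 dvdnn mul1r.
rewrite big1 ?addr0 // => -[b bh]; rewrite -val_eqE /= => b0.
by rewrite dvdn_pmul2l // dvdn_addr // gtnNdvd ?lt0n ?mul0r.
Qed.

Section Final.
Variables (C : fieldType) (q s : C) (r : nat).
Hypothesis qr : r.-primitive_root q.
Hypothesis r3 : (3 <= r)%N.
Local Notation p := (r %/ gcdn r 2)%N.
Hypothesis s2 : s ^+ 2 = (r %/ gcdn r 4)%:R.

Let qp : p.-primitive_root (q ^+ 2).
Proof. by rewrite gcdnC; exact: exp_prim_root. Qed.

Let p1 : (1 < p)%N.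
Proof.
rewrite ltn_divRL ?dvdn_gcdl // mul1n.
have := dvdn_leq (isT : (0 < 2)%N) (dvdn_gcdr r 2) => g2.
exact: leq_ltn_trans g2 r3.
Qed.

Let p0 : p%:R != 0 :> C. Proof. exact: prim_root_natf_neq0 qp. Qed.

(** For r odd both r' and r'' are r; for r = 2k with k odd both are k. *)
Let odd_case : ~~ (4 %| r)%N -> odd p /\ s ^+ 2 = p%:R.
Proof.
move=> r4; case: (boolP (odd r)) => r2.
  have c2 : coprime r 2 by rewrite coprimen2.
  have g4 : gcdn r 4 = 1%N by apply/eqP; exact: (coprimeXr 2 c2).
  by rewrite s2 g4 (eqP c2) divn1.
have d2 : (2 %| r)%N by rewrite dvdn2.
have g2 : gcdn r 2 = 2%N by apply/gcdn_idPr.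
have [k rk] : exists k, r = (2 * k)%N by exists (r %/ 2)%N; rewrite mulnC divnK.
have ok : odd k.
  by move: r4; rewrite rk -[4%N]/(2 * 2)%N dvdn_pmul2l // dvdn2 negbK.
have g4 : gcdn r 4 = 2%N.
  by rewrite rk -[4%N]/(2 * 2)%N -muln_gcdr; have /eqP -> : coprime k 2 by rewrite coprimen2.
by rewrite s2 g2 g4 rk mulKn.
Qed.

(** Here r'' is half of r'. The square of q^p is q^r = 1, and q^p is not 1 since p = r/2 is smaller
    than the order of q. *)
Let even_case h : r = (4 * h)%N ->
  [/\ p = (2 * h)%N, (0 < h)%N, 2 * s ^+ 2 = p%:R & q ^+ p = -1].
Proof.
move=> rh; have h0 : (0 < h)%N by move: r3; rewrite rh; case: (h).
have g2 : gcdn r 2 = 2%N by apply/gcdn_idPr; rewrite rh dvdn_mulr.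
have g4 : gcdn r 4 = 4%N by apply/gcdn_idPr; rewrite rh dvdn_mulr.
have ph : p = (2 * h)%N by rewrite g2 rh -[4%N]/(2 * 2)%N -mulnA mulKn.
split=> //; first by rewrite ph natrM s2 g4 rh mulKn.
have : (q ^+ p) ^+ 2 == 1.
  by rewrite -exprM ph mulnC mulnA -rh (prim_expr_order qr).
rewrite sqrf_eq1 => /orP[|/eqP //]; rewrite -(prim_order_dvd qr) ph rh.
move=> /dvdn_leq; rewrite muln_gt0 h0 => /(_ isT).
by rewrite leq_pmul2r.
Qed.

(** If 4 divides r, the factor 1/2 is compensated by the two solutions of 2b = 0, and q^p = -1 gives
    the sign. Otherwise there is one solution, and p-1 is even, so both signs are 1. *)
Lemma J4_hopf z : J4_eval q p s S2xS2_minus_ball z <-> z = (-1) ^+ p.-1.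
Proof.
rewrite /S2xS2_minus_ball.
rewrite (J4_evalP s qp p1 (fun X => RT_hopf qp X) (hopf_inv qp p1)).
suff -> : lampow (int0 s qp p1) (hopf_elt q p) = (-1) ^+ p.-1 by [].
have two1 : two_torsion C p = \sum_(b < p) (p %| 2 * b)%N%:R * 1.
  by apply: eq_bigr => b _; rewrite mulr1.
rewrite hopf_value two1; case: (boolP (4 %| r)%N) => [/dvdnP[h rh]|/odd_case[op sp]].
  have [ph h0 sp qm] := even_case (etrans rh (mulnC _ _)).
  rewrite qm; have := p0; rewrite -sp ph (sum_two_torsion_even (fun=> 1)) //.
  move: (s ^+ 2) ((-1) ^+ (2 * h).-1) => u t; rewrite mulf_eq0 negb_or.
  by move=> /andP[two0 u0]; field; rewrite u0 two0.
rewrite (sum_two_torsion_odd (fun=> 1) op) mulr1 sp divff // mul1r.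
have [k pk] : exists k, p.-1 = (2 * k)%N.
  exists (p.-1)./2; rewrite mul2n halfK.
  have := op; rewrite -{1}(prednK (ltnW p1)) oddS => /negPf ->.
  by rewrite subn0.
have qp2 : (q ^+ p) ^+ 2 = 1 by rewrite -exprM mulnC exprM (prim_expr_order qp).
by rewrite pk !exprM qp2 sqrrN !expr1n.
Qed.

Lemma J4_unlink z : J4_eval q p s S2twS2_minus_ball z <->
  z = if ~~ (4 %| r)%N then 1 else if (r %% 8 == 4)%N then -1 else 0.
Proof.
rewrite /S2twS2_minus_ball.
rewrite (J4_evalP s qp p1 (fun X => RT_unlink qp p1 X)); last first.
  exact: (adpow_central qp (kink_pos_K qp) (kink_pos_E qp p1) (kink_pos_F qp p1)
    (kink_neg_K qp p1) (kink_neg_E qp p1) (kink_neg_F qp p1)).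
suff -> : lampow (int0 s qp p1) (pure2 (kink_pos q p) (kink_neg q p))
  = if ~~ (4 %| r)%N then 1 else if (r %% 8 == 4)%N then -1 else 0 by [].
rewrite unlink_value; case: (boolP (4 %| r)%N) => [/dvdnP[h rh]|/odd_case[op sp]] /=.
  have [ph h0 sp qm] := even_case (etrans rh (mulnC _ _)).
  have oN : odd p.-1 by rewrite ph; case: (h) h0 => // n _; rewrite mulnS /= mul2n odd_double.
  have Wh : W q h%:Z = -1 by rewrite Wn -ph.
  have sE : s ^+ 2 / p%:R = 2^-1.
    have := p0; rewrite -sp; move: (s ^+ 2) => u; rewrite mulf_eq0 negb_or.
    by move=> /andP[two0 u0]; field; rewrite u0 two0.
  have two0 : 2 != 0 :> C by have := p0; rewrite -sp mulf_eq0 negb_or => /andP[].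
  rewrite sE -signr_odd oN expr1 mulN1r ph.
  rewrite (sum_two_torsion_even (fun b => W q (b%:Z * (b%:Z + 1)))) // mul0r W0.
  (* The two torsion points b = 0 and b = h contribute 1 + (-1)^(h+1), which is 2 or 0 according to
     the parity of h; with the prefactor -1/2 this gives -1 or 0. *)
  have -> : W q (h%:Z * (h%:Z + 1)) = (-1) ^+ h.+1.
    by rewrite -Wh WX intS addrC.
  have -> : (r %% 8 == 4)%N = odd h.
    by rewrite rh -[8%N]/(2 * 4)%N -muln_modl modn2; case: (odd h).
  rewrite -signr_odd oddS; case: (odd h) => /=; last by rewrite expr1 subrr mulr0.
  by rewrite expr0; field.
rewrite (sum_two_torsion_odd (fun b => W q (b%:Z * (b%:Z + 1))) op) mul0r W0 mulr1.
rewrite sp divff // mulr1 -signr_odd.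
have := op; rewrite -{1}(prednK (ltnW p1)) oddS => /negPf ->.
by rewrite expr0.
Qed.
End Final.

(** * The root of unity and the theorem *)

Lemma expr_cis (R : realType) (x : R) n :
  (cos x +i* sin x)%C ^+ n = (cos (x *+ n) +i* sin (x *+ n))%C.
Proof.
elim: n => [|n ih]; first by rewrite expr0 mulr0n cos0 sin0.
rewrite exprS ih mulrS; apply/eqP; rewrite eq_complex /= cosD sinD eqxx /=.
by rewrite addrC.
Qed.

(** For 0 < k < r the k-th power has real part cos(2x) = 1 - 2 sin(x)^2 with x = πk/r strictly
    between 0 and π. As sin(x) > 0, this real part is not 1. *)
Lemma root_e2pi_prim (R : realType) r : (0 < r)%N -> r.-primitive_root (root_e2pi R r).
Proof.
move=> r0; have r0' : 0 < r%:R :> R by rewrite ltr0n.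
apply/andP; split=> //; apply/forallP => i; rewrite unity_rootE; apply/eqP.
rewrite /root_e2pi expr_cis; set y := _ *+ _.
have yE : y = 2 * (pi * (i.+1%:R / r%:R)).
  by rewrite /y -mulr_natr; ring.
have [ir|ir] := eqVneq i.+1 r.
  rewrite ir divff ?gt_eqF // mulr1 mulrC mulr_natr in yE.
  by rewrite yE cos2pi sin2pi eq_complex /= !eqxx.
apply/negP; rewrite eq_complex /= => /andP[/eqP cosy _].
have half : 0 < sin (pi * (i.+1%:R / r%:R) : R).
  apply: sin_gt0_pi; rewrite mulr_gt0 ?pi_gt0 ?divr_gt0 ?ltr0n //=.
  rewrite gtr_pMr ?pi_gt0 // ltr_pdivrMr // mul1r ltr_nat.
  by rewrite ltn_neqAle ir ltn_ord.
move: cosy; rewrite yE mulr_natl cos_mulr2n cos2sin2 => /eqP.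
rewrite -subr_eq0; set t := sin _.
have -> : (1 - t ^+ 2) *+ 2 - 1 - 1 = - (t ^+ 2 *+ 2) by ring.
by rewrite oppr_eq0 mulrn_eq0 expf_eq0 /= gt_eqF.
Qed.

Theorem corollary9p3 (R : realType) (r : nat) (r_ge3 : (3 <= r)%N) :
  (forall z : R[i],
     J4 r S2xS2_minus_ball z <-> z = (-1) ^+ (r %/ gcdn r 2).-1)
  /\
  (forall z : R[i],
     J4 r S2twS2_minus_ball z <->
     z = if ~~ (4 %| r)%N then 1
         else if (r %% 8 == 4)%N then -1 else 0).
Proof.
have qr := root_e2pi_prim R (ltn_trans (isT : 0 < 2)%N r_ge3).
have s2 : ((Num.sqrt (r %/ gcdn r 4)%:R)%:C)%C ^+ 2 = (r %/ gcdn r 4)%:R :> R[i].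
  by rewrite -rmorphXn /= sqr_sqrtr ?ler0n // rmorph_nat.
split=> z; first exact: J4_hopf.
exact: J4_unlink.
Qed.
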